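(* Let $G=\mathrm{Aut}(\mathbb{Q},<)$. For $f\in G$ consider the properties: (1) for all orbitals $O_1,O_2\in\mathcal{O}^*_f$ with $O_1<O_2$ and either $s_f(O_1)=s_f(O_2)=1$ or $s_f(O_1)=s_f(O_2)=-1$, there exists an orbital $O_3\in\mathcal{O}^*_f$ with $O_1<O_3<O_2$ and $s_f(O_3)\neq s_f(O_1)$; (2) $f$ has only finitely many fixed points. Then almost every element of $G$ has properties (1) and (2). Moreover, a conjugacy class of $G$ is non-Haar null if and only if one (equivalently, each) of its elements has properties (1) and (2). Furthermore, every non-Haar null conjugacy class is compact biter, and every non-Haar null conjugacy class whose elements have no rational fixed points is compact catcher.
   Context: $\mathrm{Aut}(\mathbb{Q},<)$ is the group of order-preserving bijections of $\mathbb{Q}$ with the topology of pointwise convergence (a Polish group). For $f\in G$, the set of orbitals is $\mathcal{O}^*_f=\{\mathrm{conv}(\{f^n(r):n\in\mathbb{Z}\}): r\in\mathbb{Q}\}$, where convex hulls are taken relative to $\mathbb{Q}$; orbitals partition $\mathbb{Q}$, and for distinct orbitals $O_1<O_2$ means $p_1<p_2$ for some (equivalently all) $p_1\in O_1,p_2\in O_2$. The parity function $s_f:\mathcal{O}^*_f\to\{-1,0,1\}$ is $s_f(O)=0$ if $O$ is a singleton fixed point, $s_f(O)=1$ if $f(p)>p$ for $p\in O$, and $s_f(O)=-1$ if $f(p)<p$ for $p\in O$. For a Polish group $G$, a Borel set $B\subseteq G$ is Haar null if there is a Borel probability measure $\mu$ on $G$ with $\mu(gBh)=0$ for all $g,h\in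 G$; an arbitrary set is Haar null if it is contained in a Borel Haar null set; ''almost every element has property $P$'' means the set of elements without $P$ is Haar null. A set $A\subseteq G$ is compact catcher if for every compact $K\subseteq G$ there exist $g,h\in G$ with $gKh\subseteq A$; it is compact biter if for every non-empty compact $K\subseteq G$ there exist an open $U$ and $g,h\in G$ with $U\cap K\neq\emptyset$ and $g(U\cap K)h\subseteq A$. *)

(* Defs.v *)
From HB Require Import structures.
From mathcomp Require Import all_boot all_order all_algebra.
From mathcomp Require Import all_classical all_reals all_analysis.

Set Implicit Arguments.
Unset Strict Implicit.
Unset Printing Implicit Defensive.

Import Order.TTheory GRing.Theory Num.Theory.
Local Open Scope classical_set_scope.
Local Open Scope group_scope.

HB.mixin Record isTopologicalGroup G of Group G & PointedTopological G := {
  mulg_continuous : continuous (fun xy : G * G => xy.1 * xy.2 : G) ;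
  invg_continuous : continuous (fun x : G => x^-1 : G) }.

#[short(type="topologicalGroupType")]
HB.structure Definition TopologicalGroup :=
  {G of isTopologicalGroup G & Group G & PointedTopological G}.

Section group_notions.
Context {G : topologicalGroupType}.
Implicit Types A B C K U : set G.

Definition translate (g : G) B (h : G) : set G := [set g * x * h | x in B].

Definition conjugacy_class C :=
  exists f : G, C = [set f ^ g | g in [set: G]].

Definition borel : set (set G) := <<s @open G >>.

Definition borel_haar_null (R : realType) B :=
  borel B /\
  exists mu : probability (g_sigma_algebraType (@open G)) R,
    forall g h : G, mu (translate g B h) = 0%E.

Definition haar_null (R : realType) A :=
  exists2 B, borel_haar_null R B & A `<=` B.

Definition almost_every (R : realType) (P : G -> Prop) :=
  haar_null R [set f | ~ P f].

Definition compact_catcher A :=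
  forall K, compact K -> exists g h : G, translate g K h `<=` A.

Definition compact_biter A :=
  forall K, compact K -> K !=set0 ->
    exists U, exists g h : G,
      [/\ open U, U `&` K !=set0 & translate g (U `&` K) h `<=` A].

End group_notions.

Record autQ := AutQ {
  autQ_fun :> rat -> rat ;
  autQ_bij : bijective autQ_fun ;
  autQ_mono : {mono autQ_fun : x y / (x < y)%R} }.

HB.instance Definition _ := gen_eqMixin autQ.
HB.instance Definition _ := gen_choiceMixin autQ.

Lemma autQ_ext (f g : autQ) : f =1 g -> f = g.
Proof.
case: f g => [f fb fm] [g gb gm] /= /funext fg; case: _ / fg gb gm => gb gm.
by congr AutQ; exact: Prop_irrelevance.
Qed.

Section autQ_group.

Lemma autQ_id_mono : {mono @idfun rat : x y / (x < y)%R}.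
Proof. by []. Qed.

Definition autQ_one := AutQ (inv_bij (fun=> erefl)) autQ_id_mono.

Lemma autQ_comp_mono (f g : autQ) : {mono f \o g : x y / (x < y)%R}.
Proof. by move=> x y; rewrite /= !autQ_mono. Qed.

Definition autQ_mul (f g : autQ) :=
  AutQ (bij_comp (autQ_bij f) (autQ_bij g)) (@autQ_comp_mono f g).

Lemma autQ_inv_subproof (f : autQ) :
  exists g : autQ, cancel f g /\ cancel g f.
Proof.
have [g fg gf] := autQ_bij f.
have gb : bijective g by exists f.
have gm : {mono g : x y / (x < y)%R}.
  by move=> x y; rewrite -[in RHS](gf x) -[in RHS](gf y) autQ_mono.
by exists (AutQ gb gm).
Qed.

Definition autQ_inv (f : autQ) : autQ := sval (cid (autQ_inv_subproof f)).

Lemma autQ_invK (f : autQ) : cancel f (autQ_inv f) /\ cancel (autQ_inv f) f.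
Proof. exact: svalP (cid (autQ_inv_subproof f)). Qed.

Lemma autQ_mulA : associative autQ_mul.
Proof. by move=> f g h; exact: autQ_ext. Qed.

Lemma autQ_mul1 : left_id autQ_one autQ_mul.
Proof. by move=> f; exact: autQ_ext. Qed.

Lemma autQ_mulr1 : right_id autQ_one autQ_mul.
Proof. by move=> f; exact: autQ_ext. Qed.

Lemma autQ_mulV : left_inverse autQ_one autQ_inv autQ_mul.
Proof. by move=> f; apply: autQ_ext => x; exact: (autQ_invK f).1. Qed.

Lemma autQ_mulrV : right_inverse autQ_one autQ_inv autQ_mul.
Proof. by move=> f; apply: autQ_ext => x; exact: (autQ_invK f).2. Qed.

HB.instance Definition _ := isGroup.Build autQ
  autQ_mulA autQ_mul1 autQ_mulr1 autQ_mulV autQ_mulrV.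

End autQ_group.

HB.instance Definition _ := isPointed.Build autQ 1.

(* Pointwise convergence with rat carrying the discrete topology, not the
   order topology of the rationals. *)
HB.instance Definition _ := Topological.copy autQ
  (initial_topology (autQ_fun : autQ -> {ptws rat -> discrete_topology rat})).

Lemma autQ_nbhs1 (f : autQ) (x : rat) : nbhs f [set g : autQ | g x = f x].
Proof.
have c := @initial_continuous _ _
  (autQ_fun : autQ -> {ptws rat -> discrete_topology rat}) f.
have /c := @proj_continuous rat (fun=> discrete_topology rat) x f [set f x]
  (discrete_set1 (f x : discrete_topology rat)).
by [].
Qed.

Lemma autQ_cvg (F : set_system autQ) (f : autQ) : Filter F ->
  (forall x, F [set g : autQ | g x = f x]) -> F --> f.
Proof.
move=> FF Ff A [_ [[C Cop <-] Cf CA]]; apply: filterS CA _.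
pose F' : set_system {ptws rat -> discrete_topology rat} := fmap autQ_fun F.
suff : F' --> (autQ_fun f : {ptws rat -> discrete_topology rat}).
  by apply; exact: open_nbhs_nbhs.
apply/cvg_sup => x B [_ [[D Dop <-] Df DB]].
apply: (@filterS _ F _ _ (autQ_fun @^-1` B)) (Ff x) => g gx; apply: DB.
by rewrite /= [autQ_fun g x]gx.
Qed.

Lemma autQ_mul_continuous :
  continuous (fun fg : autQ * autQ => fg.1 * fg.2 : autQ).
Proof.
move=> [f g]; apply: autQ_cvg => x /=.
exists ([set h : autQ | h (g x) = f (g x)], [set h : autQ | h x = g x]).
  by split; exact: autQ_nbhs1.
by move=> [h k] [/= hg kg]; rewrite /= kg.
Qed.

Lemma autQ_inv_continuous : continuous (fun f : autQ => f^-1 : autQ).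
Proof.
move=> f; have FF := @nbhs_filter autQ f.
apply: autQ_cvg => x /=.
apply: (@filterS _ (nbhs f) _ _ [set g : autQ | autQ_inv g x = autQ_inv f x])
  (autQ_nbhs1 f (autQ_inv f x)) => g /= gf.
by rewrite -[in LHS]((autQ_invK f).2 x) -gf (autQ_invK g).1.
Qed.

HB.instance Definition _ := isTopologicalGroup.Build autQ
  autQ_mul_continuous autQ_inv_continuous.

Definition expgz (G : groupType) (f : G) (n : int) : G :=
  match n with Posz k => f ^+ k | Negz k => f ^- k.+1 end.

Definition convQ (A : set rat) : set rat :=
  [set q | exists a b, [/\ A a, A b & (a <= q <= b)%R]].

Section orbitals.
Variable f : autQ.
Implicit Types O : set rat.

Definition orbital (r : rat) : set rat :=
  convQ [set expgz f n r | n in [set: int]].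

Definition orbitals : set (set rat) := range orbital.

Definition orbital_lt O1 O2 :=
  O1 <> O2 /\ exists p1 p2, [/\ O1 p1, O2 p2 & (p1 < p2)%R].

(* Only meaningful for O in orbitals: the sign of f p - p is then the same for
   all p in O, and the last case is that of a singleton fixed point. *)
Definition parity O : int :=
  if `[< forall p, O p -> (p < f p)%R >] then 1%R
  else if `[< forall p, O p -> (f p < p)%R >] then (-1)%R
  else 0%R.

Definition alternating_orbitals :=
  forall O1 O2, orbitals O1 -> orbitals O2 -> orbital_lt O1 O2 ->
    (parity O1 = 1%R /\ parity O2 = 1%R) \/
    (parity O1 = (-1)%R /\ parity O2 = (-1)%R) ->
    exists O3, [/\ orbitals O3, orbital_lt O1 O3, orbital_lt O3 O2 &
                   parity O3 <> parity O1].

Definition fixed_points : set rat := [set q | f q = q].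

Definition finitely_many_fixed_points := finite_set fixed_points.

End orbitals.

(* Main.v *)
Require Import Defs.
From HB Require Import structures.
From mathcomp Require Import all_boot all_order all_algebra.
From mathcomp Require Import all_classical all_reals all_analysis.
From mathcomp Require Import ring lra zify.

(** A conjugacy class of Aut(Q,<) is determined by the ordered set of orbitals
    with their parities.

    Classes with (1) and (2) are large. Let K be a family of automorphisms with
    finite sets {k x | k in K} and {k^-1 x | k in K}, which fix the fixed points
    of f. A back-and-forth construction yields one g such that every k g has the
    orbital structure of f: it produces a staircase of points (x, g x), every k
    in K labels the points by orbitals of f, and a label only changes on a step
    at which g crosses the graph of k^-1. Condition (1) provides the crossings
    needed to visit a prescribed orbital, and prevents two orbitals of the same
    sign from being confused. Compact sets are such families, which gives the
    compact biter and catcher properties; as every Borel probability measure is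
    tight, the classes are not Haar null.

    Conversely, let f_t for t uniform in [0,1] be a random automorphism such
    that t |-> f_t is increasing, f_t' exceeds f_t for t < t' by a locally
    uniform gap off a finite set, and P(f_t x = y) is at most 2^-(min of the
    indices of x and y). For fixed k, two adjacent orbitals of k f_t with the
    same sign mean that f_t touches k^-1 at an irrational point, which happens
    for at most one t per sign and pair of rational bounds; and k f_t has almost
    surely finitely many fixed points by Borel-Cantelli. *)

Set Implicit Arguments.
Unset Strict Implicit.
Unset Printing Implicit Defensive.

Import Order.TTheory GRing.Theory Num.Theory numFieldNormedType.Exports.
Local Open Scope classical_set_scope.
Local Open Scope ring_scope.

(** * Automorphisms and their orbitals *)

Section integer_powers.
Variable G : groupType.
Implicit Types (f g : G) (m n : int).

Lemma expgzS f n : expgz f (n + 1) = (f * expgz f n)%g.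
Proof.
case: n => [n|[|n]].
- by rewrite -PoszD addn1 /= expgS.
- by rewrite /= expg1 mulgV.
- have -> : Negz n.+1 + 1 = Negz n by lia.
  by rewrite /= (expgSr _ n.+1) invgM mulVKg.
Qed.

Lemma expgzD f m n : expgz f (m + n) = (expgz f m * expgz f n)%g.
Proof.
elim: m => [|m IHm|m IHm]; first by rewrite add0r /= mul1g.
  by rewrite -addn1 PoszD addrAC !expgzS IHm mulgA.
apply: (@mulgI _ f); rewrite mulgA -!expgzS.
have -> : - m.+1%:Z + n + 1 = - m%:Z + n by lia.
by have -> : - m.+1%:Z + 1 = - m%:Z by lia.
Qed.

Lemma expgz1 f : expgz f 1 = f.
Proof. exact: expg1. Qed.

Lemma expgzN f n : expgz f (- n) = ((expgz f n)^-1)%g.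
Proof. by case: n => [[|n]|n] /=; rewrite ?invg1 ?invgK. Qed.

Lemma expgVz f n : expgz (f^-1)%g n = ((expgz f n)^-1)%g.
Proof. by case: n => n /=; rewrite expVgn. Qed.

Lemma expgzJ f g n : expgz (f ^ g)%g n = ((expgz f n) ^ g)%g.
Proof. by case: n => n /=; rewrite ?conjVg conjXg. Qed.

End integer_powers.

Section automorphisms.
Implicit Types (f g : autQ) (n : int) (x y : rat).

Lemma autQ_le_mono f : {mono f : x y / x <= y}.
Proof. by move=> x y; rewrite !leNgt autQ_mono. Qed.

Lemma autQ_inj f : injective f.
Proof. exact: bij_inj (autQ_bij f). Qed.

Lemma autQK f : cancel f (f^-1)%g.
Proof. exact: (autQ_invK f).1. Qed.

Lemma autQVK f : cancel (f^-1)%g f.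
Proof. exact: (autQ_invK f).2. Qed.

Lemma autQM f g x : (f * g)%g x = f (g x).
Proof. by []. Qed.

Lemma autQJ f g x : (f ^ g)%g x = (g^-1)%g (f (g x)).
Proof. by []. Qed.

Lemma autQV_lt f x y : ((f^-1)%g x < y) = (x < f y).
Proof. by rewrite -(autQ_mono f) autQVK. Qed.

Lemma lt_autQV f x y : (x < (f^-1)%g y) = (f x < y).
Proof. by rewrite -(autQ_mono f) autQVK. Qed.

Lemma autQV_le f x y : ((f^-1)%g x <= y) = (x <= f y).
Proof. by rewrite -(autQ_le_mono f) autQVK. Qed.

Lemma le_autQV f x y : (x <= (f^-1)%g y) = (f x <= y).
Proof. by rewrite -(autQ_le_mono f) autQVK. Qed.

Lemma autQV_eq f x y : ((f^-1)%g x == y) = (x == f y).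
Proof. by rewrite -(inj_eq (@autQ_inj f)) autQVK. Qed.

Lemma autQ_of_homo_onto (F : rat -> rat) :
  {homo F : x y / x < y} -> (forall y, exists x, F x = y) ->
  exists f : autQ, f =1 F.
Proof.
move=> F_homo F_onto; have F_mono := le_mono F_homo.
have F_inj : injective F by exact: inc_inj.
have [G GK] := choice F_onto.
have F_bij : bijective F by exists G => // x; apply: F_inj; rewrite GK.
by exists (AutQ F_bij (leW_mono F_mono)).
Qed.

Lemma expgz_ltz f x : x < f x -> {mono (fun n => expgz f n x) : m n / m < n}.
Proof.
move=> x_lt.
have lt_succ n : expgz f n x < expgz f (n + 1) x.
  by rewrite expgzD autQM autQ_mono expgz1.
have lt_add n (d : nat) : expgz f n x < expgz f (n + d.+1%:Z) x.
  elim: d => [|d IHd]; first exact: lt_succ.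
  apply: lt_trans IHd _; have -> : n + d.+2%:Z = n + d.+1%:Z + 1 by lia.
  exact: lt_succ.
apply: leW_mono; apply: le_mono => m n mn.
have -> : n = m + (`|n - m|.-1).+1%:Z by lia.
exact: lt_add.
Qed.

End automorphisms.

Section orbitals.
Implicit Types (f g : autQ) (m n : int) (x y z : rat).

Lemma orbitalP f x y :
  orbital f x y <-> exists m n, expgz f m x <= y <= expgz f n x.
Proof.
split=> [[_ [_ [[m _ <-] [n _ <-] mn]]]|[m [n mn]]]; first by exists m, n.
by exists (expgz f m x), (expgz f n x).
Qed.

Lemma orbital_expgz f n x : orbital f x (expgz f n x).
Proof. by apply/orbitalP; exists n, n; rewrite lexx. Qed.

Lemma orbital_refl f x : orbital f x x.
Proof. exact: (orbital_expgz f 0). Qed.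

Lemma orbital_autQ f x : orbital f x (f x).
Proof. by have := orbital_expgz f 1 x; rewrite expgz1. Qed.

Lemma orbital_sym f x y : orbital f x y -> orbital f y x.
Proof.
move=> /orbitalP[m [n /andP[mx xn]]]; apply/orbitalP; exists (- n), (- m).
by rewrite !expgzN autQV_le le_autQV xn.
Qed.

Lemma orbital_trans f x y z : orbital f x y -> orbital f y z -> orbital f x z.
Proof.
move=> /orbitalP[m [n /andP[mx xn]]] /orbitalP[m' [n' /andP[my yn]]].
apply/orbitalP; exists (m' + m), (n' + n); rewrite !expgzD !autQM.
by rewrite (le_trans _ my) ?autQ_le_mono // (le_trans yn) ?autQ_le_mono.
Qed.

Lemma orbital_convex f x y z w :
  orbital f x y -> orbital f x z -> y <= w <= z -> orbital f x w.
Proof.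
move=> /orbitalP[m [_ /andP[my _]]] /orbitalP[_ [n /andP[_ zn]]] /andP[yw wz].
by apply/orbitalP; exists m, n; rewrite (le_trans my) // (le_trans wz).
Qed.

Lemma orbital_eq f x y : orbital f x y -> orbital f x = orbital f y.
Proof.
move=> xy; apply/seteqP; split=> z; last exact: orbital_trans.
by apply: orbital_trans; exact: orbital_sym.
Qed.

Lemma orbital_sep f x y x' y' : x < y -> ~ orbital f x y ->
  orbital f x x' -> orbital f y y' -> x' < y'.
Proof.
move=> xy nxy xx' yy'; rewrite ltNge; apply/negP => y'x'; apply: nxy.
have [x'y|/ltW yx'] := leP x' y.
  apply: (orbital_trans xx'); apply: orbital_sym.
  by apply: (orbital_convex yy' (orbital_refl f y)); rewrite y'x'.
by apply: (orbital_convex (orbital_refl f x) xx'); rewrite ltW.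
Qed.

Lemma orbital_ltP f x y :
  orbital_lt (orbital f x) (orbital f y) <-> x < y /\ ~ orbital f x y.
Proof.
split=> [[neq [p [q [xp yq pq]]]]|[xy nxy]].
  have nxy : ~ orbital f x y by move/orbital_eq.
  have [//|yx|e] := ltgtP x y; last by rewrite e in neq.
  have nyx : ~ orbital f y x by move/orbital_sym.
  by have := lt_trans pq (orbital_sep yx nyx yq xp); rewrite ltxx.
split; last by exists x, y; split=> //; exact: orbital_refl.
by move=> e; apply: nxy; rewrite e; exact: orbital_refl.
Qed.

Lemma orbitalV f x : orbital (f^-1)%g x = orbital f x.
Proof.
by apply/seteqP; split=> y /orbitalP[m [n mn]]; apply/orbitalP;
  exists (- m), (- n); move: mn; rewrite !expgVz ?expgzN ?invgK.
Qed.

Lemma orbitalJ f g x y : orbital (f ^ g)%g x y <-> orbital f (g x) (g y).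
Proof.
by split=> /orbitalP[m [n mn]]; apply/orbitalP; exists m, n; move: mn;
  rewrite !expgzJ !autQJ autQV_le le_autQV.
Qed.

Lemma orbital_fixed f x y : f x = x -> orbital f x y -> y = x.
Proof.
move=> fx; have fix_expg (n : nat) : (f ^+ n)%g x = x.
  by elim: n => // n IHn; rewrite expgS autQM IHn.
have fix_expgz n : expgz f n x = x.
  case: n => n /=; first exact: fix_expg.
  by apply: (@autQ_inj (f ^+ n.+1)%g); rewrite autQVK fix_expg.
by move=> /orbitalP[m [n]]; rewrite !fix_expgz -eq_le => /eqP.
Qed.

Definition direction f x : int := sgz (f x - x).

Lemma direction_eq1 f x : (direction f x == 1) = (x < f x).
Proof. by rewrite /direction sgz_cp0 subr_gt0. Qed.

Lemma direction_eqN1 f x : (direction f x == -1) = (f x < x).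
Proof. by rewrite /direction sgz_cp0 subr_lt0. Qed.

Lemma direction_eq0 f x : (direction f x == 0) = (f x == x).
Proof. by rewrite /direction sgz_cp0 subr_eq0. Qed.

Lemma direction_eq f g x y : (direction f x == direction g y) =
  ((f x == x) == (g y == y)) && ((x < f x) == (y < g y)).
Proof. by rewrite /direction sgz_eq !subr_eq0 !subr_gt0. Qed.

Lemma directionP f x :
  [\/ direction f x = 1, direction f x = -1 | direction f x = 0].
Proof.
have [xf|fx|e] := ltgtP x (f x).
- by apply: Or31; apply/eqP; rewrite direction_eq1.
- by apply: Or32; apply/eqP; rewrite direction_eqN1.
- by apply: Or33; apply/eqP; rewrite direction_eq0 -e.
Qed.

Lemma directionJ f g x : direction (f ^ g)%g x = direction f (g x).
Proof. by apply/eqP; rewrite direction_eq autQJ autQV_eq lt_autQV !eqxx. Qed.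

Lemma direction_orbital f x y :
  orbital f x y -> direction f x = direction f y.
Proof.
have moves_up u v : orbital f u v -> u < f u -> v < f v.
  move=> /orbitalP[m [n /andP[mv vn]]] uf; rewrite ltNge; apply/negP => fv.
  have fmv i : expgz f (m + i%:Z) u <= v.
    elim: i => [|i IHi]; first by rewrite addr0.
    rewrite -addn1 PoszD addrA expgzS autQM; apply: le_trans fv.
    by rewrite autQ_le_mono.
  have := fmv (absz (n + 1 - m)%R); apply/negP; rewrite -ltNge.
  by apply: le_lt_trans vn _; rewrite expgz_ltz //; lia.
move=> xy; apply/eqP; rewrite direction_eq; apply/andP; split; apply/eqP.
  apply/eqP/eqP => fixed;
    last by rewrite (orbital_fixed fixed (orbital_sym xy)).
  by rewrite (orbital_fixed fixed xy).
by apply/idP/idP; apply: moves_up => //; exact: orbital_sym.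
Qed.

Lemma parity_orbital f x : parity f (orbital f x) = direction f x.
Proof.
rewrite /parity; case: (directionP f x) => dir_x; rewrite dir_x.
- rewrite asboolT // => p xp; rewrite -direction_eq1 -(direction_orbital xp).
  exact/eqP.
- rewrite asboolF.
    rewrite asboolT // => p xp; rewrite -direction_eqN1.
    by rewrite -(direction_orbital xp); exact/eqP.
  by move=> /(_ _ (orbital_refl f x)); rewrite -direction_eq1 dir_x.
- move/eqP: dir_x; rewrite direction_eq0 => /eqP fx.
  by rewrite !asboolF // => /(_ _ (orbital_refl f x)); rewrite fx ltxx.
Qed.

Lemma alternating_orbitalsP f : alternating_orbitals f <->
  forall x y, x < y -> ~ orbital f x y -> direction f x = direction f y ->
    direction f x <> 0 ->
    exists2 z, x < z < y & direction f z <> direction f x.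
Proof.
split=> [alt x y xy nxy eq_dir dir0|alt].
  have [||||_ [[z _ <-] /orbital_ltP[xz _] /orbital_ltP[zy _]]] :=
    alt (orbital f x) (orbital f y); first by exists x.
  - by exists y.
  - exact/orbital_ltP.
  - by rewrite !parity_orbital -eq_dir; case: (directionP f x); auto.
  - by rewrite !parity_orbital; exists z => //; rewrite xz.
move=> _ _ [x _ <-] [y _ <-] /orbital_ltP[xy nxy]; rewrite !parity_orbital.
move=> same; have [||z /andP[xz zy] dir_z] := alt x y xy nxy.
- by case: same => -[-> ->].
- by case: same => -[->].
exists (orbital f z); split; first by exists z.
- by apply/orbital_ltP; split=> // /direction_orbital/esym.
- apply/orbital_ltP; split=> // /direction_orbital e; apply: dir_z.
  by rewrite e; case: same => -[-> ->].
- by rewrite !parity_orbital.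
Qed.

Definition orbital_rep f x : rat := xget 0 (orbital f x).

Lemma orbital_repP f x : orbital f x (orbital_rep f x).
Proof. by apply: xgetPex; exists x; exact: orbital_refl. Qed.

Lemma eq_orbital_rep f x y : orbital f x y -> orbital_rep f x = orbital_rep f y.
Proof. by rewrite /orbital_rep => /orbital_eq ->. Qed.

Lemma orbital_rep_idem f x : orbital_rep f (orbital_rep f x) = orbital_rep f x.
Proof. exact/esym/eq_orbital_rep/orbital_repP. Qed.

End orbitals.

Definition generic_autQ (f : autQ) :=
  alternating_orbitals f /\ finitely_many_fixed_points f.

Lemma generic_autQJ (f g : autQ) : generic_autQ f -> generic_autQ (f ^ g)%g.
Proof.
move=> [/alternating_orbitalsP alt fin]; split.
  apply/alternating_orbitalsP => x y xy nxy; rewrite !directionJ => dir_xy dir0.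
  have [||z /andP[xz zy] dir_z] := alt (g x) (g y) _ _ dir_xy dir0.
  - by rewrite autQ_mono.
  - by move=> /orbitalJ.
  exists ((g^-1)%g z); first by rewrite lt_autQV autQV_lt xz.
  by rewrite directionJ autQVK.
apply: sub_finite_set (finite_image (g^-1)%g fin) => x /= fgx.
exists (g x); last exact: autQK.
by rewrite /fixed_points /= -[in RHS]fgx autQJ autQVK.
Qed.

(** * A criterion for conjugacy *)

Section fundamental_domain.
Variables (f : autQ) (b : rat).
Hypothesis b_lt : b < f b.
Implicit Types (n : int) (x u : rat).

Definition winding x : int :=
  xget 0 [set n | expgz f n b <= x < expgz f (n + 1) b].

Lemma winding_bounds x : orbital f b x ->
  expgz f (winding x) b <= x < expgz f (winding x + 1) b.
Proof.
move=> bx; apply: (xgetPex 0 (P := [set n | expgz f n b <= x < _])).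
move: bx => /orbitalP[m [n /andP[mx xn]]].
have {n xn} [d xd] : exists d : nat, x < expgz f (m + d%:Z) b.
  exists (absz (n + 1 - m)%R); apply: le_lt_trans xn _.
  by rewrite expgz_ltz //; lia.
elim: d => [|d IHd] in m mx xd *; first by rewrite addr0 ltNge mx in xd.
have [xm|mx'] := ltP x (expgz f (m + 1) b); first by exists m => /=; rewrite mx.
apply: (IHd (m + 1)) => //.
by have -> : m + 1 + d%:Z = m + d.+1%:Z by lia.
Qed.

Lemma winding_unique x n :
  expgz f n b <= x < expgz f (n + 1) b -> winding x = n.
Proof.
move=> /andP[nx xn]; have /winding_bounds/andP[wx xw] : orbital f b x.
  by apply/orbitalP; exists n, (n + 1); rewrite nx ltW.
have : n < winding x + 1 by rewrite -(expgz_ltz b_lt); exact: le_lt_trans nx xw.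
have : winding x < n + 1 by rewrite -(expgz_ltz b_lt); exact: le_lt_trans wx xn.
lia.
Qed.

Lemma winding_le x y : orbital f b x -> orbital f b y -> x < y ->
  winding x <= winding y.
Proof.
move=> /winding_bounds/andP[wx _] /winding_bounds/andP[_ yw] xy.
suff : winding x < winding y + 1 by lia.
by rewrite -(expgz_ltz b_lt); apply: le_lt_trans wx (lt_trans xy yw).
Qed.

Lemma winding_expgz n u : b <= u < f b -> winding (expgz f n u) = n.
Proof.
move=> /andP[bu uf]; apply: winding_unique.
by rewrite expgzD autQM expgz1 autQ_le_mono autQ_mono bu.
Qed.

Lemma orbital_expgz_domain n u : b <= u < f b -> orbital f b (expgz f n u).
Proof.
move=> /andP[bu uf]; apply/orbitalP; exists n, (n + 1).
by rewrite expgzD autQM !autQ_le_mono expgz1 bu ltW.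
Qed.

Definition residue x : rat := expgz f (- winding x) x.

Lemma expgz_residue x : expgz f (winding x) (residue x) = x.
Proof. by rewrite /residue expgzN autQVK. Qed.

Lemma residue_bounds x : orbital f b x -> b <= residue x < f b.
Proof.
move=> /winding_bounds/andP[wx xw].
rewrite /residue expgzN le_autQV wx autQV_lt.
by rewrite -[f b]/(expgz f 1 b) -autQM -expgzD.
Qed.

Lemma residue_expgz n u : b <= u < f b -> residue (expgz f n u) = u.
Proof. by move=> bu; rewrite /residue winding_expgz // expgzN autQK. Qed.

Lemma autQ_expgz_residue x :
  f x = expgz f (winding x + 1) (residue x).
Proof. by rewrite addrC expgzD autQM expgz_residue expgz1. Qed.

End fundamental_domain.

Section stretch.
Variables (R : realFieldType) (b b' c c' : R).

Definition stretch (u : R) : R := c + (u - b) * ((c' - c) / (b' - b)).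

Hypotheses (bb' : b < b') (cc' : c < c').

Lemma stretch_lt : {mono stretch : u v / u < v}.
Proof.
by move=> u v; rewrite ltrD2l ltr_pM2r ?ltrD2r // divr_gt0 ?subr_gt0.
Qed.

Lemma stretch_bounds u : b <= u < b' -> c <= stretch u < c'.
Proof.
have stretch_b : stretch b = c by rewrite /stretch; ring.
have stretch_b' : stretch b' = c'.
  by rewrite /stretch; field; rewrite subr_eq0 gt_eqF.
move=> /andP[bu ub']; apply/andP; split; last first.
  by rewrite -[X in _ < X]stretch_b' stretch_lt.
rewrite -[X in X <= _]stretch_b; move: bu; rewrite le_eqVlt.
by move=> /predU1P[<-//|bu]; rewrite ltW // stretch_lt.
Qed.

End stretch.

Lemma stretchK (R : realFieldType) (b b' c c' : R) : b < b' -> c < c' ->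
  cancel (stretch c c' b b') (stretch b b' c c').
Proof.
by move=> bb' cc' u; rewrite /stretch; field; rewrite !subr_eq0 !gt_eqF.
Qed.

Definition orbital_conjugator (h : autQ) b (f : autQ) c (phi : rat -> rat) :=
  [/\ forall x, orbital h b x -> orbital f c (phi x),
      {in orbital h b &, {homo phi : x y / x < y}},
      forall z, orbital f c z -> exists2 x, orbital h b x & phi x = z
    & forall x, orbital h b x -> phi (h x) = f (phi x)].

(* The conjugator is affine from the fundamental domain [b, h b[ to [c, f c[
   and is extended by equivariance. *)
Lemma orbital_conjugator_positive (h f : autQ) (b c : rat) :
  b < h b -> c < f c -> exists phi, orbital_conjugator h b f c phi.
Proof.
move=> b_lt c_lt; pose A := stretch b (h b) c (f c).
pose phi x := expgz f (winding h b x) (A (residue h b x)).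
have A_bounds x : orbital h b x -> c <= A (residue h b x) < f c.
  by move=> /(residue_bounds b_lt); exact: stretch_bounds.
have phi_bounds x : orbital h b x ->
    expgz f (winding h b x) c <= phi x < expgz f (winding h b x + 1) c.
  by move=> /A_bounds; rewrite expgzD autQM autQ_le_mono autQ_mono expgz1.
exists phi; split=> [x bx|x y /set_mem bx /set_mem by_ xy|z cz|x bx].
- exact/orbital_expgz_domain/A_bounds.
- have := winding_le b_lt bx by_ xy; rewrite le_eqVlt => /predU1P[eq_w|lt_w].
    rewrite /phi eq_w autQ_mono stretch_lt //
      -(autQ_mono (expgz h (winding h b x))).
    by rewrite expgz_residue eq_w expgz_residue.
  have /andP[_ phi_x] := phi_bounds _ bx.
  have /andP[phi_y _] := phi_bounds _ by_.
  apply: lt_le_trans phi_x (le_trans _ phi_y).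
  by rewrite leNgt expgz_ltz //; lia.
- have u_bounds : b <= stretch c (f c) b (h b) (residue f c z) < h b.
    by apply: stretch_bounds => //; exact: residue_bounds.
  exists (expgz h (winding f c z) (stretch c (f c) b (h b) (residue f c z))).
    exact: orbital_expgz_domain.
  rewrite /phi winding_expgz // residue_expgz // /A stretchK //.
  exact: expgz_residue.
- rewrite /phi (autQ_expgz_residue h b) winding_expgz ?residue_expgz //;
    try exact: residue_bounds.
  by rewrite expgzS.
Qed.
Lemma orbital_conjugatorV (h f : autQ) (b c : rat) phi :
  orbital_conjugator (h^-1)%g b (f^-1)%g c phi ->
    orbital_conjugator h b f c phi.
Proof.
rewrite /orbital_conjugator !orbitalV => -[maps homo onto equiv].
split=> // x bx; apply: (@autQ_inj (f^-1)%g).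
rewrite -equiv ?autQK //; apply: orbital_trans bx _; exact: orbital_autQ.
Qed.

Lemma orbital_conjugator_exists (h f : autQ) (b c : rat) :
  direction h b = direction f c -> exists phi, orbital_conjugator h b f c phi.
Proof.
case: (directionP h b) => dir_b; rewrite dir_b => /esym/eqP; move/eqP: dir_b.
- by rewrite !direction_eq1; exact: orbital_conjugator_positive.
- rewrite !direction_eqN1 -lt_autQV => hb; rewrite -lt_autQV => fc.
  have [phi conj_phi] := orbital_conjugator_positive hb fc.
  by exists phi; exact: orbital_conjugatorV.
- rewrite !direction_eq0 => /eqP hb /eqP fc; exists (fun=> c).
  split=> [x _|x y /set_mem/(orbital_fixed hb)->
    /set_mem/(orbital_fixed hb)->||//].
  + exact: orbital_refl.
  + by rewrite ltxx.
  + by move=> z /(orbital_fixed fc)->; exists b => //; exact: orbital_refl.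
Qed.

Definition orbital_labelling (h f : autQ) (psi : rat -> rat) :=
  [/\ {homo psi : x y / x <= y},
      forall x, orbital_rep f (psi x) = psi x,
      forall x, direction h x = direction f (psi x),
      forall z, exists x, psi x = orbital_rep f z
    & forall x y, psi x = psi y -> orbital h x y].

Section conjugacy_criterion.
Variables (h f : autQ) (psi : rat -> rat).
Hypothesis alt_f : alternating_orbitals f.
Hypothesis psi_labelling : orbital_labelling h f psi.

(* Otherwise alternation provides a label of another direction between psi x
   and psi y, and by monotonicity it is attained inside the orbital of x. *)
Lemma labelling_orbital x y : orbital h x y -> psi x = psi y.
Proof.
have [psi_homo psi_rep psi_dir psi_onto _] := psi_labelling.
wlog xy : x y / x < y => [hwlog oxy|oxy].
  have [xy|yx|->//] := ltgtP x y; first exact: hwlog.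
  exact/esym/hwlog/orbital_sym.
have := psi_homo _ _ (ltW xy); rewrite le_eqVlt => /predU1P[//|psi_xy].
have npsi : ~ orbital f (psi x) (psi y).
  by move=> /eq_orbital_rep; rewrite !psi_rep => e; rewrite e ltxx in psi_xy.
have dir_psi : direction f (psi x) = direction f (psi y).
  by rewrite -!psi_dir (direction_orbital oxy).
have dir0 : direction f (psi x) <> 0.
  rewrite -psi_dir => /eqP; rewrite direction_eq0 => /eqP hx.
  by rewrite (orbital_fixed hx oxy) ltxx in xy.
have /alternating_orbitalsP alt := alt_f.
have [z /andP[xz zy] dir_z] := alt _ _ psi_xy npsi dir_psi dir0.
have [w psi_w] := psi_onto z; have rep_z := orbital_repP f z.
have lt_psi_w u v : psi u < psi v -> u < v.
  by rewrite !ltNge; apply: contra; exact: psi_homo.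
have xw : psi x < psi w.
  rewrite psi_w; apply: orbital_sep xz _ (orbital_refl _ _) rep_z.
  by move=> /direction_orbital/esym.
have wy : psi w < psi y.
  rewrite psi_w; apply: orbital_sep zy _ rep_z (orbital_refl _ _).
  by move=> /direction_orbital; rewrite -dir_psi.
have oxw : orbital h x w.
  by apply: (orbital_convex (orbital_refl h x) oxy); rewrite !ltW // lt_psi_w.
exfalso; apply: dir_z; rewrite (direction_orbital rep_z) -psi_w -!psi_dir.
by rewrite (direction_orbital oxw).
Qed.

Lemma conjugate_of_labelling : exists g : autQ, h = (f ^ g)%g.
Proof.
have [psi_homo psi_rep psi_dir psi_onto psi_inj] := psi_labelling.
have /choice[phi phiP] b := orbital_conjugator_exists (psi_dir b).
pose G x := phi (orbital_rep h x) x.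
have psi_base x : psi (orbital_rep h x) = psi x.
  exact/esym/labelling_orbital/orbital_repP.
have base_x x : orbital h (orbital_rep h x) x by apply/orbital_sym/orbital_repP.
have G_orbital x : orbital f (psi x) (G x).
  by have [maps _ _ _] := phiP (orbital_rep h x); rewrite -psi_base;
    exact: maps.
have G_homo : {homo G : x y / x < y}.
  move=> x y xy; have [oxy|nxy] := pselect (orbital h x y).
    rewrite /G -(eq_orbital_rep oxy).
    have [_ homo _ _] := phiP (orbital_rep h x).
    by apply: homo => //; apply/mem_set => //;
      exact: orbital_trans (base_x x) oxy.
  have psi_xy : psi x < psi y.
    by rewrite lt_neqAle psi_homo ?ltW // andbT; apply/eqP => /psi_inj.
  apply: (orbital_sep psi_xy _ (G_orbital x) (G_orbital y)) => /eq_orbital_rep.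
  by rewrite !psi_rep => e; rewrite e ltxx in psi_xy.
have G_onto z : exists x, G x = z.
  have [x psi_x] := psi_onto z; have [_ _ onto _] := phiP (orbital_rep h x).
  have [|x' base_x' <-] := onto z.
    by rewrite psi_base psi_x; exact/orbital_sym/orbital_repP.
  by exists x'; rewrite /G -(eq_orbital_rep base_x') orbital_rep_idem.
have [g gE] := autQ_of_homo_onto G_homo G_onto.
exists g; apply: autQ_ext => x; apply: (@autQ_inj g).
rewrite autQJ autQVK !gE /G -(eq_orbital_rep (orbital_autQ h x)).
by have [_ _ _ equiv] := phiP (orbital_rep h x); rewrite equiv.
Qed.

End conjugacy_criterion.

(** * Staircases *)

Lemma finite_set_max d (T : orderType d) (A : set T) : finite_set A ->
  A !=set0 -> exists2 m, A m & forall x, A x -> (x <= m)%O.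
Proof.
move=> /finite_seqP[s ->]; elim: s => [|y s IHs] [x] //= _.
have [[z sz]|s0] := pselect ([set` s] !=set0); last first.
  exists y; first exact: mem_head.
  by move=> z; rewrite /= inE => /predU1P[->//|sz]; case: s0; exists z.
have [m sm m_max] := IHs (ex_intro _ z sz); exists (Order.max y m) => [|w].
  by rewrite /Order.max; case: ifP => _; rewrite /= inE ?eqxx ?sm ?orbT.
by rewrite /= inE le_max => /predU1P[->|/m_max->]; rewrite ?lexx ?orbT.
Qed.

Lemma finite_set_min d (T : orderType d) (A : set T) : finite_set A ->
  A !=set0 -> exists2 m, A m & forall x, A x -> (m <= x)%O.
Proof. exact: (@finite_set_max _ T^d). Qed.

Section gaps_of_finite_sets.
Variable R : realFieldType.
Implicit Types (S : set R) (u m : R).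

Lemma finite_gap_below S u m : finite_set S -> u < m ->
  exists2 c, u < c < m & forall x, S x -> x < m -> x < c.
Proof.
move=> finS um; pose A := [set x | S x /\ x < m] `|` [set u].
have [||b Ab b_max] := @finite_set_max _ _ A.
- rewrite finite_setU; split=> //; apply: sub_finite_set finS => x []//.
- by exists u; right.
have bm : b < m by case: Ab => [[]//|->].
have [bc cm] := midf_lt bm; exists ((b + m) / 2).
  by rewrite cm (le_lt_trans _ bc) // b_max //; right.
by move=> x Sx xm; apply: le_lt_trans bc; apply: b_max; left.
Qed.

Lemma finite_gap_above S m u : finite_set S -> m < u ->
  exists2 c, m < c < u & forall x, S x -> m < x -> c < x.
Proof.
move=> finS mu.
have [||c /andP[uc cm] gap] := @finite_gap_below (-%R @` S) (- u) (- m).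
- exact: finite_image.
- by rewrite ltrN2.
exists (- c); first by rewrite ltrNr cm ltrNl.
by move=> x Sx mx; rewrite ltrNl gap ?ltrN2 //; exists x.
Qed.

Lemma finite_avoid S u m : finite_set S -> u < m ->
  exists2 c, u < c < m & ~ S c.
Proof.
move=> finS um; have [c /andP[uc cm] gap] := finite_gap_below finS um.
have [cd dm] := midf_lt cm; exists ((c + m) / 2);
  first by rewrite dm (lt_trans uc).
by move=> /gap/(_ dm); rewrite ltNge ltW.
Qed.

Lemma lt_dense u m : u < m -> exists c, u < c < m.
Proof.
by move=> um; have [uc cm] := midf_lt um; exists ((u + m) / 2); rewrite uc.
Qed.

End gaps_of_finite_sets.

Definition pointwise_finite X (a : X -> autQ) (K : set X) :=
  forall x, finite_set [set a k x | k in K].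

Section gaps_of_evaluations.
Variables (X : Type) (a : X -> autQ) (K : set X).
Hypothesis fin_a : pointwise_finite a K.
Hypothesis fin_aV : pointwise_finite (fun k => ((a k)^-1)%g) K.

Lemma eval_gap_below y u m : u < m ->
  exists2 c, u < c < m & forall k, K k -> a k y < m -> a k y < c.
Proof.
move=> /(finite_gap_below (fin_a y))[c umc gap].
by exists c => // k Kk; apply: gap; exists k.
Qed.

Lemma eval_gap_above y m u : m < u ->
  exists2 c, m < c < u & forall k, K k -> m < a k y -> c < a k y.
Proof.
move=> /(finite_gap_above (fin_a y))[c umc gap].
by exists c => // k Kk; apply: gap; exists k.
Qed.

Lemma preimage_gap_below x u m : u < m ->
  exists2 c, u < c < m & forall k, K k -> x < a k m -> x < a k c.
Proof.
move=> /(finite_gap_below (fin_aV x))[c umc gap].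
by exists c => // k Kk; rewrite -!autQV_lt; apply: gap; exists k.
Qed.

Lemma preimage_gap_above x m u : m < u ->
  exists2 c, m < c < u & forall k, K k -> a k m < x -> a k c < x.
Proof.
move=> /(finite_gap_above (fin_aV x))[c umc gap].
by exists c => // k Kk; rewrite -!lt_autQV; apply: gap; exists k.
Qed.

End gaps_of_evaluations.

Record gpoint (X : Type) := GPoint {
  gx : rat ;
  gy : rat ;
  glab : X -> rat }.
Arguments GPoint {X}.
HB.instance Definition _ X := gen_eqMixin (gpoint X).

Definition gconst X (x y A : rat) : gpoint X := GPoint x y (fun=> A).
Arguments gconst {X}.

Section staircase_definitions.
Variables (X : Type) (a : X -> autQ) (s : rat -> bool) (P : set rat).
Implicit Types (k : X) (K : set X) (t : gpoint X) (l : seq (gpoint X)).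

(* A point [t] prescribes g (gx t) = gy t for an automorphism g under
   construction, so that [a k] o g maps gx t to a k (gy t), and the interval
   between these two numbers lies in one orbital of [a k] o g.  The label
   [glab t k] names this orbital and [s] gives its direction; [linked] says
   that the intervals of two points overlap. *)
Definition linked k t t' := gx t' <= a k (gy t) \/ a k (gy t') <= gx t.

Definition directed k t :=
  if s (glab t k) then gx t < a k (gy t) else a k (gy t) < gx t.

Definition admissible K t := forall k, K k -> P (glab t k) /\ directed k t.

Definition stays k t t' := glab t k = glab t' k /\ linked k t t'.

Definition switches A B k t t' :=
  [/\ glab t k = A, glab t' k = B, A < B & s A != s B].

Definition gstep K : rel (gpoint X) := fun t t' => `[< [/\ gx t < gx t',
  gy t < gy t' & exists A B, forall k, K k ->
    stays k t t' \/ switches A B k t t'] >].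

Definition staircase K t l :=
  path (gstep K) t l /\ {in t :: l, forall p, admissible K p}.

Definition precedes K : rel (gpoint X) := fun t t' =>
  `[< [/\ gx t < gx t', gy t < gy t' &
          forall k, K k -> glab t k <= glab t' k] >].

End staircase_definitions.

Section staircase_theory.
Variables (X : Type) (a : X -> autQ) (s : rat -> bool) (P : set rat).
Implicit Types (k : X) (D E K : set X) (t p q : gpoint X) (l : seq (gpoint X)).

Local Notation gstep := (gstep a s).
Local Notation admissible := (admissible a s P).
Local Notation staircase := (staircase a s P).

Lemma gstep_intro K A B t t' : gx t < gx t' -> gy t < gy t' ->
  (forall k, K k -> stays a k t t' \/ switches s A B k t t') -> gstep K t t'.
Proof. by move=> xx yy AB; apply/asboolP; split=> //; exists A, B. Qed.

Lemma gstep_precedes K : subrel (gstep K) (precedes K).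
Proof.
move=> t t' /asboolP[xx yy [A [B AB]]]; apply/asboolP; split=> // k Kk.
by case: (AB k Kk) => [[-> _]|[-> -> /ltW]].
Qed.

Lemma precedes_trans K : transitive (@precedes X K).
Proof.
move=> q p r /asboolP[x_pq y_pq lab_pq] /asboolP[x_qr y_qr lab_qr].
apply/asboolP; split=> [||k Kk]; [exact: lt_trans x_qr|exact: lt_trans y_qr|].
exact: le_trans (lab_pq k Kk) (lab_qr k Kk).
Qed.

Lemma gstep_path_precedes K t l p :
  path (gstep K) t l -> p \in l -> precedes K t p.
Proof.
move=> pth pl; have := sub_path (@gstep_precedes K) pth.
by move=> /(order_path_min (@precedes_trans K))/allP; apply.
Qed.

Lemma gstep_path_between K t l t' p : path (gstep K) t (rcons l t') ->
  p \in l -> precedes K t p /\ precedes K p t'.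
Proof.
move=> pth pl; split.
  by apply: gstep_path_precedes pth _; rewrite mem_rcons inE pl orbT.
move: pth; case/splitPr: pl => l1 l2; rewrite rcons_cat cat_path.
move=> /andP[_ /andP[_ pth]]; apply: gstep_path_precedes pth _.
by rewrite mem_rcons mem_head.
Qed.

Lemma gstep_sub K K' : K' `<=` K -> subrel (gstep K) (gstep K').
Proof.
move=> K'K t t' /asboolP[xx yy [A [B AB]]].
by apply: (@gstep_intro _ A B) => // k /K'K; exact: AB.
Qed.

Lemma staircase_sub K K' t l : K' `<=` K -> staircase K t l -> staircase K' t l.
Proof.
move=> K'K [pth adm]; split; first exact: (sub_path (@gstep_sub _ _ K'K)).
by move=> p pl k /K'K; exact: adm.
Qed.

Lemma staircase_cat K t l l' :
  staircase K t l -> staircase K (last t l) l' -> staircase K t (l ++ l').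
Proof.
move=> [pth adm] [pth' adm']; split; first by rewrite cat_path pth.
move=> p; rewrite -cat_cons mem_cat => /orP[/adm//|pl'].
by apply: adm'; rewrite inE pl' orbT.
Qed.

Lemma staircase_cons K t p l : gstep K t p -> admissible K t ->
  staircase K p l -> staircase K t (p :: l).
Proof.
move=> st adm_t [pth adm]; split; first by rewrite /= st.
by move=> q; rewrite inE => /predU1P[->|/adm].
Qed.

Lemma staircase1 K t t' : gstep K t t' -> admissible K t -> admissible K t' ->
  staircase K t [:: t'].
Proof.
move=> st adm_t adm_t'; apply: staircase_cons => //; split=> // q.
by rewrite inE => /eqP->.
Qed.

(* Refining a step for the indices which switch there does not disturb the
   indices which stay. *)
Definition freeze D t p : gpoint X :=
  GPoint (gx p) (gy p) (fun k => if `[< D k >] then glab t k else glab p k).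

Lemma glab_freeze_out D t p k : ~ D k -> glab (freeze D t p) k = glab p k.
Proof. by move=> nDk; rewrite /= asboolF. Qed.

Lemma glab_freeze_in D t p k : D k -> glab (freeze D t p) k = glab t k.
Proof. by move=> Dk; rewrite /= asboolT. Qed.

Lemma map_glab_freeze D t l k : ~ D k ->
  map (@glab X ^~ k) (map (freeze D t) l) = map (@glab X ^~ k) l.
Proof.
by move=> nDk; rewrite -map_comp; apply: eq_map => p; exact: glab_freeze_out.
Qed.

Lemma freeze_id D t p : (forall k, D k -> glab t k = glab p k) ->
  freeze D t p = p.
Proof.
case: p => x y lab /= same; congr GPoint; apply/funext => k.
by case: asboolP => // /same.
Qed.

Section freezing.
Variables (D E : set X) (t t' : gpoint X).
Hypothesis D_stays : forall k, D k -> stays a k t t'.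

Lemma gstep_freeze p q : gx t <= gx p -> gy t <= gy p ->
  gx q <= gx t' -> gy q <= gy t' ->
  gstep E p q -> gstep (E `|` D) (freeze D t p) (freeze D t q).
Proof.
move=> tpx tpy qtx qty /asboolP[xx yy [A [B AB]]].
apply: (@gstep_intro _ A B) => // k EDk.
have [Dk|nDk] := pselect (D k); last first.
  rewrite /stays /switches !glab_freeze_out //; apply: AB.
  by case: EDk.
left; split; first by rewrite !glab_freeze_in.
have [_ [link|link]] := D_stays Dk; [left|right] => /=.
  by rewrite (le_trans qtx) // (le_trans link) // autQ_le_mono.
by rewrite (le_trans _ tpx) // (le_trans _ link) // autQ_le_mono.
Qed.

Lemma admissible_freeze p : admissible D t -> admissible E p ->
  gx t < gx p < gx t' -> gy t < gy p < gy t' ->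
  admissible (E `|` D) (freeze D t p).
Proof.
move=> adm_t adm_p /andP[tpx ptx] /andP[tpy pty] k EDk.
have [Dk|nDk] := pselect (D k); last first.
  by rewrite /directed glab_freeze_out //; apply: adm_p; case: EDk.
have [Pt] := adm_t k Dk; rewrite /directed glab_freeze_in //= => dir_t.
split=> //; move: dir_t; have [_ link] := D_stays Dk.
case: (s _) => dir_t; case: link => link.
- by apply: lt_trans ptx (le_lt_trans link _); rewrite autQ_mono.
- have := le_lt_trans link dir_t.
  by rewrite autQ_mono ltNge ltW // (lt_trans tpy).
- by have := le_lt_trans link dir_t; rewrite ltNge ltW // (lt_trans tpx).
- by apply: lt_trans tpx; apply: lt_le_trans link; rewrite autQ_mono.
Qed.

Lemma staircase_freeze l : admissible D t -> admissible D t' ->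
  staircase E t (rcons l t') ->
  staircase (E `|` D) t (rcons (map (freeze D t) l) t').
Proof.
move=> adm_t adm_t' [pth adm].
have between p : p \in l -> gx t < gx p < gx t' /\ gy t < gy p < gy t'.
  move=> /(gstep_path_between pth)[/asboolP[tx ty _] /asboolP[xt yt _]].
  by rewrite tx ty.
have frz_t : freeze D t t = t by exact: freeze_id.
have frz_t' : freeze D t t' = t' by apply: freeze_id => k /D_stays[].
split.
  rewrite -[t in path _ t]frz_t -frz_t' -map_rcons.
  have [tx ty _] : [/\ gx t < gx t', gy t < gy t' & True].
    have : t' \in rcons l t' by rewrite mem_rcons mem_head.
    by move=> /(gstep_path_precedes pth)/asboolP[].
  pose box := [pred p : gpoint X |
    (gx t <= gx p <= gx t') && (gy t <= gy p <= gy t')].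
  apply: (homo_path_in (P := box)) pth => [p q|].
    move=> /andP[/andP[xp _] /andP[yp _]] /andP[/andP[_ qx] /andP[_ qy]].
    exact: gstep_freeze.
  rewrite /= all_rcons /= !lexx !ltW //=; apply/allP => p /between[].
  by move=> /andP[px xp] /andP[py yp]; rewrite /= !ltW.
move=> p; rewrite inE mem_rcons inE => /or3P[/eqP->|/eqP->|/mapP[q ql ->]].
- by move=> k [Ek|/adm_t//]; exact: adm (mem_head _ _) k Ek.
- move=> k [Ek|/adm_t'//]; apply: adm Ek.
  by rewrite inE mem_rcons mem_head orbT.
- have [xq yq] := between q ql; apply: admissible_freeze => //.
  by apply: adm; rewrite inE mem_rcons inE ql !orbT.
Qed.

End freezing.

End staircase_theory.

Section transposition.
Variables (X : Type) (a : X -> autQ) (s : rat -> bool) (P : set rat).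
Implicit Types (k : X) (K : set X) (t : gpoint X) (l : seq (gpoint X)).

Definition gswap t : gpoint X := GPoint (gy t) (gx t) (glab t).

Local Notation aV := (fun k => ((a k)^-1)%g).
Local Notation sN := (fun x => ~~ s x).

Lemma gstep_swap K t t' :
  gstep aV sN K t t' -> gstep a s K (gswap t) (gswap t').
Proof.
move=> /asboolP[xx yy [A [B AB]]]; apply: (@gstep_intro _ _ _ _ A B) => // k Kk.
case: (AB k Kk) => [[same link]|[tA tB ltAB sAB]]; [left|right].
  by split=> //; case: link; rewrite ?le_autQV ?autQV_le; [right|left].
by split=> //; apply: contra sAB => /eqP->.
Qed.

Lemma admissible_swap K t :
  admissible aV sN P K t <-> admissible a s P K (gswap t).
Proof.
by split=> adm k Kk; have [Pt dir] := adm k Kk; split=> //; move: dir;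
  rewrite /directed /=; case: (s _); rewrite /= ?autQV_lt ?lt_autQV.
Qed.

Lemma staircase_swap K t l : staircase aV sN P K t l ->
  staircase a s P K (gswap t) (map gswap l).
Proof.
move=> [pth adm]; split; first by apply: homo_path pth; exact: gstep_swap.
by move=> p; rewrite -map_cons => /mapP[q ql ->]; exact/admissible_swap/adm.
Qed.

End transposition.

(** * Refining a staircase *)

Section crossings.
Variables (X : Type) (a : X -> autQ) (s : rat -> bool) (P : set rat).

Definition crosses (E : set X) A B t t' :=
  [/\ [/\ P A, P B & A < B], gx t < gx t' /\ gy t < gy t',
      forall k, E k -> glab t k = A /\ glab t' k = B,
      admissible a s P E t & admissible a s P E t'].

End crossings.

Section downward_crossing.
Variables (X : Type) (a : X -> autQ) (s : rat -> bool) (P : set rat).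
Variables (A B : rat) (K : set X).
Hypotheses (sA : s A) (sB : ~~ s B).
Hypothesis fin_a : pointwise_finite a K.
Hypothesis fin_aV : pointwise_finite (fun k => ((a k)^-1)%g) K.
Implicit Types (k : X) (E : set X) (t q : gpoint X).

Local Notation gstep := (gstep a s).
Local Notation admissible := (admissible a s P).
Local Notation staircase := (staircase a s P).
Local Notation crosses := (crosses a s P).

Lemma downward_crosses_lt E t t' k : crosses E A B t t' -> E k ->
  gx t < a k (gy t) /\ a k (gy t') < gx t'.
Proof.
move=> [_ _ lab adm adm'] Ek; have [tA tB] := lab k Ek.
have [_] := adm k Ek; have [_] := adm' k Ek.
by rewrite /directed tA tB sA (negbTE sB).
Qed.

Lemma downward_insert E t t' x y : E `<=` K -> crosses E A B t t' ->
  gx t < x < gx t' -> gy t < y < gy t' -> (forall k, E k -> a k y != x) ->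
  exists p q r, staircase E t [:: p; q; r; t'] /\ gx q = x /\ gy q = y.
Proof.
move=> EK cr /andP[tx xt] /andP[ty yt] avoid.
have [[PA PB AB] _ lab adm adm'] := cr.
have above k : E k -> gx t < a k (gy t) by move=> /(downward_crosses_lt cr)[].
have below k : E k -> a k (gy t') < gx t' by move=> /(downward_crosses_lt cr)[].
have [x1 /andP[tx1 x1x] gap_x1] := eval_gap_above fin_a (gy t) tx.
have [y1 /andP[ty1 y1y] gap_y1] := preimage_gap_below fin_aV x ty.
have [x2 /andP[xx2 x2t] gap_x2] := eval_gap_below fin_a (gy t') xt.
have [y2 /andP[yy2 y2t] gap_y2] := preimage_gap_above fin_aV x yt.
have {}gap_x1 k : E k -> x1 < a k (gy t).
  by move=> Ek; apply: gap_x1 (above k Ek); exact: EK.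
have {}gap_x2 k : E k -> a k (gy t') < x2.
  by move=> Ek; apply: gap_x2 (below k Ek); exact: EK.
pose p := gconst x1 y1 A : gpoint X; pose r := gconst x2 y2 B : gpoint X.
pose q := GPoint x y (fun k => if a k y < x then B else A).
exists p, q, r; split=> //; apply: staircase_cons => //.
  apply: (@gstep_intro _ _ _ _ A B) => // k Ek; left; split.
    by have [] := lab k Ek.
  by left; rewrite ltW ?gap_x1.
apply: staircase_cons.
- apply: (@gstep_intro _ _ _ _ A B) => // k Ek; rewrite /stays /switches /=.
  case: ltgtP (avoid k Ek) => // akx _; [right|left].
    by split; rewrite ?sA ?(negbTE sB).
  by split=> //; left; rewrite ltW // gap_y1 //; exact: EK.
- move=> k Ek; split; rewrite /directed //= sA.
  by rewrite (lt_trans (gap_x1 k Ek)) ?autQ_mono.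
apply: staircase_cons.
- apply: (@gstep_intro _ _ _ _ A B) => // k Ek; rewrite /stays /switches /=.
  case: ltgtP (avoid k Ek) => // akx _; [left|right].
    by split=> //; right; rewrite ltW // gap_y2 //; exact: EK.
  by split; rewrite ?sA ?(negbTE sB).
- move=> k Ek; rewrite /directed /=.
  by case: ltgtP (avoid k Ek) => // _ _; rewrite ?sA ?(negbTE sB).
apply: staircase1 => //.
  apply: (@gstep_intro _ _ _ _ A B) => // k Ek; left; split.
    by have [_ ->] := lab k Ek.
  by right; rewrite ltW ?gap_x2.
move=> k Ek; split; rewrite /directed //= (negbTE sB).
by rewrite (lt_trans _ (gap_x2 k Ek)) ?autQ_mono.
Qed.

Variables O1 O2 : rat.
Hypotheses (PO1 : P O1) (PO2 : P O2).
Hypotheses (AO1 : A < O1) (O12 : O1 < O2) (O2B : O2 < B).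
Hypotheses (sO1 : ~~ s O1) (sO2 : s O2).

Lemma downward_zigzag E (lab : X -> rat) v y x0 x3 y4 : E `<=` K ->
  P A -> P B -> (forall k, E k -> lab k = A) -> (forall k, E k -> a k y = v) ->
  x0 < v < x3 -> y < y4 -> (forall k, E k -> a k y4 < x3) ->
  exists y0 y3 l, [/\ y < y0 < y3, y3 < y4,
    staircase E (GPoint x0 y0 lab) (rcons l (gconst x3 y3 B)) &
    forall k, O1 \in map (@glab X ^~ k) l /\ O2 \in map (@glab X ^~ k) l].
Proof.
move=> EK PA PB labA val_v /andP[x0v vx3] yy4 below.
have [y2 /andP[yy2 y24]] := lt_dense yy4.
have [x2 /andP[vx2 x23] gap_x2] := eval_gap_above fin_a y2 vx3.
have [x1 /andP[vx1 x12]] := lt_dense vx2.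
have [y1 /andP[yy1 y12] gap_y1] := preimage_gap_above fin_aV x1 yy2.
have [y0 /andP[yy0 y01]] := lt_dense yy1.
have [y3 /andP[y23 y34]] := lt_dense y24.
have above k z : E k -> y < z -> v < a k z.
  by move=> /val_v<-; rewrite autQ_mono.
exists y0, y3, [:: gconst x1 y1 O1; gconst x2 y2 O2]; split=> //=.
- by rewrite yy0 (lt_trans y01) // (lt_trans y12).
- apply: staircase_cons.
  + apply: (@gstep_intro _ _ _ _ A O1) => //= [|k Ek].
      exact: lt_trans vx1.
    by right; split; rewrite ?sA ?(negbTE sO1) //; exact: labA.
  + move=> k Ek; rewrite /directed /= labA // sA; split=> //.
    exact: lt_trans x0v (above k y0 Ek yy0).
  apply: staircase_cons.
  + apply: (@gstep_intro _ _ _ _ O1 O2) => //= k Ek.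
    by right; split; rewrite ?sO2 ?(negbTE sO1).
  + move=> k Ek; rewrite /directed /= (negbTE sO1); split=> //.
    by apply: gap_y1; [exact: EK|rewrite val_v].
  apply: staircase1.
  + apply: (@gstep_intro _ _ _ _ O2 B) => //= k Ek.
    by right; split; rewrite ?sO2 ?(negbTE sB).
  + move=> k Ek; rewrite /directed /= sO2; split=> //.
    by apply: gap_x2; [exact: EK|exact: above].
  + move=> k Ek; rewrite /directed /= (negbTE sB); split=> //.
    by rewrite (lt_trans _ (below k Ek)) ?autQ_mono.
- by move=> k; rewrite /= !inE !eqxx orbT.
Qed.

(* The indices whose value at height y is below v have already switched to B,
   and are not disturbed by the zigzag of those of value v. *)
Lemma downward_zigzag_last E v y x0 x3 y4 : E `<=` K -> P A -> P B ->
  (forall k, E k -> a k y <= v) -> x0 < v < x3 -> y < y4 ->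
  (forall k, E k -> a k y4 < x3) ->
  (forall k, E k -> a k y < v -> a k y4 < x0) ->
  exists y0 y3 l, let lab k := if a k y < v then B else A in
    [/\ y < y0 < y3, y3 < y4,
      staircase E (GPoint x0 y0 lab) (rcons l (gconst x3 y3 B)) &
      forall k, E k -> a k y = v ->
        O1 \in map (@glab X ^~ k) l /\ O2 \in map (@glab X ^~ k) l].
Proof.
move=> EK PA PB le_v x0vx3 yy4 below below_early.
have /andP[x0v vx3] := x0vx3.
pose early := E `&` [set k | a k y < v].
pose last_group := E `&` [set k | a k y = v].
pose lab k := if a k y < v then B else A.
have [k [/EK//]|k [_ akv]|k []//|k [/below//]|] :=
  @downward_zigzag last_group lab v y x0 x3 y4 _ PA PB _ _ x0vx3 yy4.
  by rewrite /lab akv ltxx.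
move=> y0 [y3 [l [/andP[yy0 y03] y34 zig visit]]].
have early_x0 k z : early k -> z < y4 -> a k z < x0.
  by move=> [Ek akv] zy4; apply: lt_trans (below_early k Ek akv);
    rewrite autQ_mono.
have adm_early r : gx r = x0 \/ gx r = x3 -> gy r < y4 ->
    (forall k, early k -> glab r k = B) -> admissible early r.
  move=> xr yr labB k ek; rewrite /directed labB // (negbTE sB); split=> //.
  by case: xr => ->; [|apply: lt_trans (lt_trans x0v vx3)]; exact: early_x0.
pose p := GPoint x0 y0 lab; pose q := gconst x3 y3 B : gpoint X.
have labB k : early k -> glab p k = B by move=> [_ akv]; rewrite /= /lab akv.
exists y0, y3, (map (freeze early p) l); split=> //; first by rewrite yy0.
  apply: staircase_sub (staircase_freeze (D := early) (t := p) _ _ _ zig).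
  - by move=> k Ek; have := le_v k Ek; rewrite le_eqVlt => /predU1P[];
      [left|right].
  - by move=> k ek; split; [rewrite labB|right; rewrite ltW // early_x0].
  - by apply: adm_early => //; [left|exact: lt_trans y34].
  - by apply: adm_early => //; right.
move=> k Ek akv; rewrite map_glab_freeze //.
by move=> [_ /=]; rewrite akv ltxx.
Qed.

(* Group the indices by their value at height gy t.  The last group, of value
   v, visits O1 and O2 next to v, after the others have switched to B. *)
Lemma downward_visit_last E t t' v : E `<=` K -> crosses E A B t t' ->
  (forall k, E k -> a k (gy t) <= v) -> gx t < v < gx t' ->
  exists p l, [/\ crosses (E `&` [set k | a k (gy t) < v]) A B t p,
    gx p < v, forall k, E k -> a k (gy t) = v -> glab p k = A,
    staircase E p (rcons l t') &
    forall k, E k -> a k (gy t) = v ->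
      O1 \in map (@glab X ^~ k) l /\ O2 \in map (@glab X ^~ k) l].
Proof.
move=> EK cr le_v /andP[tv vt].
have [[PA PB AB] [_ tt] lab adm adm'] := cr.
have [x0 /andP[tx0 x0v] gap_x0] := eval_gap_below fin_a (gy t) tv.
have [y4 /andP[ty4 y4t] gap_y4] := preimage_gap_above fin_aV x0 tt.
have [x3 /andP[vx3 x3t] gap_x3] := eval_gap_below fin_a (gy t') vt.
have below_x3 k y : E k -> y <= gy t' -> a k y < x3.
  move=> Ek yt; apply: le_lt_trans (_ : a k (gy t') < x3).
    by rewrite autQ_le_mono.
  by apply: gap_x3; [exact: EK|have [] := downward_crosses_lt cr Ek].
have [|k Ek|k Ek akv|] :=
  @downward_zigzag_last E v (gy t) x0 x3 y4 EK PA PB le_v _ ty4.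
- by rewrite x0v.
- by apply: below_x3; rewrite ?ltW.
- by apply: gap_y4; [|apply: gap_x0 => //]; exact: EK.
move=> y0 [y3 [l [/andP[ty0 y03] y34 zig visit]]].
pose lab0 k := if a k (gy t) < v then B else A.
have [_ adm_zig] := zig.
exists (GPoint x0 y0 lab0), (rcons l (gconst x3 y3 B)); split=> //.
- split=> // [k [Ek akv]|k [Ek _]|k [Ek _]]; last 2 first.
  + exact: adm.
  + by apply: adm_zig Ek; exact: mem_head.
  + by rewrite /= /lab0 akv; have [] := lab k Ek.
- by move=> k _ akv; rewrite /= /lab0 akv ltxx.
- rewrite -cats1; apply: staircase_cat => //; rewrite last_rcons.
  apply: staircase1 => //; last first.
    by apply: adm_zig; rewrite inE mem_rcons mem_head orbT.
  apply: (@gstep_intro _ _ _ _ B B) => //= [|k Ek]; first exact: lt_trans y4t.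
  by left; split; [have [_ ->] := lab k Ek|right; rewrite ltW ?below_x3].
- move=> k Ek akv; rewrite !map_rcons !mem_rcons !inE.
  by have [-> ->] := visit k Ek akv; rewrite !orbT.
Qed.

Lemma downward_visit E t t' : E `<=` K -> crosses E A B t t' ->
  exists2 l, staircase E t (rcons l t') & forall k, E k ->
    O1 \in map (@glab X ^~ k) l /\ O2 \in map (@glab X ^~ k) l.
Proof.
move=> EK; have /finite_seqP[ys ysE] := fin_a (gy t).
have {ysE} : forall k, E k -> a k (gy t) \in ys.
  move=> k /EK Kk; have : [set a k (gy t) | k in K] (a k (gy t)) by exists k.
  by rewrite ysE.
have [n le_n] := ubnP (size ys).
elim: n => // n IHn in E EK t' ys le_n * => val_ys cr.
have [[k0 Ek0]|E0] := pselect (exists k, E k); last first.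
  have nE k : ~ E k by move=> Ek; apply: E0; exists k.
  have [_ [xx yy] _ adm adm'] := cr; exists [::] => [|k /nE//].
  by apply: staircase1 => //; apply: (@gstep_intro _ _ _ _ A B) => // k /nE.
have [||_ [kv Ekv <-] v_max] := @finite_set_max _ _ [set a k (gy t) | k in E].
- by apply: sub_finite_set (fin_a (gy t)) => _ [k /EK Kk <-]; exists k.
- by exists (a k0 (gy t)), k0.
set v := a kv (gy t) in v_max.
have [above below] := downward_crosses_lt cr Ekv.
have [||p [l' [cr' pv labA st' visit']]] := downward_visit_last EK cr (v := v).
- by move=> k Ek; apply: v_max; exists k.
- by rewrite above (lt_trans _ below) // autQ_mono; have [_ []] := cr.
have [|||l st visit] := IHn _ _ p [seq x <- ys | x != v] _ _ cr'.
- by move=> k [/EK].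
- rewrite size_filter; apply: leq_trans (_ : size ys <= n)%N => //.
  rewrite ltn_neqAle count_size andbT -all_count.
  by apply/allPn; exists v; rewrite ?negbK ?val_ys.
- by move=> k [Ek akv]; rewrite mem_filter val_ys // lt_eqF.
pose last_group := E `&` [set k | a k (gy t) = v].
have [_ _ lab adm _] := cr; have [_ adm_st'] := st'.
have le_v k : E k -> a k (gy t) < v \/ a k (gy t) = v.
  move=> Ek; have : a k (gy t) <= v by apply: v_max; exists k.
  by rewrite le_eqVlt => /predU1P[|]; [right|left].
exists (map (freeze last_group t) l ++ p :: l') => [|k Ek].
  rewrite rcons_cat /= -cat_rcons; apply: staircase_cat; rewrite ?last_rcons //.
  apply: staircase_sub (staircase_freeze (D := last_group) _ _ _ st).
  - by move=> k Ek; case: (le_v k Ek) => akv; [left|right].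
  - move=> k [Ek akv]; split; first by rewrite labA //; have [] := lab k Ek.
    by left; rewrite akv ltW.
  - by move=> k [Ek _]; exact: adm.
  - by move=> k [Ek _]; apply: adm_st' Ek; exact: mem_head.
rewrite map_cat /= !mem_cat !inE; case: (le_v k Ek) => akv; last first.
  by have [-> ->] := visit' k Ek akv; rewrite !orbT.
rewrite map_glab_freeze; first by have [-> ->] := visit k (conj Ek akv).
by move=> [_ /= e]; rewrite e ltxx in akv.
Qed.

End downward_crossing.

Section crossing.
Variables (X : Type) (P : set rat) (K : set X).
Implicit Types (a : X -> autQ) (s : rat -> bool) (k : X) (E : set X).
Implicit Types (t : gpoint X).

Definition alternates_on s :=
  forall x y, P x -> P y -> x < y -> s x = s y ->
  exists2 z, P z & x < z < y /\ s z != s x.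

Lemma alternates_onN s : alternates_on s -> alternates_on (fun x => ~~ s x).
Proof.
move=> alt x y Px Py xy /negb_inj same.
have [z Pz [xzy sz]] := alt x y Px Py xy same.
by exists z => //; split=> //; apply: contra sz => /eqP/negb_inj->.
Qed.

Lemma downward_visit_label a s E A B t t' O :
  pointwise_finite a K -> pointwise_finite (fun k => ((a k)^-1)%g) K ->
  alternates_on s -> E `<=` K -> crosses a s P E A B t t' ->
  s A -> ~~ s B -> P O -> A < O < B ->
  exists2 l, staircase a s P E t (rcons l t') &
    forall k, E k -> O \in map (@glab X ^~ k) l.
Proof.
move=> fin_a fin_aV alt EK cr sA sB PO /andP[AO OB].
have [[PA PB _] _ _ _ _] := cr.
have [sO|sO] := boolP (s O).
  have [|O1 PO1 [/andP[AO1 O1O]]] := alt A O PA PO AO; first by rewrite sA sO.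
  rewrite sA eqb_id => sO1.
  have [l st visit] :=
    downward_visit sA sB fin_a fin_aV PO1 PO AO1 O1O OB sO1 sO EK cr.
  by exists l => // k /visit[].
have [|O2 PO2 [/andP[OO2 O2B]]] := alt O B PO PB OB.
  by rewrite (negbTE sB) (negbTE sO).
rewrite (negbTE sO) eqbF_neg negbK => sO2.
have [l st visit] :=
  downward_visit sA sB fin_a fin_aV PO PO2 AO OO2 O2B sO sO2 EK cr.
by exists l => // k /visit[].
Qed.

Lemma gswapK : involutive (@gswap X).
Proof. by case. Qed.

Lemma crosses_swap a s E A B t t' : crosses a s P E A B t t' ->
  crosses (fun k => ((a k)^-1)%g) (fun x => ~~ s x) P E A B
    (gswap t) (gswap t').
Proof.
move=> [PAB [xx yy] lab adm adm']; split=> //.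
  by apply/admissible_swap; rewrite gswapK.
by apply/admissible_swap; rewrite gswapK.
Qed.

Lemma pointwise_finiteVV a : pointwise_finite a K ->
  pointwise_finite (fun k => (((a k)^-1)^-1)%g) K.
Proof. by under eq_fun do rewrite invgK. Qed.

Variables (a : X -> autQ) (s : rat -> bool).
Hypothesis fin_a : pointwise_finite a K.
Hypothesis fin_aV : pointwise_finite (fun k => ((a k)^-1)%g) K.
Hypothesis alt_s : alternates_on s.

Lemma crossing_insert E A B t t' x y : E `<=` K ->
  crosses a s P E A B t t' -> s A != s B ->
  gx t < x < gx t' -> gy t < y < gy t' -> (forall k, E k -> a k y != x) ->
  exists2 l, staircase a s P E t (rcons l t') &
    x \in map (@gx X) l /\ y \in map (@gy X) l.
Proof.
move=> EK cr sAB txt tyt avoid; have [sA|sA] := boolP (s A).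
  have sB : ~~ s B by apply: contra sAB => sB; rewrite sA sB.
  have [p [q [r [st [<- <-]]]]] :=
    downward_insert sA sB fin_a fin_aV EK cr txt tyt avoid.
  by exists [:: p; q; r] => //; rewrite /= !inE !eqxx !orbT.
have sB : ~~ ~~ s B by apply: contra sAB => sB; rewrite (negbTE sA) (negbTE sB).
have [|p [q [r [st [<- <-]]]]] := downward_insert (s := fun x => ~~ s x) sA sB
  fin_aV (pointwise_finiteVV fin_a) EK (crosses_swap cr) tyt txt.
  by move=> k Ek; rewrite autQV_eq eq_sym avoid.
exists (map (@gswap X) [:: p; q; r]); last by rewrite /= !inE !eqxx !orbT.
have := staircase_swap (l := rcons [:: p; q; r] (gswap t')) st.
by rewrite map_rcons !gswapK.
Qed.

Lemma crossing_visit E A B t t' O : E `<=` K ->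
  crosses a s P E A B t t' -> s A != s B -> P O -> A < O < B ->
  exists2 l, staircase a s P E t (rcons l t') &
    forall k, E k -> O \in map (@glab X ^~ k) l.
Proof.
move=> EK cr sAB PO AOB; have [sA|sA] := boolP (s A).
  apply: (downward_visit_label fin_a fin_aV alt_s EK cr) => //.
  by apply: contra sAB => sB; rewrite sA sB.
have [|l st visit] := downward_visit_label fin_aV (pointwise_finiteVV fin_a)
  (alternates_onN alt_s) EK (crosses_swap cr) sA _ PO AOB.
  by apply: contra sAB => sB; rewrite (negbTE sA) (negbTE sB).
exists (map (@gswap X) l); last by move=> k /visit; rewrite -map_comp.
by have := staircase_swap st; rewrite map_rcons !gswapK.
Qed.

End crossing.

Section refinement.
Variables (X : Type) (a : X -> autQ) (s : rat -> bool) (P : set rat).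
Variable K : set X.
Hypothesis fin_a : pointwise_finite a K.
Hypothesis fin_aV : pointwise_finite (fun k => ((a k)^-1)%g) K.
Hypothesis alt_s : alternates_on P s.
Implicit Types (k : X) (t p : gpoint X) (l : seq (gpoint X)).

Local Notation gstep := (gstep a s K).
Local Notation admissible := (admissible a s P).
Local Notation staircase := (staircase a s P).

(* E collects the indices switching at the step and D the others. *)
Lemma gstep_decompose t t' : gstep t t' -> admissible K t -> admissible K t' ->
  exists E D A B, [/\ K `<=` E `|` D, E `<=` K,
    forall k, D k -> glab t k = glab t' k,
    forall l, staircase E t (rcons l t') ->
      staircase K t (rcons (map (freeze D t) l) t')
  & E = set0 \/ crosses a s P E A B t t' /\ s A != s B].
Proof.
move=> /asboolP[xx yy [A [B AB]]] adm adm'.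
pose E := K `&` [set k | ~ stays a k t t'].
pose D := K `&` [set k | stays a k t t'].
have KED : K `<=` E `|` D.
  by move=> k Kk; have [?|?] := pselect (stays a k t t'); [right|left].
exists E, D, A, B; split=> [//|k []//|k [_ []]//|l st|].
  apply: (staircase_sub KED); apply: staircase_freeze st => k [Kk //].
  - by move=> _; exact: adm.
  - by move=> _; exact: adm'.
have [E0|/set0P[k0 [Kk0 nk0]]] := eqVneq E set0; [by left|right].
have E_switches k : E k -> switches s A B k t t' by move=> [/AB[]].
have [tA tB ltAB sAB] := E_switches _ (conj Kk0 nk0); split=> //; split=> //.
- split=> //; rewrite -?tA -?tB; first by have [] := adm k0 Kk0.
  by have [] := adm' k0 Kk0.
- by move=> k /E_switches[].
- by move=> k [Kk _]; exact: adm.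
- by move=> k [Kk _]; exact: adm'.
Qed.

Lemma gstep_insert t t' x y :
  gstep t t' -> admissible K t -> admissible K t' ->
  gx t < x < gx t' -> gy t < y < gy t' -> (forall k, K k -> a k y != x) ->
  exists2 l, staircase K t (rcons l t') &
    x \in map (@gx X) l /\ y \in map (@gy X) l.
Proof.
move=> st adm adm' txt tyt avoid.
have [E [D [A [B [_ EK _ freeze_st E_cases]]]]] := gstep_decompose st adm adm'.
have [l st_l [xl yl]] : exists2 l, staircase E t (rcons l t') &
    x \in map (@gx X) l /\ y \in map (@gy X) l.
  case: E_cases => [->|[cr sAB]]; last first.
    apply: (crossing_insert fin_a fin_aV EK cr sAB) => // k /EK.
    exact: avoid.
  exists [:: gconst x y 0]; last by rewrite /= !mem_head.
  have [/andP[tx xt] /andP[ty yt]] := (txt, tyt).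
  apply: staircase_cons => //; first exact: (@gstep_intro _ _ _ _ 0 0).
  by apply: staircase1 => //; exact: (@gstep_intro _ _ _ _ 0 0).
by exists (map (freeze D t) l); [exact: freeze_st|rewrite -!map_comp].
Qed.

Definition refinable (C : set (gpoint X -> rat)) (v : rat) :=
  forall t t', gstep t t' -> admissible K t -> admissible K t' ->
  exists2 l, staircase K t (rcons l t') &
    forall c, C c -> c t < v < c t' -> v \in map c l.

Lemma refinable_gx x : refinable [set @gx X] x.
Proof.
move=> t t' st adm adm'; have [txt|ntxt] := boolP (gx t < x < gx t').
  have /asboolP[_ yy _] := st; have [y tyt avoid] := finite_avoid (fin_aV x) yy.
  have [k Kk|l st_l [xl _]] := gstep_insert st adm adm' txt tyt;
    last by exists l => // c ->.
  by apply/eqP => akx; apply: avoid; exists k => //; rewrite -akx autQK.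
by exists [::] => [|_ ->]; [exact: staircase1|rewrite (negbTE ntxt)].
Qed.

Lemma refinable_gy y : refinable [set @gy X] y.
Proof.
move=> t t' st adm adm'; have [tyt|ntyt] := boolP (gy t < y < gy t').
  have /asboolP[xx _ _] := st; have [x txt avoid] := finite_avoid (fin_a y) xx.
  have [k Kk|l st_l [_ yl]] := gstep_insert st adm adm' txt tyt;
    last by exists l => // c ->.
  by apply/eqP => akx; apply: avoid; exists k.
by exists [::] => [|_ ->]; [exact: staircase1|rewrite (negbTE ntyt)].
Qed.

Lemma refinable_glab O : P O -> refinable [set @glab X ^~ k | k in K] O.
Proof.
move=> PO t t' st adm adm'.
have [E [D [A [B [KED EK D_same freeze_st E_cases]]]]] :=
  gstep_decompose st adm adm'.
have passes k : K k -> glab t k < O < glab t' k -> E k /\ ~ D k.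
  move=> Kk tOt; have nDk : ~ D k.
    move=> /D_same same; move: tOt; rewrite same => /andP[Ot tO].
    by have := lt_trans Ot tO; rewrite ltxx.
  by split=> //; case: (KED k Kk).
case: E_cases => [E0|[cr sAB]].
  exists [::]; first exact: staircase1.
  by move=> _ [k Kk <-] /(passes k Kk)[]; rewrite E0.
have [_ _ lab _ _] := cr; have [AOB|nAOB] := boolP (A < O < B).
  have [l st_l visit] := crossing_visit fin_a fin_aV alt_s EK cr sAB PO AOB.
  exists (map (freeze D t) l) => [|_ [k Kk <-] /(passes k Kk)[Ek nDk]].
    exact: freeze_st.
  by rewrite map_glab_freeze ?visit.
exists [::]; first exact: staircase1.
move=> _ [k Kk <-] tOt; have [Ek _] := passes k Kk tOt.
by move: tOt; have [-> ->] := lab k Ek; rewrite (negbTE nAOB).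
Qed.

Lemma staircase_refine C v t l : refinable C v -> staircase K t l ->
  exists l', [/\ staircase K t l', last t l' = last t l, {subset l <= l'} &
    forall c, C c -> c t <= v <= c (last t l) -> v \in map c (t :: l')].
Proof.
move=> ref; elim: l t => [|t1 l IHl] t.
  move=> st; exists [::]; split=> // c _.
  by rewrite -eq_le => /eqP<-; rewrite mem_head.
move=> [/= /andP[st pth] adm].
have adm_t : admissible K t by apply: adm; exact: mem_head.
have st1 : staircase K t1 l by split=> // p pl; apply: adm; rewrite inE pl orbT.
have adm_t1 : admissible K t1 by case: st1 => _; apply; exact: mem_head.
have [l' [st_l' last_l' sub_l' visit]] := IHl t1 st1.
have [r st_r visit_r] := ref _ _ st adm_t adm_t1.
exists (rcons r t1 ++ l'); split.
- by apply: staircase_cat; rewrite ?last_rcons.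
- by rewrite last_cat last_rcons.
- move=> p; rewrite mem_cat mem_rcons !inE => /predU1P[->|/sub_l'->].
    by rewrite eqxx.
  by rewrite orbT.
move=> c Cc /andP[tv vl]; rewrite /= inE map_cat map_rcons mem_cat mem_rcons.
have [t1v|vt1] := leP (c t1) v.
  have : v \in map c (t1 :: l') by apply: visit => //; rewrite t1v.
  by rewrite /= !inE => /orP[->|->]; rewrite ?orbT.
move: tv; rewrite le_eqVlt => /predU1P[->|tv]; first by rewrite eqxx.
by rewrite inE visit_r ?orbT // tv.
Qed.

End refinement.

(** * Dense staircases on an interval *)

Lemma path_trichotomy (T : eqType) (e : rel T) x s p q :
  path e x s -> p \in x :: s -> q \in x :: s ->
  [\/ p = q, exists2 s', path e p (rcons s' q) & {subset s' <= s}
   | exists2 s', path e q (rcons s' p) & {subset s' <= s}].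
Proof.
have from_head y r z : path e y r -> z \in r ->
    exists2 s', path e y (rcons s' z) & {subset s' <= r}.
  move=> pth zr; move: pth; case/splitPr: zr => r1 r2.
  rewrite -cat_rcons cat_path => /andP[pth _]; exists r1 => // w wr.
  by rewrite mem_cat mem_rcons inE wr orbT.
elim: s x => [|y s IHs] x pth.
  by rewrite !mem_seq1 => /eqP-> /eqP->; exact: Or31.
rewrite inE => /predU1P[->|ps]; rewrite inE => /predU1P[->|qs].
- exact: Or31.
- by apply: Or32; exact: from_head.
- by apply: Or33; exact: from_head.
move: pth => /= /andP[_ pth].
have widen r : {subset r <= s} -> {subset r <= y :: s}.
  by move=> rs w /rs ws; rewrite inE ws orbT.
case: (IHs y pth ps qs) => [->|[r pth_r /widen ?]|[r pth_r /widen ?]].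
- exact: Or31.
- by apply: Or32; exists r.
- by apply: Or33; exists r.
Qed.

Section gconst_staircases.
Variables (X : Type) (P : set rat) (K : set X).
Implicit Types (a : X -> autQ) (s : rat -> bool).

Lemma upward_gconst_staircase a s A x y x' y' : pointwise_finite a K ->
  pointwise_finite (fun k => ((a k)^-1)%g) K -> s A -> x < x' -> y < y' ->
  admissible a s P K (gconst x y A) -> admissible a s P K (gconst x' y' A) ->
  exists p, staircase a s P K (gconst x y A) [:: p; gconst x' y' A].
Proof.
move=> fin_a fin_aV sA xx yy adm adm'.
have [x1 /andP[xx1 x1x] gap_x1] := eval_gap_above fin_a y xx.
have [y1 /andP[yy1 y1y] gap_y1] := preimage_gap_below fin_aV x' yy.
have {}gap_x1 k : K k -> x1 < a k y.
  by move=> Kk; apply: gap_x1 => //; have [_] := adm k Kk;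
    rewrite /directed /= sA.
have {}gap_y1 k : K k -> x' < a k y1.
  by move=> Kk; apply: gap_y1 => //; have [_] := adm' k Kk;
    rewrite /directed /= sA.
exists (gconst x1 y1 A); apply: staircase_cons => //.
  apply: (@gstep_intro _ _ _ _ A A) => // k Kk; left; split=> //.
  by left; rewrite ltW // gap_x1.
apply: staircase1 => //.
  apply: (@gstep_intro _ _ _ _ A A) => // k Kk; left; split=> //.
  by left; rewrite ltW // gap_y1.
move=> k Kk; have [PA _] := adm k Kk; split=> //.
by rewrite /directed /= sA (lt_trans x1x) ?gap_y1.
Qed.

Variables (a : X -> autQ) (s : rat -> bool).
Hypothesis fin_a : pointwise_finite a K.
Hypothesis fin_aV : pointwise_finite (fun k => ((a k)^-1)%g) K.

Definition joins A B := A = B \/ A < B /\ s A != s B.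

Lemma gconst_staircase A B x y x' y' : joins A B -> x < x' -> y < y' ->
  admissible a s P K (gconst x y A) -> admissible a s P K (gconst x' y' B) ->
  exists l, staircase a s P K (gconst x y A) (rcons l (gconst x' y' B)).
Proof.
move=> [<-|[AB sAB]] xx yy adm adm'; last first.
  exists [::]; apply: staircase1 => //.
  by apply: (@gstep_intro _ _ _ _ A B) => // k _; right.
have [sA|sA] := boolP (s A).
  have [p st] := upward_gconst_staircase fin_a fin_aV sA xx yy adm adm'.
  by exists [:: p].
have [||p st] := upward_gconst_staircase (s := fun x => ~~ s x) fin_aV
  (pointwise_finiteVV fin_a) sA yy xx.
- exact/admissible_swap.
- exact/admissible_swap.
by exists [:: gswap p]; exact: staircase_swap st.
Qed.

End gconst_staircases.

Section interval_staircases.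
Variables (X : Type) (a : X -> autQ) (s : rat -> bool) (P I : set rat).
Variable K : set X.
Hypothesis fin_a : pointwise_finite a K.
Hypothesis fin_aV : pointwise_finite (fun k => ((a k)^-1)%g) K.
Hypothesis alt_s : alternates_on P s.
Hypothesis I_convex : forall x y z, I x -> I y -> x <= z <= y -> I z.
Hypothesis I_up : forall x, I x -> exists2 y, I y & x < y.
Hypothesis I_down : forall x, I x -> exists2 y, I y & y < x.
Hypothesis I_a : forall k x, K k -> I x -> I (a k x).
Hypothesis I_aV : forall k x, K k -> I x -> I ((a k)^-1%g x).
Implicit Types (k : X) (t p : gpoint X) (l : seq (gpoint X)).
Implicit Types (x y A B O : rat).

Local Notation gstep := (gstep a s K).
Local Notation admissible := (admissible a s P K).
Local Notation staircase := (staircase a s P K).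

Lemma finite_strict_ub (F : set rat) x : finite_set F -> F `<=` I -> I x ->
  exists z, [/\ I z, x < z & forall w, F w -> w < z].
Proof.
move=> finF FI Ix; have [||m Fm m_max] := @finite_set_max _ _ (F `|` [set x]).
- by rewrite finite_setU.
- by exists x; right.
have [z Iz mz] : exists2 z, I z & m < z by apply: I_up; case: Fm => [/FI|->].
exists z; split=> //; first by apply: le_lt_trans mz; apply: m_max; right.
by move=> w Fw; apply: le_lt_trans mz; apply: m_max; left.
Qed.

Lemma finite_strict_lb (F : set rat) x : finite_set F -> F `<=` I -> I x ->
  exists z, [/\ I z, z < x & forall w, F w -> z < w].
Proof.
move=> finF FI Ix; have [||m Fm m_min] := @finite_set_min _ _ (F `|` [set x]).
- by rewrite finite_setU.
- by exists x; right.
have [z Iz zm] : exists2 z, I z & z < m by apply: I_down; case: Fm => [/FI|->].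
exists z; split=> //; first by apply: lt_le_trans zm _; apply: m_min; right.
by move=> w Fw; apply: lt_le_trans zm _; apply: m_min; left.
Qed.

Lemma admissible_gconst A x y : P A ->
  (forall k, K k -> if s A then x < a k y else a k y < x) ->
  admissible (gconst x y A).
Proof. by move=> PA dir k Kk; split=> //; exact: dir. Qed.

Lemma admissible_far_right A x y : P A -> I x -> I y ->
  exists x' y', [/\ I x', I y', x < x', y < y' & admissible (gconst x' y' A)].
Proof.
move=> PA Ix Iy; have [sA|sA] := boolP (s A).
  have [x' Ix' xx'] := I_up Ix.
  have [|y' [Iy' yy' ub]] := finite_strict_ub (fin_aV x') _ Iy.
    by move=> _ [k Kk <-]; exact: I_aV.
  exists x', y'; split=> //; apply: admissible_gconst => // k Kk.
  by rewrite sA -autQV_lt; apply: ub; exists k.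
have [y' Iy' yy'] := I_up Iy.
have [|x' [Ix' xx' ub]] := finite_strict_ub (fin_a y') _ Ix.
  by move=> _ [k Kk <-]; exact: I_a.
exists x', y'; split=> //; apply: admissible_gconst => // k Kk.
by rewrite (negbTE sA); apply: ub; exists k.
Qed.

Lemma admissible_far_left A x y : P A -> I x -> I y ->
  exists x' y', [/\ I x', I y', x' < x, y' < y & admissible (gconst x' y' A)].
Proof.
move=> PA Ix Iy; have [sA|sA] := boolP (s A).
  have [y' Iy' yy'] := I_down Iy.
  have [|x' [Ix' xx' lb]] := finite_strict_lb (fin_a y') _ Ix.
    by move=> _ [k Kk <-]; exact: I_a.
  exists x', y'; split=> //; apply: admissible_gconst => // k Kk.
  by rewrite sA; apply: lb; exists k.
have [x' Ix' xx'] := I_down Ix.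
have [|y' [Iy' yy' lb]] := finite_strict_lb (fin_aV x') _ Iy.
  by move=> _ [k Kk <-]; exact: I_aV.
exists x', y'; split=> //; apply: admissible_gconst => // k Kk.
by rewrite (negbTE sA) -lt_autQV; apply: lb; exists k.
Qed.

Lemma label_bridge A B : P A -> P B -> A <= B ->
  exists2 C, P C & joins s A C /\ joins s C B.
Proof.
move=> PA PB; rewrite le_eqVlt => /predU1P[<-|AB].
  by exists A => //; split; left.
have [/eqP sAB|sAB] := boolP (s A == s B); last first.
  by exists A => //; split; [left|right].
have [C PC [/andP[AC CB] sC]] := alt_s PA PB AB sAB.
by exists C => //; split; right; rewrite -?sAB // eq_sym.
Qed.

Definition endpoint t :=
  exists x y A, [/\ t = gconst x y A, I x, I y & P A].

Let I_max x y : I x -> I y -> I (Num.max x y).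
Proof. by rewrite /Num.max; case: ifP. Qed.

Let I_min x y : I x -> I y -> I (Num.min x y).
Proof. by rewrite /Num.min; case: ifP. Qed.

Lemma extend_right t x y O : endpoint t -> admissible t -> I x -> I y -> P O ->
  exists l, [/\ staircase t l, endpoint (last t l),
    x < gx (last t l) /\ y < gy (last t l) & forall k, O <= glab (last t l) k].
Proof.
move=> [xt [yt [A [-> Ixt Iyt PA]]]] adm Ix Iy PO.
have PO' : P (Num.max A O) by rewrite /Num.max; case: ifP.
have [|C PC [AC CO]] := label_bridge PA PO'; first by rewrite le_max lexx.
have [x1 [y1 [Ix1 Iy1 xx1 yy1 adm1]]] := admissible_far_right PC Ixt Iyt.
have [x2 [y2 [Ix2 Iy2]]] :=
  admissible_far_right PO' (I_max Ix1 Ix) (I_max Iy1 Iy).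
rewrite !gt_max => /andP[x12 xx2] /andP[y12 yy2] adm2.
have [l1 st1] := gconst_staircase fin_a fin_aV AC xx1 yy1 adm adm1.
have [l2 st2] := gconst_staircase fin_a fin_aV CO x12 y12 adm1 adm2.
exists (rcons l1 (gconst x1 y1 C) ++ rcons l2 (gconst x2 y2 (Num.max A O))).
rewrite last_cat !last_rcons; split=> //.
- by apply: staircase_cat; rewrite ?last_rcons.
- by exists x2, y2, (Num.max A O).
- by move=> k; rewrite /= le_max lexx orbT.
Qed.

Lemma extend_left t x y O : endpoint t -> admissible t -> I x -> I y -> P O ->
  exists t0 l, [/\ staircase t0 (rcons l t), endpoint t0,
    gx t0 < x /\ gy t0 < y & forall k, glab t0 k <= O].
Proof.
move=> [xt [yt [A [-> Ixt Iyt PA]]]] adm Ix Iy PO.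
have PO' : P (Num.min A O) by rewrite /Num.min; case: ifP.
have [|C PC [OC CA]] := label_bridge PO' PA; first by rewrite ge_min lexx.
have [x1 [y1 [Ix1 Iy1 xx1 yy1 adm1]]] := admissible_far_left PC Ixt Iyt.
have [x2 [y2 [Ix2 Iy2]]] :=
  admissible_far_left PO' (I_min Ix1 Ix) (I_min Iy1 Iy).
rewrite !lt_min => /andP[x12 xx2] /andP[y12 yy2] adm2.
have [l1 st1] := gconst_staircase fin_a fin_aV CA xx1 yy1 adm1 adm.
have [l2 st2] := gconst_staircase fin_a fin_aV OC x12 y12 adm2 adm1.
exists (gconst x2 y2 (Num.min A O)), (rcons l2 (gconst x1 y1 C) ++ l1).
rewrite rcons_cat; split=> //.
- by apply: staircase_cat; rewrite ?last_rcons.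
- by exists x2, y2, (Num.min A O).
- by move=> k; rewrite /= ge_min lexx orbT.
Qed.

Definition spanning (c : gpoint X * seq (gpoint X)) :=
  [/\ staircase c.1 c.2, endpoint c.1 & endpoint (last c.1 c.2)].

Definition points (c : gpoint X * seq (gpoint X)) := c.1 :: c.2.

Lemma spanning_extend c x y O : spanning c -> I x -> I y -> P O ->
  exists c', [/\ spanning c', {subset points c <= points c'},
    gx c'.1 < x < gx (last c'.1 c'.2), gy c'.1 < y < gy (last c'.1 c'.2) &
    forall k, glab c'.1 k <= O <= glab (last c'.1 c'.2) k].
Proof.
case: c => t l [/= st end_t end_l] Ix Iy PO; have [_ adm] := st.
have [t0 [l0 [st0 end_t0 [x0x y0y] O0]]] :=
  extend_left end_t (adm _ (mem_head _ _)) Ix Iy PO.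
have [l1 [st1 end_l1 [xx1 yy1] O1]] :=
  extend_right end_l (adm _ (mem_last _ _)) Ix Iy PO.
exists (t0, rcons l0 t ++ l ++ l1).
split=> [|p|||k]; rewrite /= ?last_cat ?last_rcons ?last_cat.
- split; rewrite /= ?last_cat ?last_rcons ?last_cat //.
  by do 2![apply: staircase_cat; rewrite ?last_rcons //].
- by rewrite !inE !mem_cat mem_rcons inE => /orP[/eqP->|->];
    rewrite ?eqxx ?orbT.
- by rewrite x0x.
- by rewrite y0y.
- by rewrite O0 O1.
Qed.

Lemma spanning_refine c C v : refinable a s P K C v -> spanning c ->
  exists c', [/\ spanning c', {subset points c <= points c'},
    c'.1 = c.1 /\ last c'.1 c'.2 = last c.1 c.2 &
    forall f, C f -> f c.1 <= v <= f (last c.1 c.2) -> v \in map f (points c')].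
Proof.
case: c => t l ref [/= st end_t end_l].
have [l' [st' last_l' sub_l' visit]] := staircase_refine ref st.
exists (t, l'); split=> //=; first by split; rewrite /= ?last_l'.
by move=> p; rewrite !inE => /predU1P[->|/sub_l'->]; rewrite ?eqxx ?orbT.
Qed.

Lemma spanning_visit c x y O : spanning c -> I x -> I y -> P O ->
  exists c', [/\ spanning c', {subset points c <= points c'},
    x \in map (@gx X) (points c'), y \in map (@gy X) (points c') &
    forall k, K k -> O \in map (@glab X ^~ k) (points c')].
Proof.
move=> sp Ix Iy PO.
have [c0 [sp0 sub0 xb yb Ob]] := spanning_extend sp Ix Iy PO.
have le_of_lt (u v w : rat) : u < v < w -> u <= v <= w.
  by move=> /andP[uv vw]; rewrite !ltW.
have [c1 [sp1 sub1 [fst1 last1] vis_x]] :=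
  spanning_refine (refinable_gx fin_a fin_aV x) sp0.
have [c2 [sp2 sub2 [fst2 last2] vis_y]] :=
  spanning_refine (refinable_gy fin_a fin_aV y) sp1.
have [c3 [sp3 sub3 _ vis_O]] :=
  spanning_refine (refinable_glab fin_a fin_aV alt_s PO) sp2.
have sub_map f c' c'' : {subset points c' <= points c''} ->
    {subset map f (points c') <= map f (points c'') :> seq rat}.
  by move=> sub _ /mapP[p /sub pc ->]; exact: map_f.
exists c3; split=> [//|p pc||| k Kk].
- exact/sub3/sub2/sub1/sub0.
- by apply/(sub_map _ _ _ sub3)/(sub_map _ _ _ sub2)/vis_x => //;
    exact: le_of_lt.
- apply/(sub_map _ _ _ sub3)/vis_y => //.
  by rewrite last1 fst1; exact: le_of_lt.
- by apply: vis_O; [exists k|rewrite last2 fst2 last1 fst1].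
Qed.

Lemma staircase_in_interval t l p : path gstep t l -> endpoint t ->
  endpoint (last t l) -> p \in t :: l -> I (gx p) /\ I (gy p).
Proof.
move=> pth [x [y [A [tE Ix Iy _]]]] [x' [y' [A' [lE Ix' Iy' _]]]] pl.
have [tx ty] : gx t <= gx p /\ gy t <= gy p.
  move: pl; rewrite inE => /predU1P[->//|].
  by move=> /(gstep_path_precedes pth)/asboolP[/ltW ? /ltW ?].
have [xl yl] : gx p <= gx (last t l) /\ gy p <= gy (last t l).
  move: pth; case/splitPl: pl => l1 l2 <-; rewrite last_cat cat_path.
  move=> /andP[_]; case: l2 => // q l2 /gstep_path_precedes/(_ (mem_last q l2)).
  by move=> /asboolP[/ltW ? /ltW ?].
rewrite tE /= in tx ty; rewrite lE /= in xl yl.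
by split; [apply: (I_convex Ix Ix')|apply: (I_convex Iy Iy')]; apply/andP.
Qed.

End interval_staircases.

Section graph_solutions.
Variables (X : Type) (a : X -> autQ) (K : set X).
Implicit Types (k : X) (p q : gpoint X) (l : seq (gpoint X)).

Definition linked_step k : rel (gpoint X) :=
  fun p q => precedes K p q && `[< linked a k p q >].

(* The graph of an automorphism g of the interval I, given by labelled points:
   the labels of index k enumerate P monotonically, and points with a common
   label are joined by overlapping intervals. *)
Record graph_solution (adm : X -> gpoint X -> Prop) (I P : set rat)
    (S : set (gpoint X)) : Prop := GraphSolution {
  solution_in : forall p, S p -> [/\ I (gx p), I (gy p) &
    forall k, K k -> P (glab p k) /\ adm k p] ;
  solution_chain : forall p q, S p -> S q ->
    [\/ p = q, precedes K p q | precedes K q p] ;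
  solution_gx : forall x, I x -> exists2 p, S p & gx p = x ;
  solution_gy : forall y, I y -> exists2 p, S p & gy p = y ;
  solution_glab : forall k O, K k -> P O -> exists2 p, S p & glab p k = O ;
  solution_linked : forall k p q, K k -> S p -> S q -> precedes K p q ->
    glab p k = glab q k ->
    exists2 l, path (linked_step k) p (rcons l q) & forall r, r \in l -> S r }.

Lemma linked_path s p l q k : path (gstep a s K) p (rcons l q) -> K k ->
  glab p k = glab q k -> path (linked_step k) p (rcons l q).
Proof.
move=> + Kk; have stays_linked u v : gstep a s K u v ->
    glab v k <= glab u k -> glab u k = glab v k /\ linked_step k u v.
  move=> uv le_vu; rewrite /linked_step (gstep_precedes uv).
  move/asboolP: uv => [_ _ [A [B /(_ k Kk)[[same link]|[uA vB AB _]]]]].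
    by split=> //; exact/asboolP.
  by move: le_vu; rewrite uA vB leNgt AB.
elim: l p => [|r l IHl] p /= /andP[st pth] same.
  by have [|_ ->] := stays_linked p q st; rewrite ?same.
have le_rq : glab r k <= glab q k.
  have : q \in rcons l q by rewrite mem_rcons mem_head.
  by move=> /(gstep_path_precedes pth)/asboolP[_ _ /(_ k Kk)].
have [|same_r ->] := stays_linked p r st; first by rewrite same.
by rewrite IHl // -same_r.
Qed.

End graph_solutions.

Section solution_existence.
Variables (X : Type) (a : X -> autQ) (s : rat -> bool) (P I : set rat).
Variable K : set X.
Hypothesis fin_a : pointwise_finite a K.
Hypothesis fin_aV : pointwise_finite (fun k => ((a k)^-1)%g) K.
Hypothesis alt_s : alternates_on P s.
Hypothesis I_convex : forall x y z, I x -> I y -> x <= z <= y -> I z.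
Hypothesis I_up : forall x, I x -> exists2 y, I y & x < y.
Hypothesis I_down : forall x, I x -> exists2 y, I y & y < x.
Hypothesis I_a : forall k x, K k -> I x -> I (a k x).
Hypothesis I_aV : forall k x, K k -> I x -> I ((a k)^-1%g x).
Variables x0 O0 : rat.
Hypotheses (Ix0 : I x0) (PO0 : P O0).
Implicit Types (c : gpoint X * seq (gpoint X)).

Local Notation spanning := (spanning a s P I K).

Lemma spanning_sequence : exists cs : nat -> gpoint X * seq (gpoint X),
  [/\ forall n, spanning (cs n),
      forall m n, (m <= n)%N -> {subset points (cs m) <= points (cs n)},
      forall x, I x -> exists n, x \in map (@gx X) (points (cs n)) /\
        x \in map (@gy X) (points (cs n))
    & forall O, P O -> exists n, forall k, K k ->
        O \in map (@glab X ^~ k) (points (cs n))].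
Proof.
have [x1 [y1 [Ix1 Iy1 _ _ adm1]]] :=
  admissible_far_right s fin_a fin_aV I_up I_a I_aV PO0 Ix0 Ix0.
have sp1 : spanning (gconst x1 y1 O0, [::]).
  split=> /=; [|by exists x1, y1, O0|by exists x1, y1, O0].
  by split=> // p; rewrite inE => /eqP->.
pose q n : rat := odflt 0 (unpickle n).
pose x n := if `[< I (q n) >] then q n else x0.
pose O n := if `[< P (q n) >] then q n else O0.
have Ix n : I (x n) by rewrite /x; case: asboolP.
have PO n : P (O n) by rewrite /O; case: asboolP.
have next (nc : nat * {c | spanning c}) : {nc' : nat * {c | spanning c} |
    [/\ nc'.1 = nc.1.+1,
      {subset points (sval nc.2) <= points (sval nc'.2)},
      x nc.1 \in map (@gx X) (points (sval nc'.2)),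
      x nc.1 \in map (@gy X) (points (sval nc'.2)) &
      forall k, K k -> O nc.1 \in map (@glab X ^~ k) (points (sval nc'.2))]}.
  case: nc => n [c sp_c]; apply: cid.
  have [c' [sp' sub xc yc Oc]] := spanning_visit fin_a fin_aV alt_s I_up I_down
    I_a I_aV sp_c (Ix n) (Ix n) (PO n).
  by exists (n.+1, exist _ c' sp').
have [cs [cs0 csS]] := dependent_choice next (0%N, exist _ _ sp1).
have fst_cs n : (cs n).1 = n.
  by elim: n => [|n IHn]; [rewrite cs0|have [-> _ _ _ _] := csS n; rewrite IHn].
exists (fun n => sval (cs n).2); split=> [n|m n|z Iz|z Pz].
- exact: svalP.
- move=> /subnKC<-; elim: (n - m)%N => [|d IHd]; first by rewrite addn0.
  move=> p /IHd; rewrite addnS.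
  by have [_ sub _ _ _] := csS (m + d)%N; exact: sub.
- exists (pickle z).+1; have [_ _ + + _] := csS (pickle z).
  by rewrite fst_cs /x /q pickleK /= asboolT.
- exists (pickle z).+1; have [_ _ _ _] := csS (pickle z).
  by rewrite fst_cs /O /q pickleK /= asboolT.
Qed.

Theorem graph_solution_exists :
  exists S, graph_solution a K (directed a s) I P S.
Proof.
have [cs [sp_cs sub_cs cs_x cs_O]] := spanning_sequence.
pose S := [set p | exists n, p \in points (cs n)].
have common p q : S p -> S q ->
    exists n, p \in points (cs n) /\ q \in points (cs n).
  move=> [m pm] [n qn]; exists (maxn m n).
  by split; [apply: (sub_cs m)|apply: (sub_cs n)]; rewrite ?leq_maxl ?leq_maxr.
have pth n : path (gstep a s K) (cs n).1 (cs n).2 by have [[]] := sp_cs n.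
have joined p q : S p -> S q -> [\/ p = q,
    exists2 l, path (gstep a s K) p (rcons l q) & forall r, r \in l -> S r
  | exists2 l, path (gstep a s K) q (rcons l p) & forall r, r \in l -> S r].
  move=> Sp Sq; have [n [pn qn]] := common p q Sp Sq.
  have sub_S l : {subset l <= (cs n).2} -> forall r, r \in l -> S r.
    by move=> sub r /sub rl; exists n; rewrite inE rl orbT.
  have [->|[l pth_l /sub_S lS]|[l pth_l /sub_S lS]] :=
    path_trichotomy (pth n) pn qn.
  - exact: Or31.
  - by apply: Or32; exists l.
  - by apply: Or33; exists l.
have joined_precedes p l q : path (gstep a s K) p (rcons l q) -> precedes K p q.
  by move=> /gstep_path_precedes; apply; rewrite mem_rcons mem_head.
exists S.
split=> [p [n pn]|p q Sp Sq|x Ix|y Iy|k O Kk PO|k p q Kk Sp Sq pq same].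
- have [[_ adm] end_h end_l] := sp_cs n.
  have [Ix Iy] := staircase_in_interval I_convex (pth n) end_h end_l pn.
  by split=> // k; exact: adm.
- have [->|[l pth_l _]|[l pth_l _]] := joined p q Sp Sq.
  + exact: Or31.
  + by apply: Or32; exact: joined_precedes pth_l.
  + by apply: Or33; exact: joined_precedes pth_l.
- by have [n [/mapP[p pn ->] _]] := cs_x x Ix; exists p => //; exists n.
- by have [n [_ /mapP[p pn ->]]] := cs_x y Iy; exists p => //; exists n.
- by have [n /(_ k Kk)/mapP[p pn ->]] := cs_O O PO; exists p => //; exists n.
- move/asboolP: (pq) => [x_pq _ _].
  have [e|[l pth_l lS]|[l /joined_precedes/asboolP[x_qp _ _] _]] :=
    joined p q Sp Sq.
  + by rewrite e ltxx in x_pq.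
  + by exists l => //; exact: linked_path pth_l Kk same.
  + by have := lt_trans x_pq x_qp; rewrite ltxx.
Qed.

End solution_existence.

(** * Gluing over the gaps between fixed points *)

Section gaps.
Variable f : autQ.
Implicit Types (k : autQ) (x y z : rat).

(* For a non-fixed point x this is the maximal convex set without fixed points
   of f around x; for a fixed point it is {x}. *)
Definition gap x : set rat :=
  [set y | forall z, f z = z -> (z < x) = (z < y) /\ (x < z) = (y < z)].

Lemma gap_refl x : gap x x. Proof. by []. Qed.

Lemma gap_sym x y : gap x y -> gap y x.
Proof. by move=> xy z /xy[-> ->]. Qed.

Lemma gap_trans x y z : gap x y -> gap y z -> gap x z.
Proof. by move=> xy yz w fw; have [-> ->] := xy w fw; exact: yz. Qed.

Lemma gap_eq x y : gap x y -> gap x = gap y.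
Proof.
move=> xy; apply/seteqP; split=> z; last exact: gap_trans.
exact/gap_trans/gap_sym.
Qed.

Lemma gap_fixed x y : f x = x -> gap x y -> y = x.
Proof.
move=> fx /(_ x fx); rewrite ltxx => -[xy yx].
by apply/eqP; rewrite eq_le !leNgt -xy -yx.
Qed.

Lemma gap_nonfixed x y : f x <> x -> gap x y -> f y <> y.
Proof.
by move=> nfx /gap_sym yx fy; have e := gap_fixed fy yx; rewrite e in nfx.
Qed.

Lemma gap_convex x y z w : gap x y -> gap x z -> y <= w <= z -> gap x w.
Proof.
move=> xy xz /andP[yw wz] u fu.
have [uxy xyu] := xy u fu; have [uxz xzu] := xz u fu; split.
  by apply/idP/idP => [|uw]; [rewrite uxy => /lt_le_trans; exact
                             |rewrite uxz; exact: lt_le_trans wz].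
by apply/idP/idP => [|wu]; [rewrite xzu; exact: le_lt_trans
                           |rewrite xyu; exact: le_lt_trans wu].
Qed.

Lemma gap_autQ k x : fixed_points f `<=` fixed_points k -> gap x (k x).
Proof. by move=> fk z /fk kz; rewrite -{2 4}kz !autQ_mono. Qed.

Lemma fixed_pointsV k : fixed_points (k^-1)%g = fixed_points k.
Proof.
apply/seteqP; split=> x; rewrite /fixed_points /= => kx.
  by rewrite -[in LHS]kx autQVK.
by rewrite -[in LHS]kx autQK.
Qed.

Lemma gap_orbital x y : orbital f x y -> gap x y.
Proof.
have fix_expgz n : fixed_points f `<=` fixed_points (expgz f n).
  by move=> z fz; apply: (orbital_fixed fz); exact: orbital_expgz.
by move=> /orbitalP[m [n]]; apply: gap_convex; exact: gap_autQ.
Qed.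

Lemma gap_sep x y x' y' : x < y -> ~ gap x y -> gap x x' -> gap y y' -> x' < y'.
Proof.
move=> xy nxy xx' yy'.
have [z [fz xz zy]] : exists z, [/\ f z = z, x <= z & z <= y].
  apply: contrapT => nz; apply: nxy => z fz.
  have [zx|xz] := ltP z x.
    by have zy := lt_trans zx xy; rewrite zy (lt_gtF zx) (lt_gtF zy).
  have [yz|zy] := ltP y z.
    by have {}xz := lt_trans xy yz; rewrite xz (lt_gtF yz).
  by exfalso; apply: nz; exists z.
have x'z : x' <= z.
  by have [zx _] := xx' z fz; rewrite leNgt -zx -leNgt.
have zy'' : z <= y'.
  by have [_ yz] := yy' z fz; rewrite leNgt -yz -leNgt.
rewrite lt_neqAle (le_trans x'z zy'') andbT; apply/eqP => e; apply: nxy.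
by apply: gap_trans xx' _; rewrite e; exact: gap_sym.
Qed.

Lemma gap_unbounded x : finitely_many_fixed_points f -> f x <> x ->
  (exists2 y, gap x y & x < y) /\ (exists2 y, gap x y & y < x).
Proof.
move=> fin nfx.
have not_x z : f z = z -> z != x by move=> fz; apply/eqP => e; rewrite e in fz.
split.
  have [|y /andP[xy _] fix_y] := @finite_gap_above _ _ x (x + 1) fin.
    by rewrite ltrDl.
  exists y => // z fz; case: ltgtP (not_x z fz) => // [zx|xz] _.
    by have zy := lt_trans zx xy; rewrite zy lt_gtF.
  by have yz := fix_y z fz xz; rewrite yz lt_gtF.
have [|y /andP[_ yx] fix_y] := @finite_gap_below _ _ (x - 1) x fin.
  by rewrite ltrBlDr ltrDl.
exists y => // z fz; case: ltgtP (not_x z fz) => // [zx|xz] _.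
  by have zy := fix_y z fz zx; rewrite zy lt_gtF.
by have yz := lt_trans yx xz; rewrite yz lt_gtF.
Qed.

End gaps.

Section solutions_on_gaps.
Variables (f : autQ) (K : set autQ).
Hypothesis alt_f : alternating_orbitals f.
Hypothesis fin_f : finitely_many_fixed_points f.
Hypothesis fin_K : pointwise_finite id K.
Hypothesis fin_KV : pointwise_finite (fun k => (k^-1)%g) K.
Hypothesis K_fix : forall k, K k -> fixed_points f `<=` fixed_points k.
Implicit Types (k : autQ) (I : set rat) (p q : gpoint autQ).

Definition labels I : set rat := [set z | I z /\ orbital_rep f z = z].

Definition codirected k p :=
  sgz (k (gy p) - gx p) = direction f (glab p k).

Lemma directed_codirected k p : f (glab p k) <> glab p k ->
  directed id (fun z => z < f z) k p -> codirected k p.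
Proof.
move=> nfix; rewrite /directed /codirected /direction => dir.
apply/eqP; rewrite sgz_eq !subr_eq0 !subr_gt0.
move: dir; case: (ltgtP (glab p k) (f (glab p k))) => [_|_|e _].
- by move=> dir; rewrite dir (gt_eqF dir).
- by move=> dir; rewrite (lt_gtF dir) (lt_eqF dir).
- by rewrite -e in nfix.
Qed.

Lemma alternates_on_labels x : f x <> x ->
  alternates_on (labels (gap f x)) (fun z => z < f z).
Proof.
move=> nfx y z [gy_ rep_y] [gz rep_z] yz /eqP same.
have dir_eq u v : gap f x u -> gap f x v ->
    (direction f u == direction f v) = ((u < f u) == (v < f v)).
  move=> /(gap_nonfixed nfx)/eqP/negbTE nfu /(gap_nonfixed nfx)/eqP/negbTE nfv.
  by rewrite direction_eq nfu nfv.
have nyz : ~ orbital f y z.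
  by move=> /eq_orbital_rep; rewrite rep_y rep_z => e; rewrite e ltxx in yz.
have /alternating_orbitalsP alt := alt_f.
have [|dir0|w /andP[yw wz] dir_w] := alt y z yz nyz.
- by apply/eqP; rewrite dir_eq.
- by have /eqP := dir0; rewrite direction_eq0 => /eqP; exact: gap_nonfixed gy_.
have gw : gap f x w by apply: (gap_convex gy_ gz); rewrite !ltW.
have rep_w := orbital_repP f w.
have g_rep : gap f x (orbital_rep f w) by apply: (gap_trans gw);
  exact: gap_orbital.
have dir_rep : direction f (orbital_rep f w) <> direction f y.
  by rewrite -(direction_orbital rep_w).
exists (orbital_rep f w); first by split=> //; exact: orbital_rep_idem.
split; last by rewrite -dir_eq //; apply/eqP.
apply/andP; split.
  apply: (orbital_sep yw _ (orbital_refl _ _) rep_w) => /direction_orbital/esym.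
  exact: dir_w.
apply: (orbital_sep wz _ rep_w (orbital_refl _ _)) => /direction_orbital e.
by apply: dir_w; rewrite e; apply/esym/eqP; rewrite dir_eq.
Qed.

Lemma gap_solution_exists x : exists S,
  graph_solution id K codirected (gap f x) (labels (gap f x)) S.
Proof.
have [fx|nfx] := pselect (f x = x).
  have gap_x y : gap f x y -> y = x by exact: gap_fixed.
  exists [set GPoint x x (fun=> x)].
  split=> [_ ->|_ _ -> ->|y /gap_x->|y /gap_x->|k z _ [/gap_x-> _]|
    k _ _ _ -> ->].
  - split=> // k /K_fix/(_ x fx) kx; split; last first.
      by rewrite /codirected /direction /= kx fx.
    by split=> //; apply: (orbital_fixed fx); exact: orbital_repP.
  - exact: Or31.
  - by exists (GPoint x x (fun=> x)).
  - by exists (GPoint x x (fun=> x)).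
  - by exists (GPoint x x (fun=> x)).
  - by move=> /asboolP[/=]; rewrite ltxx.
have nfix y : gap f x y -> f y <> y by exact: gap_nonfixed.
have [y z w gy_ gz|y gxy|y gxy|k y Kk gxy|k y Kk gxy|||S sol] :=
  @graph_solution_exists _ id (fun z => z < f z) (labels (gap f x)) (gap f x)
    K fin_K fin_KV (alternates_on_labels nfx) _ _ _ _ _ x (orbital_rep f x).
- exact: gap_convex gy_ gz.
- have [[z gyz yz] _] := gap_unbounded fin_f (nfix y gxy).
  by exists z => //; exact: gap_trans gxy gyz.
- have [_ [z gyz zy]] := gap_unbounded fin_f (nfix y gxy).
  by exists z => //; exact: gap_trans gxy gyz.
- exact: gap_trans gxy (gap_autQ _ (K_fix Kk)).
- by apply: gap_trans gxy _; apply: gap_autQ; rewrite fixed_pointsV;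
    exact: K_fix.
- exact: gap_refl.
- by split; [exact/gap_orbital/orbital_repP|exact: orbital_rep_idem].
exists S; case: sol => S_in S_chain S_gx S_gy S_glab S_linked; split=> // p Sp.
have [gpx gpy lab_p] := S_in p Sp; split=> // k Kk.
have [[g_lab rep_lab] dir] := lab_p k Kk; split=> //.
by apply: directed_codirected dir; exact: nfix.
Qed.

Lemma solution_precedes (adm : autQ -> gpoint autQ -> Prop) S S' p q :
  graph_solution id K adm (gap f (gx p)) (labels (gap f (gx p))) S ->
  graph_solution id K adm (gap f (gx q)) (labels (gap f (gx q))) S' ->
  S p -> S' q -> gx p < gx q -> ~ gap f (gx p) (gx q) -> precedes K p q.
Proof.
move=> solS solS' Sp Sq xpq npq; apply/asboolP.
have [_ yp lab_p] := solution_in solS Sp.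
have [_ yq lab_q] := solution_in solS' Sq.
split=> // [|k Kk]; first exact: gap_sep xpq npq yp yq.
have [[gp _] _] := lab_p k Kk; have [[gq _] _] := lab_q k Kk.
exact/ltW/(gap_sep xpq npq).
Qed.

Lemma solution_glue (adm : autQ -> gpoint autQ -> Prop) :
  (forall x, exists S,
    graph_solution id K adm (gap f x) (labels (gap f x)) S) ->
  exists S, graph_solution id K adm setT (labels setT) S.
Proof.
move=> gap_sol; have /choice[Sol SolP] : forall I, exists S, forall x,
    I = gap f x -> graph_solution id K adm I (labels I) S.
  move=> I; have [[x ->]|nI] := pselect (exists x, I = gap f x).
    by have [S sol] := gap_sol x; exists S.
  by exists set0 => x e; case: nI; exists x.
have sol x :
  graph_solution id K adm (gap f x) (labels (gap f x)) (Sol (gap f x)).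
  exact: SolP.
pose S := [set p | Sol (gap f (gx p)) p].
have S_of x p : Sol (gap f x) p -> S p.
  by move=> Sp; have [/gap_eq e _ _] := solution_in (sol x) Sp;
    rewrite /S /= -e.
exists S.
split=> [p Sp|p q Sp Sq|x _|y _|k O Kk [_ rep_O]|k p q Kk Sp Sq pq same].
- have [_ _ lab_p] := solution_in (sol _) Sp; split=> // k Kk.
  by have [[_ rep_lab] adm_p] := lab_p k Kk.
- have [gpq|ngpq] := pselect (gap f (gx p) (gx q)).
    by apply: (solution_chain (sol (gx p))) => //; rewrite (gap_eq gpq).
  have [xpq|xqp|e] := ltgtP (gx p) (gx q); last by case: ngpq; rewrite e.
    by apply: Or32; exact: solution_precedes (sol _) (sol _) _ _ _ _.
  apply: Or33; apply: solution_precedes (sol _) (sol _) _ _ _ _ => //.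
  by move=> /gap_sym.
- have [p Sp px] := solution_gx (sol x) (@gap_refl f x).
  by exists p => //; exact: S_of Sp.
- have [p Sp py] := solution_gy (sol y) (@gap_refl f y).
  by exists p => //; exact: S_of Sp.
- have [p Sp labO] := solution_glab (sol O) Kk (conj (@gap_refl f O) rep_O).
  by exists p => //; exact: S_of Sp.
- have [_ _ /(_ k Kk)[[gp _] _]] := solution_in (sol _) Sp.
  have [_ _ /(_ k Kk)[[gq _] _]] := solution_in (sol _) Sq.
  have gpq : gap f (gx p) (gx q).
    by apply: gap_trans gp _; rewrite same; exact: gap_sym.
  rewrite /S /= -(gap_eq gpq) in Sq.
  have [l pth lS] := solution_linked (sol _) Kk Sp Sq pq same.
  by exists l => // r /lS; exact: S_of.
Qed.

Lemma linked_path_orbital (g : autQ) k l p q :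
  path (linked_step id K k) p (rcons l q) ->
  (forall r, r \in p :: rcons l q -> g (gx r) = gy r) ->
  orbital (k * g)%g (gx p) (gx q).
Proof.
have linked_orbital u v : linked_step id K k u v ->
    g (gx u) = gy u -> g (gx v) = gy v -> orbital (k * g)%g (gx u) (gx v).
  move=> /andP[/asboolP[/ltW x_uv _ _] /asboolP[]] link g_u g_v.
    apply: (orbital_convex (orbital_refl _ _) (orbital_autQ _ _)).
    by rewrite autQM g_u x_uv.
  apply: orbital_sym;
    apply: (orbital_convex (orbital_autQ _ _) (orbital_refl _ _)).
  by rewrite autQM g_v x_uv andbT.
elim: l p => [|r l IHl] p /= /andP[pr pth] g_pt.
  by apply: linked_orbital pr _ _; apply: g_pt; rewrite !inE eqxx ?orbT.
have g_r : g (gx r) = gy r by apply: g_pt; rewrite !inE eqxx orbT.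
apply: orbital_trans (linked_orbital _ _ pr _ g_r) (IHl _ pth _).
  by apply: g_pt; exact: mem_head.
by move=> u ul; apply: g_pt; rewrite inE ul orbT.
Qed.

Lemma conjugate_of_solution S :
  graph_solution id K codirected setT (labels setT) S ->
  exists g : autQ, forall k, K k -> exists h : autQ, (k * g)%g = (f ^ h)%g.
Proof.
case=> S_in S_chain S_gx S_gy S_glab S_linked.
have /choice[T TP] x : exists p, S p /\ gx p = x.
  by have [p Sp px] := S_gx x I; exists p.
have T_S x : S (T x) by have [] := TP x.
have gx_T x : gx (T x) = x by have [] := TP x.
have T_precedes x y : x < y -> precedes K (T x) (T y).
  move=> xy; have [e||/asboolP[]] := S_chain _ _ (T_S x) (T_S y) => //.
    by move: xy; rewrite -(gx_T x) e gx_T ltxx.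
  by rewrite !gx_T => yx; have := lt_trans xy yx; rewrite ltxx.
have TK p : S p -> T (gx p) = p.
  move=> Sp; have [//|/asboolP[]|/asboolP[]] := S_chain _ _ (T_S (gx p)) Sp;
    by rewrite gx_T ltxx.
have [x y /T_precedes/asboolP[]//|y|g gE] :=
  @autQ_of_homo_onto (fun x => gy (T x)).
  by have [p Sp py] := S_gy y I; exists (gx p); rewrite TK.
exists g => k Kk.
apply: (@conjugate_of_labelling _ f (fun x => glab (T x) k)) => //.
split=> [x y|x|x|z|x y].
- rewrite le_eqVlt => /predU1P[->//|/T_precedes/asboolP[_ _]]; exact.
- by have [_ _ /(_ k Kk)[[]]] := S_in _ (T_S x).
- have [_ _ /(_ k Kk)[_ <-]] := S_in _ (T_S x).
  by rewrite /direction autQM gE gx_T.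
- have [p Sp lab_p] :=
    S_glab k (orbital_rep f z) Kk (conj I (orbital_rep_idem f z)).
  by exists (gx p); rewrite TK.
- wlog xy : x y / x < y => [hwlog same|same].
    have [xy|yx|->] := ltgtP x y; [exact: hwlog| |exact: orbital_refl].
    exact/orbital_sym/hwlog.
  have [l pth lS] :=
    S_linked k _ _ Kk (T_S x) (T_S y) (T_precedes _ _ xy) same.
  rewrite -(gx_T x) -(gx_T y); apply: linked_path_orbital pth _ => r.
  rewrite inE mem_rcons inE gE => /or3P[/eqP->|/eqP->|/lS Sr]; rewrite TK //;
    exact: T_S.
Qed.

Theorem common_conjugate :
  exists g : autQ, forall k, K k -> exists h : autQ, (k * g)%g = (f ^ h)%g.
Proof.
have [S sol] := solution_glue gap_solution_exists.
exact: conjugate_of_solution sol.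
Qed.

End solutions_on_gaps.

(** * Compactness and tightness *)

Section translations.
Variable G : topologicalGroupType.
Implicit Types (g h x : G) (A B : set G).
Local Open Scope group_scope.

Lemma translation_continuous g h : continuous (fun x => g * x * h).
Proof.
move=> x; have mul2 u v : continuous (fun x : G => u x) -> continuous v ->
    {for x, continuous (fun x : G => u x * v x : G)}.
  move=> cu cv; apply: (@continuous_comp _ _ _ (fun y => (u y, v y))
    (fun uv : G * G => uv.1 * uv.2)); last exact: mulg_continuous.
  by apply: cvg_pair; [exact: cu|exact: cv].
apply: mul2; last by move=> ?; exact: cvg_cst.
move=> y; apply: (@continuous_comp _ _ _ (fun y => (g, y))
  (fun uv : G * G => uv.1 * uv.2)); last exact: mulg_continuous.
by apply: cvg_pair; [exact: cvg_cst|exact: cvg_id].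
Qed.

Lemma translateE g h A : translate g A h = (fun x => g^-1 * x * h^-1) @^-1` A.
Proof.
apply/seteqP; split=> [_ [x Ax <-]|x Ax] /=.
  by rewrite !mulgA mulVg mul1g mulgK.
exists (g^-1 * x * h^-1) => //.
by rewrite !mulgA mulgV mul1g mulgVK.
Qed.

Local Notation borelG := (g_sigma_algebraType (@open G)).

Lemma open_borel A : open A -> measurable (A : set borelG).
Proof. by move=> oA; exact: sub_sigma_algebra. Qed.

Lemma continuous_borel (phi : G -> G) : continuous phi ->
  measurable_fun setT (phi : borelG -> borelG).
Proof.
move=> cphi; apply: (@measurability _ _ borelG borelG setT phi (@open G)) => //.
move=> _ [A oA <-]; rewrite setTI; apply: open_borel.
by move/continuousP: cphi; exact.
Qed.

Lemma borel_translate g h A :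
  measurable (A : set borelG) -> measurable (translate g A h : set borelG).
Proof.
move=> mA; rewrite translateE -[X in measurable X]setTI.
by apply: (continuous_borel (@translation_continuous g^-1 h^-1)).
Qed.

Definition conj_class x : set G := [set x ^ g | g in [set: G]].

Lemma conj_class_refl x : conj_class x x.
Proof. by exists 1 => //; rewrite conjg1. Qed.

Lemma conj_class_sym x y : conj_class x y -> conj_class y x.
Proof. by move=> [g _ <-]; exists g^-1 => //; rewrite conjgK. Qed.

End translations.

Section pointwise_topology.
Implicit Types (f g : autQ) (K : set autQ).

Lemma nbhs_autQP f (A : set autQ) : nbhs f A <->
  exists s : seq rat, forall g, {in s, g =1 f} -> A g.
Proof.
split=> [|[s sA]].
  pose F : set_system autQ :=
    [set B | exists s : seq rat, forall g, {in s, g =1 f} -> B g].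
  have FF : Filter F.
    split; first by exists [::].
    - move=> B C [s sB] [r rC]; exists (s ++ r) => g gf; split.
        by apply: sB => x xs; apply: gf; rewrite mem_cat xs.
      by apply: rC => x xr; apply: gf; rewrite mem_cat xr orbT.
    - by move=> B C BC [s sB]; exists s => g /sB/BC.
  suff Ff : F --> f by move/Ff.
  by apply: autQ_cvg => x; exists [:: x] => g; apply; exact: mem_head.
apply: filterS sA _; elim: s => [|x s IHs].
  by apply: filterS filterT => g _ x.
apply: filterS (filterI (autQ_nbhs1 f x) IHs) => g [gx gs] y.
by rewrite inE => /predU1P[->//|]; exact: gs.
Qed.

Lemma open_agree f (S : set rat) : finite_set S ->
  open [set g : autQ | forall x, S x -> g x = f x].
Proof.
move=> /finite_seqP[s ->]; rewrite openE => g gf.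
by apply/nbhs_autQP; exists s => h hg x xs; rewrite hg ?gf.
Qed.

Lemma open_eval (x y : rat) : open [set g : autQ | g x = y].
Proof.
rewrite openE => g gx; apply/nbhs_autQP; exists [:: x] => h hg.
by rewrite /= hg ?mem_head.
Qed.

Lemma compact_pointwise_finite K : compact K -> pointwise_finite id K.
Proof.
rewrite compact_cover => + x.
move=> /(_ rat setT (fun y => [set g : autQ | g x = y])).
case=> [y _|k _|D _ KD]; [exact: open_eval|by exists (k x)|].
apply: sub_finite_set (finite_fset D).
by move=> _ [k Kk <-]; have [y yD /= ->] := KD k Kk.
Qed.

Lemma compact_pointwise_finiteV K : compact K ->
  pointwise_finite (fun k => (k^-1)%g) K.
Proof.
move=> cK x; have cKV : compact [set (k^-1)%g | k in K].
  apply: continuous_compact cK; apply: continuous_subspaceT.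
  exact: autQ_inv_continuous.
apply: sub_finite_set (compact_pointwise_finite cKV x).
by move=> _ [k Kk <-]; exists (k^-1)%g => //; exists k.
Qed.

End pointwise_topology.

(* For an h0 agreeing with K on the fixed points of f, the automorphisms
   h0^-1 * k fix them, and have a common g with h0^-1 * k * g conjugate to f. *)
Lemma translate_into_conj_class (f h0 : autQ) (K : set autQ) :
  generic_autQ f -> pointwise_finite id K ->
  pointwise_finite (fun k => (k^-1)%g) K ->
  (forall k x, K k -> f x = x -> k x = h0 x) ->
  exists g, translate 1%g K g `<=` conj_class f.
Proof.
move=> [alt_f fin_f] finK finKV K_h0; pose K' := [set (h0^-1 * k)%g | k in K].
have [x|x|_ [k Kk <-] x fx|g gP] := @common_conjugate f K' alt_f fin_f.
- apply: sub_finite_set (finite_image (h0^-1)%g (finK x)).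
  by move=> _ [_ [k Kk <-] <-]; exists (k x) => //; exists k.
- apply: sub_finite_set (finKV (h0 x)).
  by move=> _ [_ [k Kk <-] <-]; exists k => //; rewrite invgM invgK.
- by rewrite /fixed_points /= (K_h0 _ _ Kk fx) autQK.
exists (g * h0^-1)%g => _ [k Kk <-].
have [|h kgE] := gP (h0^-1 * k)%g; first by exists k.
exists (h * h0^-1)%g => //; rewrite conjgM -kgE conjgE invgK.
by rewrite mul1g !mulgA mulgV mul1g.
Qed.

Lemma conj_class_compact_biter (f : autQ) :
  generic_autQ f -> compact_biter (conj_class f).
Proof.
move=> gen_f K cK [h0 Kh0]; have [_ fin_f] := gen_f.
pose U := [set k : autQ | forall x, fixed_points f x -> k x = h0 x].
have [x|x|k x [Uk _]|g sub_g] :=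
  @translate_into_conj_class f h0 (U `&` K) gen_f.
- apply: sub_finite_set (compact_pointwise_finite cK x).
  by move=> _ [k [_ Kk] <-]; exists k.
- apply: sub_finite_set (compact_pointwise_finiteV cK x).
  by move=> _ [k [_ Kk] <-]; exists k.
- exact: Uk.
exists U, 1%g, g; split=> //; first exact: open_agree.
by exists h0.
Qed.

Lemma conj_class_compact_catcher (f : autQ) :
  generic_autQ f -> fixed_points f = set0 -> compact_catcher (conj_class f).
Proof.
move=> gen_f no_fix K cK; exists 1%g;
  apply: (translate_into_conj_class (h0 := 1%g)) => //.
- exact: compact_pointwise_finite.
- exact: compact_pointwise_finiteV.
- by move=> k x _ fx; have : fixed_points f x by []; rewrite no_fix.
Qed.

Section measure_lemmas.
Context (d : measure_display) (T : measurableType d) (R : realType).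
Implicit Types (A K : set T).

Lemma negligible_exists (mu : {measure set T -> \bar R}) (I : countType)
    (A : I -> set T) :
  (forall i, mu.-negligible (A i)) -> mu.-negligible [set x | exists i, A i x].
Proof.
move=> nA; pose F n := if unpickle n is Some i then A i else set0.
apply: (@negligibleS _ _ _ _ (\bigcup_n F n)).
  by move=> x [i Aix]; exists (pickle i) => //; rewrite /F pickleK.
apply: negligible_bigcup => n; rewrite /F; case: (unpickle n) => [i|];
  first exact: nA.
exact: negligible_set0.
Qed.

Lemma measure_countable_cover (mu : {measure set T -> \bar R}) (I : countType)
    (L : I -> set T) K : measurable K -> (forall i, measurable (L i)) ->
  (forall x, K x -> exists i, L i x) -> mu K != 0%E ->
  exists i, mu (K `&` L i) != 0%E.
Proof.
move=> mK mL cover; apply: contra_neqP => /forallNP null_KL.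
apply: (measure_negligible mK).
apply: (negligibleS (mu := mu)) (negligible_exists (A := fun i => K `&` L i) _).
  by move=> x Kx; have [i Lix] := cover x Kx; exists i.
move=> i; exists (K `&` L i); split=> //; first exact: measurableI.
by apply/eqP; have /negP/negPn := null_KL i.
Qed.

Lemma measure_tail_small (mu : {finite_measure set T -> \bar R})
    (A : nat -> set T) (e : R) :
  (forall n, measurable (A n)) -> nonincreasing_seq A ->
  \bigcap_n A n = set0 -> 0 < e -> exists n, (mu (A n) <= e%:E)%E.
Proof.
move=> mA decrA capA e0.
have cvg_mu : (mu (A n) @[n --> \oo] --> 0)%E.
  rewrite -(measure0 mu) -capA; apply: nonincreasing_cvg_mu => //.
    by rewrite ltey_eq fin_num_measure.
  by rewrite capA.
have /fine_cvg cvg_fine : (mu (A n) @[n --> \oo] --> (0 : R)%:E)%E by [].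
have [N _ /(_ N (leqnn N))] := (cvgrPdist_le _ _).1 cvg_fine e e0.
rewrite /= sub0r normrN => le_e; exists N.
rewrite -[mu _]fineK ?fin_num_measure // lee_fin.
exact: le_trans (ler_norm _) le_e.
Qed.

Lemma probability_bounded (mu : probability T R) (F : nat -> T -> nat) :
  (forall n m, measurable [set x | (m <= F n x)%N]) ->
  exists K, [/\ measurable K, mu K != 0%E &
    forall n, exists m, forall x, K x -> (F n x < m)%N].
Proof.
move=> mF; have /choice[m mP] n : exists m,
    (mu [set x | (m <= F n x)%N] <= ((1/2)%R / (2 ^ n.+1)%:R)%:E)%E.
  apply: (@measure_tail_small mu (fun m => [set x | (m <= F n x)%N])) => //.
  - by move=> i j ij; rewrite subsetEset => x; exact: leq_trans.
  - rewrite -subset0 => x Fx; have := Fx (F n x).+1 I.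
    by rewrite /= ltnn.
pose Bad := \bigcup_n [set x | (m n <= F n x)%N].
have mBad : measurable Bad by apply: bigcupT_measurable => n; exact: mF.
have Bad_le : (mu Bad <= (1/2)%:E)%E.
  apply: le_trans (epsilon_trick0 predT (_ : (0 <= 1/2 :> R))); last by [].
  apply: le_trans (measure_sigma_subadditive mu _ mBad (@subset_refl _ _)) _.
    by move=> n; exact: mF.
  by apply: lee_nneseries => n _ //; exact: mP.
exists (~` Bad); split; first exact: measurableC.
  rewrite probability_setC //; apply/eqP => e.
  move: Bad_le; rewrite -[mu Bad]fineK ?fin_num_measure // lee_fin.
  move: e; rewrite -[mu Bad]fineK ?fin_num_measure // -EFinB => -[]; lra.
move=> n; exists (m n) => x nBad; rewrite ltnNge; apply/negP => Fx.
by apply: nBad; exists n.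
Qed.

End measure_lemmas.

Section countable_measurability.
Context (d : measure_display) (T : measurableType d).
Implicit Types A B : T -> Prop.

Lemma measurable_prop_cst (Q : Prop) : measurable [set _ : T | Q].
Proof.
have [q|nq] := pselect Q.
  by rewrite (_ : [set _ | _] = setT); [exact: measurableT|apply/seteqP; split].
by rewrite (_ : [set _ | _] = set0); [exact: measurable0|apply/seteqP; split].
Qed.

Lemma measurable_prop_not A :
  measurable [set x | A x] -> measurable [set x | ~ A x].
Proof. exact: measurableC. Qed.

Lemma measurable_prop_and A B :
  measurable [set x | A x] -> measurable [set x | B x] ->
  measurable [set x | A x /\ B x].
Proof. exact: measurableI. Qed.

Lemma measurable_prop_exists (I : countType) (A : I -> T -> Prop) :
  (forall i, measurable [set x | A i x]) ->
  measurable [set x | exists i, A i x].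
Proof.
move=> mA; rewrite (_ : [set x | _] = \bigcup_i [set x | A i x]); last first.
  by apply/seteqP; split=> x [i]; [exists i|move=> _ ?; exists i].
by apply: countable_bigcupT_measurable => //; exact: countableP.
Qed.

Lemma measurable_prop_forall (I : countType) (A : I -> T -> Prop) :
  (forall i, measurable [set x | A i x]) ->
  measurable [set x | forall i, A i x].
Proof.
move=> mA; rewrite (_ : [set x | _] = [set x | ~ exists i, ~ A i x]).
  by apply/measurable_prop_not/measurable_prop_exists => i;
    exact: measurable_prop_not.
by apply/seteqP; split=> x /= Ax => [[i]//|i]; apply: contrapT => nAx;
  apply: Ax; exists i.
Qed.

Lemma measurable_prop_imply A B : measurable [set x | A x] ->
  measurable [set x | B x] -> measurable [set x | A x -> B x].
Proof.
move=> mA mB; rewrite (_ : [set x | _] = ~` [set x | A x] `|` [set x | B x]).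
  by apply: measurableU => //; exact: measurableC.
apply/seteqP; split=> x /=; last by case=> // nAx /nAx.
by move=> AB; have [Ax|] := pselect (A x); [right; exact: AB|left].
Qed.

Lemma measurable_eq_countable (I : countType) (F G : T -> I) :
  (forall i, measurable [set x | F x = i]) ->
  (forall i, measurable [set x | G x = i]) -> measurable [set x | F x = G x].
Proof.
move=> mF mG.
rewrite (_ : [set x | _] = [set x | exists i, F x = i /\ G x = i]).
  by apply: measurable_prop_exists => i; exact: measurable_prop_and.
by apply/seteqP; split=> x /=; [exists (G x)|case=> i [-> ->]].
Qed.

Lemma measurable_pred_countable (I : countType) (F : T -> I) (Q : I -> Prop) :
  (forall i, measurable [set x | F x = i]) -> measurable [set x | Q (F x)].
Proof.
move=> mF; rewrite (_ : [set x | _] = [set x | exists i, Q i /\ F x = i]).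
  apply: measurable_prop_exists => i; apply: measurable_prop_and => //.
  exact: measurable_prop_cst.
by apply/seteqP; split=> x /=; [exists (F x)|case=> i [Qi ->]].
Qed.

End countable_measurability.

Notation borelQ := (g_sigma_algebraType (@open autQ)).

Lemma measurable_eval (x y : rat) :
  measurable ([set g : autQ | g x = y] : set borelQ).
Proof. exact: (open_borel (open_eval x y)). Qed.

Lemma measurable_evalV (x y : rat) :
  measurable ([set g : autQ | (g^-1)%g x = y] : set borelQ).
Proof.
rewrite (_ : [set _ | _] = [set g : autQ | g y = x]).
  exact: measurable_eval.
by apply/seteqP; split=> g /= <-; rewrite ?autQVK ?autQK.
Qed.

Lemma measurable_evals (s r : seq rat) :
  measurable ([set g : autQ | map g s = r] : set borelQ).
Proof.
elim: s r => [|x s IHs] [|y r] /=; [exact: measurable_prop_cst..| |].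
  by rewrite (_ : [set _ | _] = set0); [exact: measurable0|apply/seteqP; split].
rewrite (_ : [set _ | _] = [set g : autQ | g x = y /\ map g s = r]).
  by apply: measurable_prop_and; [exact: measurable_eval|exact: IHs].
by apply/seteqP; split=> g /=; case=> -> ->.
Qed.

Lemma finite_pickle_lt m : finite_set [set x : rat | (pickle x < m)%N].
Proof.
apply: sub_finite_set (finite_image (odflt 0 \o unpickle) (finite_II m)).
by move=> x xm; exists (pickle x); last by rewrite /comp pickleK.
Qed.

Lemma tight_autQ (R : realType) (mu : probability borelQ R) :
  exists K : set borelQ,
  [/\ measurable K, mu K != 0%E, pointwise_finite id K &
      pointwise_finite (fun k : autQ => (k^-1)%g) K].
Proof.
pose q n : rat := odflt 0 (unpickle n).
have qK x : q (pickle x) = x by rewrite /q pickleK.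
pose F n (k : borelQ) :=
  maxn (pickle ((k : autQ) (q n))) (pickle (((k : autQ)^-1)%g (q n))).
have [n m|K [mK K0 K_bounded]] := @probability_bounded _ _ R mu F.
  rewrite (_ : [set k | _] =
      [set k : borelQ | (m <= pickle ((k : autQ) (q n)))%N] `|`
      [set k : borelQ | (m <= pickle (((k : autQ)^-1)%g (q n)))%N]).
    apply: measurableU.
      exact: (measurable_pred_countable (fun y => m <= pickle y)%N
                                        (measurable_eval (q n))).
    exact: (measurable_pred_countable (fun y => m <= pickle y)%N
                                      (measurable_evalV (q n))).
  by apply/seteqP; split=> k /=; rewrite leq_max => /orP.
exists K; split=> // x; have [m K_lt] := K_bounded (pickle x);
  apply: sub_finite_set (finite_pickle_lt m) => _ [k /K_lt + <-];
  by rewrite /F qK gtn_max => /andP[].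
Qed.

Lemma generic_conj_class_not_haar_null (R : realType) (f : autQ) :
  generic_autQ f -> ~ haar_null R (conj_class f).
Proof.
move=> gen_f [B [bB [mu muB]] fB]; have [_ fin_f] := gen_f.
have [K [mK K0 finK finKV]] := tight_autQ mu.
have /finite_seqP[s sE] := fin_f.
have [r|k _|r Kr0] := @measure_countable_cover _ borelQ R mu (seq rat)
  (fun r => [set k : autQ | map k s = r]) K mK _ _ K0.
- exact: measurable_evals.
- by exists (map (k : autQ) s).
pose Kr : set autQ := K `&` [set k : autQ | map k s = r].
have [h0 [Kh0 h0r]] : Kr !=set0.
  by apply/set0P; apply: contra_neq Kr0 => e; rewrite -/Kr e measure0.
have [x|x|k x [_ kr] fx|g sub_g] := @translate_into_conj_class f h0 Kr gen_f.
- by apply: sub_finite_set (finK x) => _ [k [Kk _] <-]; exists k.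
- by apply: sub_finite_set (finKV x) => _ [k [Kk _] <-]; exists k.
- have xs : x \in s by have : fixed_points f x by []; rewrite sE.
  have /eq_in_map/(_ x xs) : map k s = map h0 s by rewrite [LHS]kr [RHS]h0r.
  by [].
move/eqP: Kr0; apply;
  apply: (@subset_measure0 _ _ _ mu _ (translate 1%g B g^-1%g)).
- apply: measurableI => //; exact: measurable_evals.
- exact: borel_translate.
- move=> k Kk; rewrite translateE /= invgK invg1 mul1g; apply: fB.
  by have := sub_g (k * g)%g; apply; exists k => //; rewrite mul1g.
- exact: muB.
Qed.

(** * A monotone family of automorphisms *)

Section capped_distance.
Variable R : realFieldType.
Implicit Types (D : seq R) (a b d w z : R).

Definition cdist D z : R := \big[Num.min/1]_(d <- D) `|z - d|.

Lemma cdist_cons d D z : cdist (d :: D) z = Num.min `|z - d| (cdist D z).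
Proof. by rewrite /cdist big_cons. Qed.

Lemma cdist_ge0 D z : 0 <= cdist D z.
Proof.
by elim: D => [|d D IHD]; rewrite ?cdist_cons ?le_min ?normr_ge0 //
  /cdist big_nil.
Qed.

Lemma cdist_mem D d : d \in D -> cdist D d = 0.
Proof.
elim: D => // d' D IHD; rewrite inE cdist_cons => /predU1P[->|/IHD->].
  by rewrite subrr normr0 min_l // cdist_ge0.
by rewrite min_r.
Qed.

Lemma cdist_lipschitz D z w : cdist D w <= cdist D z + `|w - z|.
Proof.
elim: D => [|d D IHD]; first by rewrite /cdist !big_nil lerDl.
rewrite !cdist_cons ge_min; case: (leP `|z - d| (cdist D z)) => _.
  by have := ler_distD z w d; rewrite [leRHS]addrC => ->.
by rewrite IHD orbT.
Qed.

Lemma cdist_cat_le D D' z : cdist (D' ++ D) z <= cdist D z.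
Proof. by elim: D' => //= d D' IHD'; rewrite cdist_cons ge_min IHD' orbT. Qed.

Lemma cdist_gt D a b : {in D, forall d, ~~ (a <= d <= b)} ->
  exists2 e, 0 < e & forall z, a <= z <= b -> e < cdist D z.
Proof.
elim: D => [|d D IHD] Dab.
  exists (1 / 2) => [|z _]; first lra.
  by rewrite /cdist big_nil; lra.
have [|e e0 e_lt] := IHD; first by move=> d' d'D; rewrite Dab // inE d'D orbT.
have [e' e'0 e'_lt] :
  exists2 e', 0 < e' & forall z, a <= z <= b -> e' < `|z - d|.
  have := Dab d (mem_head _ _); rewrite negb_and -!ltNge => /orP[da|bd].
    exists ((a - d) / 2) => [|z /andP[az _]]; first lra.
    by apply: lt_le_trans (ler_norm _); lra.
  exists ((d - b) / 2) => [|z /andP[_ zb]]; first lra.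
  by rewrite distrC; apply: lt_le_trans (ler_norm _); lra.
exists (Num.min e' e) => [|z abz]; first by rewrite lt_min e0 e'0.
by rewrite cdist_cons lt_min !gt_min e_lt // e'_lt // orbT.
Qed.

End capped_distance.

Section nudges.
Implicit Types (D : seq rat) (c d r z : rat).

Lemma autQ_min (f g : autQ) :
  exists h : autQ, forall z, h z = Num.min (f z) (g z).
Proof.
apply: autQ_of_homo_onto => [x y xy|y].
  by rewrite lt_min !gt_min !autQ_mono xy orbT.
have [fg|gf] := leP ((f^-1)%g y) ((g^-1)%g y).
  by exists ((g^-1)%g y); rewrite autQVK min_r // -autQV_le.
by exists ((f^-1)%g y); rewrite autQVK min_l // -autQV_le ltW.
Qed.

Lemma autQ_shift c : exists h : autQ, forall z, h z = z + c.
Proof.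
apply: autQ_of_homo_onto => [x y xy|y]; first by rewrite ltrD2r.
by exists (y - c); rewrite subrK.
Qed.

Lemma autQ_cone r d :
  0 <= r < 1 -> exists h : autQ, forall z, h z = z + r * `|z - d|.
Proof.
move=> /andP[r0 r1]; apply: autQ_of_homo_onto => [x y xy|y].
  have dist_le : `|x - d| <= y - x + `|y - d|.
    by rewrite -(gtr0_norm (_ : 0 < y - x)) ?subr_gt0 // (distrC y x) ler_distD.
  have : r * `|x - d| <= r * (y - x + `|y - d|) by rewrite ler_wpM2l.
  have : r * (y - x) < y - x by rewrite gtr_pMl ?subr_gt0.
  lra.
have [yd|dy] := leP d y.
  exists (d + (y - d) / (1 + r)); rewrite [d + _]addrC addrK ger0_norm.
    by field; lra.
  by rewrite divr_ge0 //; lra.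
exists (d + (y - d) / (1 - r)); rewrite [d + _]addrC addrK ler0_norm.
  by field; lra.
by rewrite pmulr_lle0 ?invr_gt0; lra.
Qed.

Lemma nudge_exists D r : 0 <= r < 1 ->
  exists h : autQ, forall z, h z = z + r * cdist D z.
Proof.
move=> r01; elim: D => [|d D [h hE]].
  have [h hE] := autQ_shift r.
  by exists h => z; rewrite hE /cdist big_nil mulr1.
have [k kE] := autQ_cone d r01; have [g gE] := autQ_min k h.
exists g => z; rewrite gE kE hE cdist_cons minr_pMr; last by case/andP: r01.
by rewrite addr_minr.
Qed.

(* Three nudges at level n.+1 displace a point by at most (1 + 2 + 4) / 9 of the
   displacement of one nudge at level n. *)
Definition slack n : rat := (9 ^+ n.+1)^-1.

Lemma slack_gt0 n : 0 < slack n.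
Proof. by rewrite invr_gt0 exprn_gt0. Qed.

Lemma slackS n : slack n = 9 * slack n.+1.
Proof. by rewrite /slack (exprS _ n.+1) invfM mulrA divff ?mul1r. Qed.

Lemma slack_bounds n : 0 <= slack n < 1.
Proof.
rewrite ltW ?slack_gt0 //= invf_lt1 ?exprn_gt0 //.
by rewrite exprn_egt1.
Qed.

Definition nudge D n : autQ := sval (cid (nudge_exists D (slack_bounds n))).

Lemma nudgeE D n z : nudge D n z = z + slack n * cdist D z.
Proof. exact: (svalP (cid (nudge_exists D (slack_bounds n)))). Qed.

Lemma le_nudge D n z : z <= nudge D n z.
Proof. by rewrite nudgeE lerDl mulr_ge0 ?cdist_ge0 ?ltW ?slack_gt0. Qed.

Lemma nudge_mem D n d : d \in D -> nudge D n d = d.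
Proof. by move=> dD; rewrite nudgeE cdist_mem // mulr0 addr0. Qed.

Lemma nudge_cat_le D D' n z : nudge (D' ++ D) n z <= nudge D n z.
Proof.
by rewrite !nudgeE lerD2l ler_wpM2l ?cdist_cat_le // ltW ?slack_gt0.
Qed.

Lemma nudge3_le D n z :
  nudge D n.+1 (nudge D n.+1 (nudge D n.+1 z)) <= nudge D n z.
Proof.
have /andP[r0 r1] := slack_bounds n.+1.
have cdist_nudge w : cdist D (nudge D n.+1 w) <= 2 * cdist D w.
  apply: le_trans (cdist_lipschitz _ w _) _.
  rewrite nudgeE addrAC subrr add0r ger0_norm ?mulr_ge0 ?cdist_ge0 //.
  have : slack n.+1 * cdist D w <= cdist D w.
    by rewrite ler_piMl ?cdist_ge0 // ltW.
  lra.
set z1 := nudge D n.+1 z; set z2 := nudge D n.+1 z1.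
have z1E : z1 = z + slack n.+1 * cdist D z by exact: nudgeE.
have z2E : z2 = z1 + slack n.+1 * cdist D z1 by exact: nudgeE.
rewrite !nudgeE (slackS n).
have cdist1 : slack n.+1 * cdist D z1 <= slack n.+1 * (2 * cdist D z).
  by rewrite ler_wpM2l // cdist_nudge.
have cdist2 : slack n.+1 * cdist D z2 <= slack n.+1 * (4 * cdist D z).
  have := cdist_nudge z1; have := cdist_nudge z;
    rewrite -/z1 -/z2 => le_z1 le_z2.
  by rewrite ler_wpM2l //; lra.
have := mulr_ge0 r0 (cdist_ge0 D z); lra.
Qed.

End nudges.

(* [gapped_on x y D F U]: locally uniformly on [x, y] off D, the graph of U
   stays above the graph of F shifted to the left. *)
Definition gapped_on (x y : rat) (D : seq rat) (F U : rat -> rat) :=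
  forall a b, x <= a -> b <= y -> {in D, forall d, ~~ (a <= d <= b)} ->
  exists2 e, 0 < e &
    forall z w, a <= z <= b -> a <= w <= b -> w <= z + e -> F w < U z.

Section monotone_family.
Implicit Types (be : nat -> bool) (m n : nat) (x y z d : rat).

(* Below the node of the tree of binary sequences reached by [be] after n
   steps, all automorphisms lie between [lower be n] and [upper be n] and have
   the values of [lower be n] on [frozen be n].  The three nudges of [nudge3_le]
   leave room for a gap between the two children of a node. *)
Fixpoint branch be n : autQ * seq rat :=
  if n is m.+1 then
    let: (F, D) := branch be m in
    let F' := if be m then (F * nudge D n * nudge D n)%g else F in
    (F', (if pickle_inv m is Some x then [:: x; (F'^-1)%g x] else [::]) ++ D)
  else (1%g, [::]).

Definition lower be n : autQ := (branch be n).1.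
Definition frozen be n : seq rat := (branch be n).2.
Definition upper be n : autQ := (lower be n * nudge (frozen be n) n)%g.

Definition new_frozen be n : seq rat :=
  if pickle_inv n is Some x then [:: x; ((lower be n.+1)^-1)%g x] else [::].

Lemma lowerS be n : lower be n.+1 = if be n
  then (lower be n * nudge (frozen be n) n.+1 * nudge (frozen be n) n.+1)%g
  else lower be n.
Proof. by rewrite /lower /frozen /=; case: (branch be n). Qed.

Lemma frozenS be n : frozen be n.+1 = new_frozen be n ++ frozen be n.
Proof. by rewrite /new_frozen /lower /frozen /=; case: (branch be n). Qed.

Lemma frozen_sub be m n : (m <= n)%N -> {subset frozen be m <= frozen be n}.
Proof.
move=> /subnKC<-; elim: (n - m)%N => [|k IHk]; first by rewrite addn0.
by move=> x /IHk xD; rewrite addnS frozenS mem_cat xD orbT.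
Qed.

Lemma lower_leS be n z : lower be n z <= lower be n.+1 z.
Proof.
rewrite lowerS; case: (be n) => //; rewrite !autQM autQ_le_mono.
by apply: le_trans (le_nudge _ _ _) (le_nudge _ _ _).
Qed.

Lemma lower_le be m n z : (m <= n)%N -> lower be m z <= lower be n z.
Proof.
apply: (@homo_leq _ (fun i => lower be i z) (fun x y => x <= y)) => [x||k].
- exact: lexx.
- by move=> x y w; exact: le_trans.
- exact: lower_leS.
Qed.

Lemma upper_geS be n z : upper be n.+1 z <= upper be n z.
Proof.
rewrite /upper !autQM frozenS.
have shrink : nudge (new_frozen be n ++ frozen be n) n.+1 z <=
  nudge (frozen be n) n.+1 z by exact: nudge_cat_le.
rewrite lowerS; case: (be n); rewrite ?autQM autQ_le_mono; last first.
  apply: le_trans shrink (le_trans _ (nudge3_le _ _ _)).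
  by apply: le_trans (le_nudge _ _ _) (le_nudge _ _ _).
by apply: le_trans (nudge3_le _ _ _); rewrite !autQ_le_mono.
Qed.

Lemma upper_ge be m n z : (m <= n)%N -> upper be n z <= upper be m z.
Proof.
apply: (@homo_leq _ (fun i => upper be i z) (fun x y => y <= x)) => [x||k].
- exact: lexx.
- by move=> x y w xy yw; exact: le_trans yw xy.
- exact: upper_geS.
Qed.

Lemma lower_le_upper be n z : lower be n z <= upper be n z.
Proof. by rewrite /upper autQM autQ_le_mono le_nudge. Qed.

Lemma lower_frozen be m n x : (m <= n)%N -> x \in frozen be m ->
  lower be n x = lower be m x.
Proof.
move=> mn xD; apply/eqP; rewrite eq_le (lower_le _ _ mn) andbT.
have -> : lower be m x = upper be m x by rewrite /upper autQM nudge_mem.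
exact: le_trans (lower_le_upper _ _ _) (upper_ge _ _ mn).
Qed.

Lemma mem_new_frozen be x :
  x \in frozen be (pickle x).+1 /\
  ((lower be (pickle x).+1)^-1)%g x \in frozen be (pickle x).+1.
Proof. by rewrite frozenS /new_frozen pickleK_inv !inE !eqxx !orbT. Qed.

Lemma frozen_pickle be n d : d \in frozen be n ->
  (pickle d < n)%N \/ (pickle (lower be n d) < n)%N.
Proof.
elim: n => // n IHn; rewrite frozenS mem_cat => /orP[|dD]; last first.
  rewrite (lower_frozen (leqnSn n) dD).
  by case: (IHn dD) => lt_n; [left|right]; exact: ltn_trans lt_n _.
rewrite /new_frozen; have := @pickle_invK rat n; case: pickle_inv => //= x xn.
by rewrite !inE => /orP[]/eqP->; [left|right; rewrite autQVK]; rewrite xn.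
Qed.

Lemma eq_branch be be' n : (forall i, (i < n)%N -> be i = be' i) ->
  branch be n = branch be' n.
Proof.
elim: n => //= n IHn eq_be; rewrite IHn => [|i /ltnW]; last exact: eq_be.
by rewrite eq_be.
Qed.

Lemma limit_exists be :
  exists f : autQ, forall n x, x \in frozen be n -> f x = lower be n x.
Proof.
pose F x := lower be (pickle x).+1 x.
have F_frozen n x : x \in frozen be n -> F x = lower be n x.
  move=> xD; have [xD' _] := mem_new_frozen be x; rewrite /F.
  have [lt_xn|le_nx] := leqP (pickle x).+1 n;
    first by rewrite (lower_frozen lt_xn).
  by rewrite (lower_frozen (ltnW le_nx)).
have [x y xy|y|f fF] := @autQ_of_homo_onto F.
- pose n := maxn (pickle x).+1 (pickle y).+1.
  have mem_n z : (pickle z < n)%N -> z \in frozen be n.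
    by move=> /(frozen_sub (be := be)); apply; have [] := mem_new_frozen be z.
  by rewrite !(F_frozen n) ?autQ_mono // mem_n ?leq_maxl ?leq_maxr.
- have [_ yD] := mem_new_frozen be y.
  by exists ((lower be (pickle y).+1)^-1 y)%g; rewrite (F_frozen _ _ yD) autQVK.
by exists f => n x xD; rewrite fF (F_frozen n).
Qed.

Definition limit be : autQ := sval (cid (limit_exists be)).

Lemma limit_frozen be n x : x \in frozen be n -> limit be x = lower be n x.
Proof. exact: (svalP (cid (limit_exists be))). Qed.

Lemma limit_between be n z : lower be n z <= limit be z <= upper be n z.
Proof.
have [zD _] := mem_new_frozen be z; pose m := maxn n (pickle z).+1.
rewrite (@limit_frozen be m) ?(frozen_sub _ zD) ?leq_maxr //.
rewrite lower_le ?leq_maxl //=.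
by rewrite (le_trans (lower_le_upper _ _ _)) // upper_ge ?leq_maxl.
Qed.

Lemma limit_local be be' x : (forall i, (i <= pickle x)%N -> be i = be' i) ->
  limit be x = limit be' x.
Proof.
move=> eq_be; have [xD _] := mem_new_frozen be x.
have e : branch be (pickle x).+1 = branch be' (pickle x).+1 by exact: eq_branch.
rewrite (limit_frozen xD).
by rewrite (@limit_frozen be' (pickle x).+1) /lower /frozen -?e.
Qed.

Section first_difference.
Variables (be be' : nat -> bool) (n : nat).
Hypothesis eq_be : forall i, (i < n)%N -> be i = be' i.
Hypotheses (be_n : be n = false) (be'_n : be' n = true).

Lemma limit_gapped x y : gapped_on x y (frozen be n) (limit be) (limit be').
Proof.
move=> a b _ _ /cdist_gt[e e0 e_lt].
have lower_eq : lower be' n = lower be n by rewrite /lower (eq_branch eq_be).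
have frozen_eq : frozen be' n = frozen be n.
  by rewrite /frozen (eq_branch eq_be).
exists (slack n.+1 * e) => [|z w abz abw wz].
  by rewrite mulr_gt0 ?slack_gt0.
have /andP[_ lim_w] := limit_between be n.+1 w.
have /andP[lim_z _] := limit_between be' n.+1 z.
apply: le_lt_trans lim_w (lt_le_trans _ lim_z).
rewrite /upper frozenS !lowerS be_n be'_n lower_eq frozen_eq !autQM.
rewrite autQ_mono; apply: le_lt_trans (nudge_cat_le _ _ _ _) _.
rewrite autQ_mono.
by apply: le_lt_trans wz _; rewrite nudgeE ltrD2l ltr_pM2l ?slack_gt0 ?e_lt.
Qed.

Lemma limit_coincidence x : limit be x = limit be' x ->
  (pickle x < n)%N \/ (pickle (limit be x) < n)%N.
Proof.
have [xD|xnD] := boolP (x \in frozen be n).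
  by rewrite (limit_frozen xD) => _; exact: frozen_pickle.
have [||d dD|e e0 gap_e] := @limit_gapped x x x x; try exact: lexx.
  by apply: contra xnD; rewrite -eq_le => /eqP->.
by have := gap_e x x; rewrite lexx lerDl ltW // => /(_ isT isT isT)/lt_eqF/eqP.
Qed.

End first_difference.

End monotone_family.

(** * Touching adjacent orbitals *)

Section mirror.
Implicit Types (f g : autQ) (x y z : rat).

Lemma mirror_bij f : bijective (fun z => - f (- z)).
Proof.
by exists (fun z => - (f^-1)%g (- z)) => z; rewrite opprK ?autQK ?autQVK opprK.
Qed.

Lemma mirror_mono f : {mono (fun z => - f (- z)) : x y / x < y}.
Proof. by move=> x y; rewrite ltrN2 autQ_mono ltrN2. Qed.

Definition mirror f : autQ := AutQ (mirror_bij f) (@mirror_mono f).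

Lemma mirrorM f g : mirror (f * g)%g = (mirror f * mirror g)%g.
Proof. by apply: autQ_ext => z; rewrite autQM /= opprK. Qed.

Lemma mirrorX f n : mirror (f ^+ n)%g = (mirror f ^+ n)%g.
Proof.
elim: n => [|n IHn]; first by apply: autQ_ext => z; rewrite /= opprK.
by rewrite !expgS mirrorM IHn.
Qed.

Lemma expgz_mirror f n : expgz (mirror f) n = mirror (expgz f n).
Proof.
case: n => n /=; rewrite -?mirrorX //; apply/mulg1_eq.
by rewrite -mirrorM mulgV; apply: autQ_ext => z; rewrite /= opprK.
Qed.

Lemma orbital_mirror f x y : orbital (mirror f) x y <-> orbital f (- x) (- y).
Proof.
have flip m n : (expgz (mirror f) m x <= y <= expgz (mirror f) n x) =
    (expgz f n (- x) <= - y <= expgz f m (- x)).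
  by rewrite !expgz_mirror /= [- _ <= y]lerNl [y <= - _]lerNr andbC.
split=> /orbitalP[m [n mn]]; apply/orbitalP; exists n, m;
  first by rewrite -flip.
by rewrite flip.
Qed.

End mirror.

Section crossing_gaps.
Implicit Types (D : seq rat) (h : autQ) (a b d e x y z w : rat).

Lemma gapped_on_sub D (F U : rat -> rat) x y x' y' : x <= x' -> y' <= y ->
  gapped_on x y D F U -> gapped_on x' y' D F U.
Proof.
by move=> xx yy gap a b xa yb; apply: gap;
  [exact: le_trans xa|exact: le_trans yy].
Qed.

Lemma gapped_on_cons d D (F U : rat -> rat) x y : ~~ (x <= d <= y) ->
  gapped_on x y (d :: D) F U -> gapped_on x y D F U.
Proof.
move=> nd gap a b xa yb nD; apply: gap => // c;
  rewrite inE => /predU1P[->|/nD//].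
by apply: contra nd => /andP[ad db]; rewrite (le_trans xa) // (le_trans db).
Qed.

Lemma gapped_on_mull D (F U : rat -> rat) x y h : gapped_on x y D F U ->
  gapped_on x y D (h \o F) (h \o U).
Proof.
move=> gap a b xa yb nD; have [e e0 gap_e] := gap a b xa yb nD.
by exists e => // z w az aw wz; rewrite /= autQ_mono gap_e.
Qed.

Lemma gapped_on_opp D (F U : rat -> rat) x y : gapped_on x y D F U ->
  gapped_on (- y) (- x) (map -%R D) (fun z => - U (- z)) (fun z => - F (- z)).
Proof.
have oppI a b z : (a <= z <= b) = (- b <= - z <= - a) by rewrite !lerN2 andbC.
move=> gap a b ya bx nD; have [|||e e0 gap_e] := gap (- b) (- a).
- by rewrite lerNr.
- by rewrite lerNl.
- by move=> d dD; rewrite -[d]opprK -oppI; apply: nD; exact: map_f.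
exists e => // z w abz abw wz; rewrite ltrN2 gap_e -?oppI //; lra.
Qed.

(* The orbit of x under h' advances by e as long as it remains below y, since
   h' z > h w > w for w = min(y, z + e). *)
Lemma gap_orbital_free h (h' : autQ) x y e : x <= y -> 0 < e ->
  (forall z, x <= z <= y -> z < h z) ->
  (forall z w, x <= z <= y -> x <= w <= y -> w <= z + e -> h w < h' z) ->
  orbital h' x y.
Proof.
move=> xy e0 h_up gap; apply: contrapT => nxy.
have orbit_lt n : (h' ^+ n)%g x < y.
  rewrite ltNge; apply/negP => yn; apply: nxy; apply/orbitalP.
  by exists 0, (n : int); rewrite /= xy.
have orbit_ge n : x + e * n%:R <= (h' ^+ n)%g x.
  elim: n => [|n IHn]; first by rewrite mulr0 addr0.
  have := orbit_lt n; have := orbit_lt n.+1; rewrite expgS autQM.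
  move: ((h' ^+ n)%g x) IHn => z xz h'z_lt z_lt.
  have xz' : x <= z by apply: le_trans xz; rewrite lerDl mulr_ge0 // ltW.
  pose w := Num.min y (z + e).
  have xwy : x <= w <= y by rewrite le_min xy ge_min lexx (le_trans xz') //
    lerDl ltW.
  have w_lt : w < h' z.
    apply: lt_trans (h_up w xwy) (gap _ _ _ xwy _); first by rewrite xz' ltW.
    by rewrite ge_min lexx orbT.
  have : z + e < h' z by move: w_lt; rewrite gt_min ltNge (ltW h'z_lt).
  rewrite -natr1; lra.
have := archi_boundP (divr_ge0 (_ : 0 <= y - x) (ltW e0)).
rewrite subr_ge0 => /(_ xy).
set n := Num.bound _; rewrite ltr_pdivrMr // => lt_n.
have := orbit_ge n; have := orbit_lt n; lra.
Qed.

Lemma gap_orbital_up D h (h' : autQ) x y : gapped_on x y D h h' -> x <= y ->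
  (forall z, x <= z <= y -> z < h z) -> (forall z, x <= z <= y -> z < h' z) ->
  orbital h' x y.
Proof.
elim: D x y => [|d D IHD] x y gap xy h_up h'_up.
  have [||//|e e0 gap_e] := gap x y; [exact: lexx..|].
  exact: gap_orbital_free xy e0 h_up gap_e.
have [/andP[xd dy]|nd] := boolP (x <= d <= y); last first.
  by apply: IHD; first exact: gapped_on_cons nd gap.
have h'd : d < h' d by rewrite h'_up ?xd.
have h'Vd : (h'^-1)%g d < d by rewrite autQV_lt.
apply: (@orbital_trans _ _ d).
  have od : orbital h' d ((h'^-1)%g d).
    by apply: orbital_sym; rewrite -{2}[d](autQVK h'); exact: orbital_autQ.
  have [le_xd|lt_dx] := leP x ((h'^-1)%g d); last first.
    by apply: orbital_sym; apply: (orbital_convex od (orbital_refl _ _));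
      rewrite ltW.
  apply: orbital_trans (orbital_sym od); apply: IHD => //.
  - apply: (@gapped_on_cons d); first by rewrite xd -ltNge.
    by apply: gapped_on_sub gap; rewrite ?(le_trans (ltW h'Vd)).
  - by move=> z /andP[xz zd]; rewrite h_up ?xz ?(le_trans zd)
      ?(le_trans (ltW h'Vd)).
  - by move=> z /andP[xz zd]; rewrite h'_up ?xz ?(le_trans zd)
      ?(le_trans (ltW h'Vd)).
have [le_dy|lt_yd] := leP (h' d) y; last first.
  by apply: (orbital_convex (orbital_refl _ _) (orbital_autQ _ _));
    rewrite dy ltW.
apply: orbital_trans (orbital_autQ h' d) _; apply: IHD => //.
- apply: (@gapped_on_cons d); first by rewrite negb_and -ltNge h'd.
  by apply: gapped_on_sub gap; rewrite ?(le_trans xd) // ltW.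
- by move=> z /andP[dz zy];
    rewrite h_up ?zy ?(le_trans xd) // (le_trans (ltW h'd)).
- by move=> z /andP[dz zy]; rewrite h'_up ?zy ?(le_trans xd) //
    (le_trans (ltW h'd)).
Qed.

Lemma gap_orbital_down D h (h' : autQ) x y : gapped_on x y D h h' -> x <= y ->
  (forall z, x <= z <= y -> h z < z) -> (forall z, x <= z <= y -> h' z < z) ->
  orbital h x y.
Proof.
move=> /gapped_on_opp gap xy h_down h'_down.
apply: orbital_sym; rewrite -[x]opprK -[y]opprK; apply/orbital_mirror.
apply: (@gap_orbital_up _ (mirror h') (mirror h)) gap _ _ _ => [|z|z].
- by rewrite lerN2.
- by rewrite lerNl lerNr andbC /= ltrNr => /h'_down.
- by rewrite lerNl lerNr andbC /= ltrNr => /h_down.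
Qed.

End crossing_gaps.

Definition adjacent_alike (h : autQ) x y := [/\ x < y, ~ orbital h x y &
  (forall z, x <= z <= y -> z < h z) \/ (forall z, x <= z <= y -> h z < z)].

Lemma not_alternating_adjacent (h : autQ) : ~ alternating_orbitals h ->
  exists x y, adjacent_alike h x y.
Proof.
move=> nalt; apply: contrapT => none; apply: nalt; apply/alternating_orbitalsP.
move=> x y xy nxy dir_xy dir0; apply: contrapT => same; apply: none.
have dir_z z : x <= z <= y -> direction h z = direction h x.
  move=> /andP[]; rewrite le_eqVlt => /predU1P[<-//|xz].
  rewrite le_eqVlt => /predU1P[->//|zy].
  by apply: contrapT => ndir; apply: same; exists z; rewrite // xz.
exists x, y; split=> //; case: (directionP h x) => dir_x //;
  [left|right] => z /dir_z.
  by rewrite dir_x => /eqP; rewrite direction_eq1.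
by rewrite dir_x => /eqP; rewrite direction_eqN1.
Qed.

(** * Borel sets of automorphisms *)

Section borel_properties.

Lemma measurable_expgz (n : int) (x y : rat) :
  measurable ([set f : autQ | expgz f n x = y] : set borelQ).
Proof.
have measurable_expg m u v :
    measurable ([set f : autQ | (f ^+ m)%g u = v] : set borelQ).
  elim: m u v => [|m IHm] u v.
    exact: (@measurable_prop_cst _ borelQ (u = v)).
  rewrite (_ : [set f | _] =
      [set f : autQ | exists w, (f ^+ m)%g u = w /\ f w = v]).
    by apply: measurable_prop_exists => w; apply: measurable_prop_and => //;
      exact: measurable_eval.
  by apply/seteqP; split=> f /=; rewrite expgS autQM;
    [exists ((f ^+ m)%g u)|case=> w [->]].
case: n => n; first exact: measurable_expg.
rewrite (_ : [set f | _] = [set f : autQ | (f ^+ n.+1)%g y = x]).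
  exact: measurable_expg.
by apply/seteqP; split=> f /= <-; rewrite ?autQVK ?autQK.
Qed.

Lemma measurable_orbital (x y : rat) :
  measurable ([set f : autQ | orbital f x y] : set borelQ).
Proof.
rewrite (_ : [set f | _] = [set f : autQ | exists m n : int,
    expgz f m x <= y /\ y <= expgz f n x]).
  apply: measurable_prop_exists => m; apply: measurable_prop_exists => n.
  apply: measurable_prop_and.
    exact: (@measurable_pred_countable _ borelQ rat (fun f : autQ => _)
      (fun z => z <= y) (measurable_expgz m x)).
  exact: (@measurable_pred_countable _ borelQ rat (fun f : autQ => _)
    (fun z => y <= z) (measurable_expgz n x)).
apply/seteqP; split=> f /=.
  by move=> /orbitalP[m [n /andP[]]]; exists m, n.
by move=> [m [n [mx xn]]]; apply/orbitalP; exists m, n; rewrite mx.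
Qed.

Lemma measurable_direction (x : rat) (c : int) :
  measurable ([set f : autQ | direction f x = c] : set borelQ).
Proof.
exact: (measurable_pred_countable (fun y => sgz (y - x) = c)
                                  (measurable_eval x)).
Qed.

Lemma measurable_alternating_orbitals :
  measurable ([set f : autQ | alternating_orbitals f] : set borelQ).
Proof.
rewrite (_ : [set f | _] = [set f : autQ | forall x y, x < y ->
  ~ orbital f x y ->
    direction f x = direction f y -> direction f x <> 0 ->
    exists z, x < z < y /\ direction f z <> direction f x]); last first.
  apply/seteqP; split=> f /=.
    move=> /alternating_orbitalsP alt x y xy nxy dir_xy dir0.
    by have [z] := alt x y xy nxy dir_xy dir0; exists z.
  move=> alt; apply/alternating_orbitalsP => x y xy nxy dir_xy dir0.
  by have [z []] := alt x y xy nxy dir_xy dir0; exists z.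
have direction_eq_measurable u v :
    measurable ([set f : autQ | direction f u = direction f v] : set borelQ).
  by apply: measurable_eq_countable => c; exact: measurable_direction.
apply: measurable_prop_forall => x; apply: measurable_prop_forall => y.
apply: measurable_prop_imply; first exact: measurable_prop_cst.
apply: measurable_prop_imply.
  by apply: measurable_prop_not; exact: measurable_orbital.
apply: measurable_prop_imply; first exact: direction_eq_measurable.
apply: measurable_prop_imply.
  by apply: measurable_prop_not; exact: measurable_direction.
apply: measurable_prop_exists => z.
apply: measurable_prop_and; first exact: measurable_prop_cst.
by apply: measurable_prop_not; exact: direction_eq_measurable.
Qed.

Lemma measurable_generic_autQ :
  measurable ([set f | generic_autQ f] : set borelQ).
Proof.
apply: measurable_prop_and; first exact: measurable_alternating_orbitals.
rewrite (_ : [set f | _] =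
    [set f : autQ | exists s : seq rat, forall x, f x = x -> x \in s]).
  apply: measurable_prop_exists => s; apply: measurable_prop_forall => x.
  by apply: measurable_prop_imply;
    [exact: measurable_eval|exact: measurable_prop_cst].
apply/seteqP; split=> f /=.
  move=> /finite_seqP[s sE]; exists s => x fx.
  by have : fixed_points f x by []; rewrite sE.
move=> [s fix_s]; apply: (@sub_finite_set _ _ [set` s]); last exact: finite_seq.
by move=> x fx; exact: fix_s.
Qed.

Lemma measurable_fun_autQ d (T : measurableType d) (phi : T -> borelQ) :
  (forall x y, measurable [set t | (phi t : autQ) x = y]) ->
  measurable_fun setT phi.
Proof.
move=> mphi; apply: (@measurability _ _ _ borelQ setT phi (@open autQ)) => //.
move=> _ [W oW <-]; rewrite setTI.
rewrite (_ : phi @^-1` W = [set t | exists s : seq (rat * rat),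
    (forall g : autQ, (forall z, z \in s -> g z.1 = z.2) -> W g) /\
    forall z, z \in s -> (phi t : autQ) z.1 = z.2]).
  apply: measurable_prop_exists => s.
  apply: measurable_prop_and; first exact: measurable_prop_cst.
  apply: measurable_prop_forall => z; apply: measurable_prop_imply => //.
  exact: measurable_prop_cst.
apply/seteqP; split=> t /=; last by move=> [s [sW agree]]; exact: sW.
move=> Wt; have /nbhs_autQP[s sW] := open_nbhs_nbhs (conj oW Wt).
exists [seq (x, (phi t : autQ) x) | x <- s];
  split=> [g g_agree|z /mapP[x _ ->]//].
by apply: sW => x xs; have := g_agree (x, (phi t : autQ) x); apply;
  exact: map_f.
Qed.

End borel_properties.

(** * Binary digits *)

Section binary_digits.
Variable R : realType.
Implicit Types t : R.

Definition dyadic n t : nat := Num.truncn (2 ^+ n * t).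
Definition digit n t : bool := odd (dyadic n.+1 t).

Lemma dyadic_bounds n t : 0 <= t ->
  (dyadic n t)%:R / 2 ^+ n <= t < (dyadic n t).+1%:R / 2 ^+ n.
Proof.
move=> t0; rewrite ler_pdivrMr ?ltr_pdivlMr ?exprn_gt0 // [t * _]mulrC.
by apply: truncn_itv; rewrite mulr_ge0 // exprn_ge0.
Qed.

Lemma dyadic_half n t : 0 <= t -> dyadic n t = (dyadic n.+1 t)./2.
Proof.
move=> t0; have /andP[le_t lt_t] := dyadic_bounds n.+1 t0.
have p : 0 < 2 ^+ n.+1 :> R by rewrite exprn_gt0.
apply: truncn_def; move: le_t lt_t.
rewrite ler_pdivrMr // ltr_pdivlMr // [t * _]mulrC exprS -mulrA.
set x := 2 ^+ n * t; set j := dyadic n.+1 t => le_j lt_j.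
have : (j./2.*2 <= j)%N by rewrite -{2}(odd_double_half j) leq_addl.
have : (j.+1 <= j./2.+1.*2)%N.
  by rewrite -{1}(odd_double_half j) doubleS; case: (odd j).
rewrite -!(ler_nat R) -!muln2 !natrM => odd_j even_j; apply/andP; split; lra.
Qed.

Lemma dyadicS n t : 0 <= t -> dyadic n.+1 t = ((dyadic n t).*2 + digit n t)%N.
Proof. by move=> t0; rewrite (dyadic_half n t0) addnC odd_double_half. Qed.

Lemma dyadic0 t : 0 <= t < 1 -> dyadic 0 t = 0%N.
Proof. by move=> t01; apply: truncn_def; rewrite expr0 mul1r. Qed.

Lemma eq_dyadic n t t' : 0 <= t < 1 -> 0 <= t' < 1 ->
  (forall i, (i < n)%N -> digit i t = digit i t') -> dyadic n t = dyadic n t'.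
Proof.
move=> t01 t01'; have [/andP[t0 _] /andP[t0' _]] := (t01, t01').
elim: n => [|n IHn] eq_dig; first by rewrite !dyadic0.
by rewrite !dyadicS // eq_dig // IHn // => i /ltnW; exact: eq_dig.
Qed.

Lemma dyadic_neq t t' : 0 <= t -> t < t' -> exists n, dyadic n t != dyadic n t'.
Proof.
move=> t0 tt'; have t0' : 0 <= t' by exact/ltW/(le_lt_trans t0).
have gap0 : 0 <= (t' - t)^-1 by rewrite invr_ge0 subr_ge0 ltW.
have := archi_boundP gap0; set n := Num.bound _ => lt_n.
exists n; apply/eqP => e.
have /andP[le_t _] := dyadic_bounds n t0; have /andP[_] := dyadic_bounds n t0'.
rewrite -e -natr1 mulrDl mul1r => lt_t'.
have : t' - t < (2 ^+ n)^-1 by lra.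
rewrite -[X in X < _]invrK ltf_pV2 ?posrE ?invr_gt0 ?exprn_gt0 ?subr_gt0 //.
move=> /lt_trans/(_ lt_n); rewrite -natrX ltr_nat.
by rewrite ltnNge ltnW // ltn_expl.
Qed.

Lemma first_digit t t' : 0 <= t < 1 -> 0 <= t' < 1 -> t < t' ->
  exists n, [/\ forall i, (i < n)%N -> digit i t = digit i t',
    digit n t = false & digit n t' = true].
Proof.
move=> t01 t01' tt'; have [/andP[t0 _] /andP[t0' _]] := (t01, t01').
have [n neq_n n_min] := ex_minnP (dyadic_neq t0 tt').
case: n neq_n n_min => [|n] neq_n n_min; first by rewrite !dyadic0 ?eqxx
  in neq_n.
have eq_dy i : (i <= n)%N -> dyadic i t = dyadic i t'.
  by move=> i_n; apply/eqP; apply: contraTT i_n => /n_min; rewrite -ltnNge.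
exists n; have le_dy : (dyadic n.+1 t <= dyadic n.+1 t')%N.
  by apply: le_truncn; rewrite ler_pM2l ?exprn_gt0 // ltW.
move: neq_n le_dy; rewrite !dyadicS // (eq_dy n) // eqn_add2l leq_add2l.
case: (digit n t); case: (digit n t') => // _ _.
by split=> // i i_n; rewrite /digit eq_dy.
Qed.

Lemma measurable_dyadic n m :
  measurable ([set t | dyadic n t = m] : set (measurableTypeR R)).
Proof.
have measurable_gt k :
  measurable ([set t | (k < dyadic n t)%N] : set (measurableTypeR R)).
  rewrite (_ : [set t | _] = `[k.+1%:R / 2 ^+ n, +oo[%classic) //.
  apply/seteqP; split=> t; rewrite /= in_itv /= andbT truncn_gt_nat;
    by rewrite ler_pdivrMr ?exprn_gt0 // mulrC.
case: m => [|m].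
  rewrite (_ : [set t | _] = [set t | ~ (0 < dyadic n t)%N]).
    exact: measurable_prop_not.
  by apply/seteqP; split=> t /=; [move->|case: dyadic => // ? []].
rewrite (_ : [set t | _] =
  [set t | (m < dyadic n t)%N /\ ~ (m.+1 < dyadic n t)%N]).
  by apply: measurable_prop_and => //; exact: measurable_prop_not.
apply/seteqP; split=> t /= => [->|[lt_m]]; first by rewrite ltnn.
by move=> /negP; rewrite -leqNgt => le_m; apply/eqP; rewrite eqn_leq le_m.
Qed.

Lemma measurable_digit n (c : bool) :
  measurable ([set t | digit n t = c] : set (measurableTypeR R)).
Proof.
exact: (measurable_pred_countable (fun m => odd m = c)
                                  (measurable_dyadic n.+1)).
Qed.

End binary_digits.

(** * The random automorphism *)

Section random_automorphism.
Variable R : realType.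
Implicit Types (t : R) (x y q : rat) (j k : autQ).

Definition random_autQ t : autQ := limit (fun n => digit n t).

Lemma random_autQ_gapped t t' x y : 0 <= t < 1 -> 0 <= t' < 1 -> t < t' ->
  exists D, gapped_on x y D (random_autQ t) (random_autQ t').
Proof.
move=> t01 t01' tt'; have [n [eq_dig dig dig']] := first_digit t01 t01' tt'.
by exists (frozen (fun i => digit i t) n); exact: limit_gapped.
Qed.

Lemma random_autQ_coincidence t t' x m : 0 <= t < 1 -> 0 <= t' < 1 ->
  random_autQ t x = random_autQ t' x -> (m <= pickle x)%N ->
  (m <= pickle (random_autQ t x))%N -> dyadic m.+1 t = dyadic m.+1 t'.
Proof.
wlog tt' : t t' / t < t' => [hwlog|] t01 t01' eq_x mx my.
  have [tt'|t't|->//] := ltgtP t t'; first exact: hwlog.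
  by apply/esym/hwlog; rewrite -?eq_x.
have [n [eq_dig dig dig']] := first_digit t01 t01' tt'.
have n_gt : (m < n)%N.
  have [] := limit_coincidence eq_dig dig dig' eq_x; exact: leq_ltn_trans.
by apply: eq_dyadic => // i im; apply: eq_dig; exact: leq_trans im n_gt.
Qed.

Lemma measurable_random_autQ_eval x y :
  measurable ([set t | random_autQ t x = y] : set (measurableTypeR R)).
Proof.
pose digits l : nat -> bool := nth false l.
rewrite (_ : [set t | _] = [set t | exists l : seq bool,
    (forall i, (i <= pickle x)%N -> digit i t = digits l i) /\
      limit (digits l) x = y]).
  apply: measurable_prop_exists => l.
  apply: measurable_prop_and; last exact: measurable_prop_cst.
  apply: measurable_prop_forall => i.
  apply: measurable_prop_imply; first exact: measurable_prop_cst.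
  exact: measurable_digit.
apply/seteqP; split=> t /=; last by move=> [l [eq_l <-]]; exact: limit_local.
move=> t_x; exists (mkseq (fun n => digit n t) (pickle x).+1).
have eq_l i : (i <= pickle x)%N ->
  digit i t = digits (mkseq (fun n => digit n t) (pickle x).+1) i.
  by move=> ix; rewrite /digits nth_mkseq.
by split=> //; rewrite -t_x; exact/esym/limit_local.
Qed.

Definition random_borelQ : measurableTypeR R -> borelQ := random_autQ.

Lemma measurable_random_borelQ : measurable_fun setT random_borelQ.
Proof. exact: measurable_fun_autQ measurable_random_autQ_eval. Qed.

HB.instance Definition _ :=
  isMeasurableFun.Build _ _ _ _ random_borelQ measurable_random_borelQ.

Definition random_law : probability borelQ R :=
  distribution (uniform_prob (@ltr01 R)) random_borelQ.

Lemma uniform_prob_negligible (A : set (measurableTypeR R)) : measurable A ->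
  (@lebesgue_measure R).-negligible [set t | 0 <= t < 1 /\ A t] ->
  uniform_prob (@ltr01 R) A = 0%E.
Proof.
move=> mA nA.
have mA01 : measurable (A `&` `[(0 : R), 1]%classic) by exact: measurableI.
have -> : uniform_prob (@ltr01 R) A =
    uniform_prob (@ltr01 R) (A `&` `[(0 : R), 1]%classic).
  by rewrite /uniform_prob integral_uniform_pdf [RHS]integral_uniform_pdf
    -setIA setIid.
have /null_content_dominatesP := @dominates_uniform_prob R 0 1 (@ltr01 R).
apply=> //; apply: (measure_negligible mA01).
have sub : A `&` `[(0 : R), 1]%classic `<=`
    [set t | 0 <= t < 1 /\ A t] `|` [set 1].
  move=> t [At /=]; rewrite in_itv /= => /andP[t0]; rewrite le_eqVlt.
  by move=> /predU1P[->|t1]; [right|left; rewrite t0].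
apply: (negligibleS (mu := @lebesgue_measure R) sub); apply: negligibleU => //.
by exists [set 1]; split=> //; exact: lebesgue_measure_set1.
Qed.

(* Two parameters with the same adjacent orbitals would contradict the gap
   between their automorphisms. *)
Lemma adjacent_alike_negligible k x y : (@lebesgue_measure R).-negligible
  [set t | 0 <= t < 1 /\ adjacent_alike (k * random_autQ t)%g x y].
Proof.
pose Adj (up : bool) := [set t | [/\ 0 <= t < 1, x < y,
  ~ orbital (k * random_autQ t)%g x y & forall z, x <= z <= y ->
    if up then z < (k * random_autQ t)%g z else (k * random_autQ t)%g z < z]].
have negligible_Adj up : (@lebesgue_measure R).-negligible (Adj up).
  have subsingleton t t' : Adj up t -> Adj up t' -> t < t' -> False.
    move=> [t01 xy nxy dir] [t01' _ nxy' dir'] tt'.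
    have [D gap] := random_autQ_gapped x y t01 t01' tt'.
    have {}gap : gapped_on x y D (k * random_autQ t)%g (k * random_autQ t')%g.
      exact: gapped_on_mull.
    case: up dir dir' => dir dir'.
      by apply: nxy'; apply: (gap_orbital_up gap) => //; exact: ltW.
    by apply: nxy; apply: (gap_orbital_down gap) => //; exact: ltW.
  have [[t At]|nA] := pselect (exists t, Adj up t); last first.
    rewrite (_ : Adj up = set0); first exact: negligible_set0.
    by rewrite -subset0 => t At; apply: nA; exists t.
  exists [set t]; split=> //; first exact: lebesgue_measure_set1.
  move=> t' At'; have [lt_t't|lt_tt'|//] := ltgtP t' t; exfalso.
    exact: subsingleton At' At lt_t't.
  exact: subsingleton At At' lt_tt'.
apply: (negligibleS (mu := @lebesgue_measure R))
  (_ : _ `<=` Adj true `|` Adj false) _.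
  by move=> t [t01 [xy nxy [up|down]]]; [left|right].
exact: negligibleU.
Qed.

Lemma coincidence_small x y m : exists J : set (measurableTypeR R),
  [/\ measurable J, (lebesgue_measure J <= (1 / (2 ^ m.+1)%:R)%:E)%E &
    forall t, 0 <= t < 1 -> (m <= pickle x)%N -> (m <= pickle y)%N ->
      random_autQ t x = y -> J t].
Proof.
have [[t0 [[t01 mx my] e0]]|none] := pselect (exists t,
    [/\ 0 <= t < 1, (m <= pickle x)%N & (m <= pickle y)%N] /\
      random_autQ t x = y);
  last first.
  exists set0; split=> //; first by rewrite measure0 lee_fin.
  by move=> t t01 mx my e; apply: none; exists t.
pose c : R := (dyadic m.+1 t0)%:R / 2 ^+ m.+1.
pose c' : R := (dyadic m.+1 t0).+1%:R / 2 ^+ m.+1.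
exists [set` `[c, c'[]; split; first exact: measurable_itv.
  have cc' : c' - c = 1 / (2 ^ m.+1)%:R.
    by rewrite /c /c' -mulrBl -natr1 addrAC subrr add0r natrX.
  rewrite lebesgue_measure_itv /=; case: ifP => _; last by rewrite lee_fin.
  by rewrite -EFinB cc'.
move=> t t_01 _ _ e; rewrite /= in_itv /= /c /c'.
have -> : dyadic m.+1 t0 = dyadic m.+1 t.
  by apply: (random_autQ_coincidence (x := x)); rewrite ?e0 ?e.
by apply: dyadic_bounds; case/andP: t_01.
Qed.

Lemma coincidence_index_small j m : exists J : set (measurableTypeR R),
  [/\ measurable J, (lebesgue_measure J <= (2 / (2 ^ m.+1)%:R)%:E)%E &
  forall t q, 0 <= t < 1 -> minn (pickle q) (pickle (j q)) = m ->
    random_autQ t q = j q -> J t].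
Proof.
pose q : rat := odflt 0 (unpickle m).
have [J1 [mJ1 le_J1 J1P]] := coincidence_small q (j q) m.
have [J2 [mJ2 le_J2 J2P]] := coincidence_small ((j^-1)%g q) q m.
exists (J1 `|` J2); split; first exact: measurableU.
  apply: le_trans (measureU2 _ mJ1 mJ2) _.
  apply: le_trans (leeD le_J1 le_J2) _.
  by rewrite -EFinD lee_fin -mulrDl.
move=> t p t01 minm e.
have [mp mjp] : (m <= pickle p)%N /\ (m <= pickle (j p))%N.
  by rewrite -minm geq_minl geq_minr.
have [le_p|/ltnW le_jp] := leqP (pickle p) (pickle (j p)).
  have qE : q = p by rewrite /q -minm (minn_idPl le_p) pickleK.
  by left; apply: J1P; rewrite ?qE.
have qE : q = j p by rewrite /q -minm (minn_idPr le_jp) pickleK.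
by right; apply: J2P; rewrite ?qE ?autQK.
Qed.

(* Borel-Cantelli, for the events indexed by the minimum of the indices of q
   and j q: each minimum is reached by at most two points q. *)
Lemma infinite_coincidence_negligible j : (@lebesgue_measure R).-negligible
  [set t | 0 <= t < 1 /\ ~ finite_set [set q | random_autQ t q = j q]].
Proof.
have /choice[J JP] := coincidence_index_small j.
have mJ m : measurable (J m) by have [] := JP m.
have sum_lt : (\big[+%E/0%R]_(0 <= m <oo) lebesgue_measure (J m) < +oo)%E.
  apply: (@le_lt_trans _ _ (2 : R)%:E); last by rewrite ltry.
  apply: le_trans (@epsilon_trick0 R 2 predT _); last by [].
  by apply: lee_nneseries => // m _; have [] := JP m.
apply: (negligibleS (mu := @lebesgue_measure R))
  (_ : _ `<=` lim_sup_set J) _; last first.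
  exists (lim_sup_set J); split=> //; last exact: lim_sup_set_cvg0.
  by apply: bigcapT_measurable => n; apply: bigcup_measurable => m _; exact: mJ.
move=> t [t01 inf] n _; apply: contrapT => notJ; apply: inf.
apply: (@sub_finite_set _ _ ([set q : rat | (pickle q < n)%N] `|`
    [set (j^-1)%g q | q in [set q : rat | (pickle q < n)%N]])); last first.
  rewrite finite_setU.
  by split; [|apply: finite_image]; exact: finite_pickle_lt.
move=> q e; have [|nq] := ltnP (pickle q) n; first by left.
have [lt_jq|njq] := ltnP (pickle (j q)) n.
  by right; exists (j q); rewrite ?autQK.
exfalso; apply: notJ; exists (minn (pickle q) (pickle (j q))).
  by rewrite /= leq_min nq.
by have [_ _] := JP (minn (pickle q) (pickle (j q))); apply.
Qed.

Lemma random_autQ_generic k : (@lebesgue_measure R).-negligible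
  [set t | 0 <= t < 1 /\ ~ generic_autQ (k * random_autQ t)%g].
Proof.
apply: (negligibleS (mu := @lebesgue_measure R)) (_ : _ `<=`
    [set t | exists xy : rat * rat, 0 <= t < 1 /\
      adjacent_alike (k * random_autQ t)%g xy.1 xy.2] `|`
    [set t | 0 <= t < 1 /\
      ~ finite_set [set q | random_autQ t q = (k^-1)%g q]]) _.
  move=> t [t01 /not_andP[/not_alternating_adjacent[x [y adj]]|inf]].
    by left; exists (x, y).
  right; split=> // fin; apply: inf; apply: sub_finite_set fin => q /= kq.
  by rewrite -[in RHS]kq autQM autQK.
apply: negligibleU; last exact: infinite_coincidence_negligible.
by apply: negligible_exists => -[x y]; exact: adjacent_alike_negligible.
Qed.

Theorem almost_every_generic_autQ : almost_every R generic_autQ.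
Proof.
pose B := [set f : autQ | ~ generic_autQ f].
have mB : measurable (B : set borelQ).
  by apply: measurable_prop_not; exact: measurable_generic_autQ.
exists B => //; split=> //; exists random_law => g h.
have mT : measurable (translate g B h : set borelQ) by exact: borel_translate.
rewrite /random_law /distribution /= /pushforward.
apply: uniform_prob_negligible.
  by rewrite -[X in measurable X]setTI; exact: measurable_random_borelQ.
pose k := (h^-1 * g^-1)%g.
apply: (negligibleS (mu := @lebesgue_measure R)) _ (random_autQ_generic k).
move=> t [t01]; rewrite translateE /preimage /= => nB.
split=> // gen; apply: nB.
have -> : (g^-1 * random_autQ t * h^-1)%g = ((k * random_autQ t) ^ (h^-1))%g.
  by rewrite conjgE /k invgK !mulgA mulgV mul1g.
exact: generic_autQJ.
Qed.

End random_automorphism.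

Lemma conj_class_generic (f f' : autQ) :
  conj_class f f' -> generic_autQ f -> generic_autQ f'.
Proof. by move=> [g _ <-]; exact: generic_autQJ. Qed.

Lemma not_haar_null_generic (R : realType) (f : autQ) :
  ~ haar_null R (conj_class f) -> generic_autQ f.
Proof.
move=> nnull; apply: contrapT => ngen; apply: nnull.
have [B nullB subB] := almost_every_generic_autQ R.
exists B => // f' ff'; apply: subB => gen_f'; apply: ngen.
exact: conj_class_generic (conj_class_sym ff') gen_f'.
Qed.

Theorem theorem3p2 (R : realType) :
  [/\ almost_every R (fun f : autQ =>
        alternating_orbitals f /\ finitely_many_fixed_points f),
      forall C : set autQ, conjugacy_class C ->
        (~ haar_null R C <->
           exists f, C f /\
             (alternating_orbitals f /\ finitely_many_fixed_points f)) /\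
        ((exists f, C f /\
             (alternating_orbitals f /\ finitely_many_fixed_points f)) <->
         (forall f, C f ->
             alternating_orbitals f /\ finitely_many_fixed_points f)),
      forall C : set autQ, conjugacy_class C ->
        ~ haar_null R C -> compact_biter C
    & forall C : set autQ, conjugacy_class C ->
        ~ haar_null R C -> (forall f, C f -> fixed_points f = set0) ->
        compact_catcher C].
Proof.
have in_class (f : autQ) : conj_class f f by exact: conj_class_refl.
have gen_class (f : autQ) :
  (exists f', conj_class f f' /\ generic_autQ f') -> generic_autQ f.
  by move=> [f' [/conj_class_sym ff' gen_f']];
    exact: conj_class_generic ff' gen_f'.
split.
- exact: almost_every_generic_autQ.
- move=> _ [f ->]; rewrite -/(conj_class f); split; split.
  + move=> /not_haar_null_generic gen_f.
    by exists f; split; first exact: in_class.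
  + by move=> /gen_class; exact: generic_conj_class_not_haar_null.
  + by move=> /gen_class gen_f f' ff'; exact: conj_class_generic ff' gen_f.
  + by move=> gen; exists f; split; [exact: in_class|exact/gen/in_class].
- move=> _ [f ->] /not_haar_null_generic; exact: conj_class_compact_biter.
- move=> _ [f ->] /not_haar_null_generic gen_f no_fix.
  exact: conj_class_compact_catcher gen_f (no_fix f (in_class f)).
Qed.
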